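(* Fix an integer $r$. Then: (i) for $k=k(m)$ with $k=o(m)$ and every balanced sequence $\nu\vdash mk$, $\langle\psi_r^{(m^k)},\chi^\nu\rangle\sim f^\nu/(m^kk!)$ as $m\to\infty$; (ii) if $\sigma_n$ is uniformly random in $\mathfrak S_n$ with cycle type $\lambda(\sigma_n)$, $(\nu_n)$ is a balanced sequence with $\nu_n\vdash n$, and $R_n$ is defined by $\langle\psi_r^{\lambda(\sigma_n)},\chi^{\nu_n}\rangle=\frac{f^{\nu_n}}{z_{\lambda(\sigma_n)}}(1+R_n)$, then $\mathrm{Prob}(|R_n|>\varepsilon)\to0$ for every $\varepsilon>0$. In particular (case $r=0$) both statements hold for the conjugacy characters $\phi^\lambda=\mathrm{Ind}_{Z_\lambda}^{\mathfrak S_n}\mathbf 1$, the characters of $\mathfrak S_n$ acting by conjugation on the span of the permutations of cycle type $\lambda$.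
   Context: For $\lambda=(1^{m_1}2^{m_2}\cdots)\vdash n$, $z_\lambda=\prod_i i^{m_i}m_i!$ and $Z_\lambda\cong\prod_i\mathfrak S_{m_i}[\mathbb Z_i]$ is the centralizer of a permutation of cycle type $\lambda$, with $\mathbb Z_i$ the cyclic group generated by an $i$-cycle. Let $\zeta_i$ be a primitive (faithful) linear character of $\mathbb Z_i$. For an integer $r$, $\psi^\lambda_r:=\mathrm{Ind}_{Z_\lambda}^{\mathfrak S_n}(\mathrm{id}_{m_1}[\zeta_1^r]\otimes\mathrm{id}_{m_2}[\zeta_2^r]\otimes\cdots)$, where $\mathrm{id}_{m_i}[\zeta_i^r]$ is the character of the wreath product $\mathfrak S_{m_i}[\mathbb Z_i]$ obtained from $\zeta_i^r$ and the trivial character of $\mathfrak S_{m_i}$; $\psi^\lambda_1$ is the higher Lie character. $(m^k)$ is the rectangle with $k$ rows of length $m$. For $\nu\vdash n$, $f^\nu$ is the number of standard Young tableaux of shape $\nu$ and $\chi^\nu$ the irreducible character. A sequence $\nu\vdash n$ is balanced if its first row and first column have length $\le a\sqrt n$ for a constant $a$. *)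

(* Defs.v *)
From mathcomp Require Import all_boot all_order all_algebra all_fingroup all_solvable all_field all_character.
Set Implicit Arguments.
Unset Strict Implicit.
Unset Printing Implicit Defensive.
Import GRing.Theory Num.Theory.
Local Open Scope ring_scope.

Definition is_partition (n : nat) (nu : seq nat) : bool :=
  [&& sorted geq nu, all (fun x => 0 < x)%N nu & sumn nu == n].

Definition conj_part (nu : seq nat) : seq nat :=
  [seq count (fun p => j < p)%N nu | j <- iota 0 (head 0%N nu)].

Definition zlambda (la : seq nat) : nat :=
  \prod_(1 <= i < (sumn la).+1) (i ^ count_mem i la * (count_mem i la)`!)%N.

Definition is_cell (nu : seq nat) (c : nat * nat) : bool := (c.2 < nth 0 nu c.1)%N.

Definition cell_of n (c : 'I_n * 'I_n) : nat * nat := (nat_of_ord c.1, nat_of_ord c.2).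

(* A standard Young tableau of shape nu |- n, described by the map sending
   each entry x in {0,...,n-1} to the cell containing it: injective, with
   values in the diagram (hence a bijection onto it), and increasing along
   rows and down columns. *)
Definition syt n (nu : seq nat) : {set {ffun 'I_n -> 'I_n * 'I_n}} :=
  [set t : {ffun 'I_n -> 'I_n * 'I_n} | [&& injectiveb t,
              [forall x, is_cell nu (cell_of (t x))] &
              [forall x, forall y,
                 ((((cell_of (t y)).1 == (cell_of (t x)).1) &&
                   ((cell_of (t y)).2 == (cell_of (t x)).2.+1)) ||
                  (((cell_of (t y)).1 == (cell_of (t x)).1.+1) &&
                   ((cell_of (t y)).2 == (cell_of (t x)).2))) ==> (x < y)%N]]].

Definition num_syt n (nu : seq nat) : nat := #|syt n nu|.

Definition ind_fun (gT : finGroupType) (G H : {set gT}) (phi : gT -> algC)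
  (g : gT) : algC :=
  #|H|%:R^-1 * \sum_(x in G) (if conjg g x \in H then phi (conjg g x) else 0).

Definition dot_fun (gT : finGroupType) (G : {set gT}) (f h : gT -> algC) : algC :=
  #|G|%:R^-1 * \sum_(x in G) f x * (h x)^*.

Definition Sn n : {group {perm 'I_n}} := [set: {perm 'I_n}]%G.

(* index of the block containing x when {0..n-1} is cut into consecutive
   blocks of sizes mu_1, mu_2, ... *)
Definition block_of (mu : seq nat) (x : nat) : nat :=
  count (fun s => s <= x)%N [seq sumn (take i.+1 mu) | i <- iota 0 (size mu)].

(* Young subgroup S_mu (stabiliser of the blocks); the set is a group *)
Definition young_set n (mu : seq nat) : {set {perm 'I_n}} :=
  [set s : {perm 'I_n} | [forall x : 'I_n, block_of mu (s x) == block_of mu x]].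
Definition young n (mu : seq nat) : {group {perm 'I_n}} := <<young_set n mu>>%G.

Definition sign_fun n (s : {perm 'I_n}) : algC := (-1) ^+ odd_perm s.

(* chi^nu : the unique irreducible character of S_n that is a constituent of
   both Ind_{S_nu}^{S_n} 1 and Ind_{S_nu'}^{S_n} sgn (Specht module). *)
Definition irr_index n (nu : seq nat) : option (Iirr (Sn n)) :=
  [pick i : Iirr (Sn n) |
     (dot_fun (Sn n) (ind_fun (Sn n) (young n nu) (fun _ => 1)) ('chi_i) != 0)
  && (dot_fun (Sn n) (ind_fun (Sn n) (young n (conj_part nu)) (@sign_fun n))
        ('chi_i) != 0)].

Definition chi n (nu : seq nat) (g : {perm 'I_n}) : algC :=
  if irr_index n nu is Some i then 'chi_i g else 0.

Definition cycle_type n (s : {perm 'I_n}) : seq nat :=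
  sort geq [seq #|C| | C : {set 'I_n} <- enum (porbits s)].

Definition zeta (i : nat) : algC :=
  if i is i'.+1 then sval (C_prim_root_exists (ltn0Sn i')) else 1.

Definition base n (s : {perm 'I_n}) (x : 'I_n) : 'I_n :=
  [arg min_(y < x in porbit s x) (y : nat)].

(* The linear character id_{m_1}[zeta_1^r] (x) id_{m_2}[zeta_2^r] (x) ... of
   Z_lambda = 'C[s]: for g in 'C[s] and each cycle C of s (of length i, with
   base point b), g b = s^(a_C) (base of g C); the value is prod_C zeta_i^(r a_C). *)
Definition xi (r : int) n (s g : {perm 'I_n}) : algC :=
  \prod_(x : 'I_n | base s x == x)
     zeta #|porbit s x| ^ (r * (findex s (base s (g x)) (g x))%:Z).

Definition psi (r : int) n (s : {perm 'I_n}) : {perm 'I_n} -> algC :=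
  ind_fun (Sn n) ('C[s])%g (xi r s).

Definition mult (r : int) n (s : {perm 'I_n}) (nu : seq nat) : algC :=
  dot_fun (Sn n) (psi r s) (@chi n nu).

Definition balanced (a : algC) (N : nat -> nat) (nu : nat -> seq nat) : Prop :=
  forall n, [/\ is_partition (N n) (nu n),
                (head 0%N (nu n))%:R <= a * sqrtC (N n)%:R
              & (size (nu n))%:R <= a * sqrtC (N n)%:R].

(* Main.v *)
Require Import Defs.
From mathcomp Require Import all_boot all_order all_algebra all_fingroup all_solvable all_field all_character.
From mathcomp Require Import sesquilinear.
From mathcomp Require Import zify ring.
Set Implicit Arguments.
Unset Strict Implicit.
Unset Printing Implicit Defensive.
Import Order.TTheory GRing.Theory Num.Theory.
Local Open Scope ring_scope.
Local Open Scope sesquilinear_scope.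

(* Since the centralizer of s has order z_lambda, Frobenius reciprocity gives
     mult * z_lambda / f - 1 = sum over g <> 1 in C(s) of xi(g) conj(chi(g)) / f,
   so it suffices to sum |chi(g)| / f over C(s); this is done with two bounds.

   Realise chi = chi^nu by unitary matrices.  As in the Vershik-Okounkov approach, the joint
   eigenvectors of the Jucys-Murphy elements are indexed by standard tableaux.  Comparing the
   trivial and sign multiplicities of Young subgroups (Mackey's formula and the Gale-Ryser
   inequalities) shows that the tableaux occurring in chi^nu are those of shape nu, each once.
   Hence deg chi = f, and every Jucys-Murphy element has norm at most b, the larger of the first
   row and the first column, so b = O(sqrt n).

   Small support.  Choose p moved points y, about a third of the support, whose images under g
   are not among the chosen points, and disjoint sets Z_y of q fixed points of g.  Conjugating
   by (y z) and averaging over z in Z_y inserts the sum of the transpositions (g y, z), which is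
   conjugate to a Jucys-Murphy element; thus q^p |chi(g)| <= b^p f.

   Large support.  |chi(g)|^2 <= |C(g)| <= n^cyc(g) with 2 cyc(g) + |supp g| <= 2n, while
   f (2b)^n >= n!, which comes from the trace of the product of the b + X_j.

   (i) An element of C(s) is determined by the images of one point in each cycle, so the sum of
   n^(-2j(g)) over C(s) is at most 2^k, where j(g) counts the cycles that g moves; and
   |chi(g)| n^(2j(g)) / f is much smaller than 2^(-k) for g <> 1.

   (ii) Put n ~ u^12.  On average over s there are at most t! elements of C(s) with support of
   size t, which handles the supports of size at most 24u.  Since E 2^cyc(s) = n + 1, most s have
   at most u cycles; then |C(s)| <= n^u, and |chi(g)| / f is at most (2n)^(-u) for the remaining g. *)

(** * Unitary realisations *)

(** [chi] is specified only as a common constituent of two induced characters, so its degree and the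
    spectrum of the Jucys-Murphy elements must be recovered from multiplicities. Unitarity makes
    those elements Hermitian, which rules out Jordan blocks and makes joint eigenvectors with
    different contents orthogonal. Products of stars of transpositions, which need not commute, are
    controlled by the Frobenius norm: unitary factors preserve it, and a Hermitian factor multiplies
    it by at most its spectral radius. The two character bounds have complementary ranges. For a
    support of at most n/2 the first gives (C p / sqrt n)^p, where p is any number up to a third of
    the support, so p can be kept far below sqrt n however large the support is. The second gains
    n^(-|supp g|/4) against a factor exponential in n, so it needs a support exceeding a constant
    multiple of n / log n. The estimates are stated between powers of natural numbers, with even
    powers of the ratios where sqrt n would enter; this avoids logarithms and fractional
    exponents. *)

Record unitary_irrep (gT : finGroupType) d (rho : gT -> 'M[algC]_d) : Prop := UnitaryIrrep {
  rho1 : rho 1%g = 1%:M;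
  rhoM : forall g h, rho (g * h)%g = rho g *m rho h;
  rhoV : forall g, (rho g)^t* = rho g^-1%g;
  rho_irr : forall m (U : 'M[algC]_(m, d)), U != 0 ->
     (forall g, stablemx U (rho g)) -> (1%:M <= U)%MS }.

Lemma adjmxM m n p (A : 'M[algC]_(m, n)) (B : 'M[algC]_(n, p)) :
  (A *m B)^t* = B^t* *m A^t*.
Proof. by rewrite trmx_mul map_mxM. Qed.

Lemma trmulC m n (A : 'M[algC]_(m, n)) :
  \tr (A *m A^t*) = \sum_i \sum_j `|A i j| ^+ 2.
Proof.
rewrite /mxtrace; apply: eq_bigr => i _; rewrite !mxE; apply: eq_bigr => j _.
by rewrite !mxE normCK.
Qed.

Lemma hermitian_factor n (B : 'M[algC]_n) : B \is hermsymmx ->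
  (forall u : 'rV[algC]_n, u != 0 -> 0 < (u *m B *m u^t*) 0 0) ->
  exists2 C : 'M[algC]_n, C \in unitmx & B = C *m C^t*.
Proof.
move=> hB pB.
have nB : B \is normalmx by apply: hermitian_normalmx.
have /orthomx_spectralP defB := nB.
set P := spectralmx B in defB; set D := spectral_diag B in defB.
have uP : P \is unitarymx := spectral_unitarymx B.
have Pu : P \in unitmx by apply: unitarymx_unit.
have D0 i : 0 < D 0 i.
  have rPP : (row i P *m (row i P)^t*) 0 0 = 1.
    transitivity ((P *m P^t*) i i); last by rewrite (unitarymxP uP) mxE eqxx.
    rewrite !mxE; by apply: eq_bigr => j _; rewrite !mxE.
  have /pB : row i P != 0.
    by apply/negP => /eqP e; move: rPP; rewrite e mul0mx mxE => /esym/eqP; rewrite oner_eq0.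
  suff -> : (row i P *m B *m (row i P)^t*) 0 0 = D 0 i by [].
  rewrite defB invmx_unitary // -row_mul !mulmxA.
  have /unitarymxP -> := uP; rewrite mul1mx row_mul row_diag_mx -scalemxAl -rowE.
  by rewrite -scalemxAl mxE rPP mulr1.
pose S := diag_mx (map_mx sqrtC D).
have SS : S *m S^t* = diag_mx D.
  rewrite /S tr_diag_mx map_diag_mx mulmx_diag; congr diag_mx; apply/rowP=> i; rewrite !mxE.
  by rewrite /= geC0_conj ?sqrtC_ge0 ?ltW // -expr2 sqrtCK.
exists (P^t* *m S); last by rewrite adjmxM trmxCK mulmxA -[_ *m S *m _]mulmxA SS {1}defB invmx_unitary.
rewrite unitmx_mul -invmx_unitary // unitmx_inv Pu /= unitmxE det_diag unitfE.
by apply/prodf_neq0 => i _; rewrite mxE sqrtC_eq0 gt_eqF.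
Qed.

(** Weyl's unitary trick: the average [B] of the products of [R g] with its adjoint is an invariant
    positive definite form, and conjugation by a factor [C] of [B] turns it into the standard
    one. *)
Lemma repr_unitary (gT : finGroupType) (G : {group gT}) d (R : mx_representation algC G d) :
  G = [set: gT]%G -> mx_irreducible R ->
  exists2 rho : gT -> 'M[algC]_d, unitary_irrep rho & forall g, \tr (rho g) = \tr (R g).
Proof.
move=> defG irrR; have Gx g : g \in G by rewrite defG inE.
pose B := \sum_(g in G) R g *m (R g)^t*.
have hB : B \is hermsymmx.
  apply/is_hermitianmxP; rewrite expr0 scale1r /B raddf_sum /= raddf_sum /=.
  apply: eq_bigr => g _; by rewrite adjmxM trmxCK.
have pB (u : 'rV[algC]_d) : u != 0 -> 0 < (u *m B *m u^t*) 0 0.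
  move=> u0; have nn (v : 'rV[algC]_d) : 0 <= (v *m v^t*) 0 0.
    by rewrite mxE sumr_ge0 // => j _; rewrite !mxE /= -normCK exprn_ge0.
  have -> : (u *m B *m u^t*) 0 0 = \sum_(g in G) ((u *m R g) *m (u *m R g)^t*) 0 0.
    rewrite mulmx_sumr mulmx_suml summxE; apply: eq_bigr => h _.
    by rewrite adjmxM !mulmxA.
  rewrite (bigD1 1%g) ?Gx //= ltr_wpDr ?sumr_ge0 //.
  rewrite repr_mx1 mulmx1 -dotmxE dnorm_gt0 //.
have [C Cu defB] := hermitian_factor hB pB.
pose r g := invmx C *m R g *m C.
have r1 : r 1%g = 1%:M by rewrite /r repr_mx1 mulmx1 mulVmx.
have M g h : r (g * h)%g = r g *m r h.
  by rewrite /r repr_mxM ?Gx // !mulmxA mulmxK.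
have BR h : R h *m B *m (R h)^t* = B.
  rewrite mulmx_sumr mulmx_suml /B [RHS](reindex_inj (mulgI h)) /=.
  apply: eq_big => [g|g _]; first by rewrite !Gx.
  by rewrite repr_mxM ?Gx // adjmxM !mulmxA.
have uR g : r g *m (r g)^t* = 1%:M.
  rewrite /r 2!adjmxM; have -> : invmx C *m R g *m C *m (C^t* *m ((R g)^t* *m (invmx C)^t*)) =
      invmx C *m (R g *m (C *m C^t*) *m (R g)^t*) *m (invmx C)^t* by rewrite !mulmxA.
  rewrite -defB BR defB mulmxA mulVmx // mul1mx -adjmxM mulVmx //.
  by rewrite trmx1 map_mx1.
exists r; last by move=> g; rewrite mxtrace_mulC mulmxA mulmxV // mul1mx.
split=> // [g|m U U0 sU].
  by rewrite -[LHS]mul1mx -r1 -(mulVg g) M -mulmxA uR mulmx1.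
have [_ /(_ <<U *m invmx C>>%MS)] := (mx_irrP R).1 irrR.
rewrite -sub1mx genmxE => full.
have /full : mxmodule R <<U *m invmx C>>%MS.
  apply/mxmoduleP => g _; rewrite (eqmxMr _ (genmxE _)) genmxE.
  have /(submxMr (invmx C)) := sU g.
  by rewrite /r !mulmxA mulmxK.
rewrite -mxrank_eq0 mxrank_gen mxrank_eq0 => full1.
have /full1 /(submxMr C) : U *m invmx C != 0.
  by apply: contra U0 => /eqP e; rewrite -[U](mulmxKV Cu) e mul0mx.
by rewrite mul1mx mulmxKV // => /(submx_trans _); apply; rewrite sub1mx row_full_unit.
Qed.

Lemma irr_unitary (gT : finGroupType) (G : {group gT}) (i : Iirr G) : G = [set: gT]%G ->
  exists d, exists2 rho : gT -> 'M[algC]_d, unitary_irrep rho & forall g, \tr (rho g) = 'chi_i g.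
Proof.
move=> defG; have [rho urho trho] := repr_unitary defG (socle_irr (socle_of_Iirr i)).
have Gx g : g \in G by rewrite defG inE.
by eexists; exists rho => // g; rewrite trho -irrRepr cfunE Gx mulr1n.
Qed.

(** * Jucys-Murphy elements and standard tableaux *)

Section JucysMurphy.
Variables (n d : nat) (rho : {perm 'I_n} -> 'M[algC]_d).
Hypothesis Urho : unitary_irrep rho.

(** Arbitrary [Z] are allowed, because the bound for small supports inserts such sums away from
    initial segments. *)
Definition star (x : 'I_n) (Z : {set 'I_n}) : 'M[algC]_d :=
  \sum_(z in Z) rho (tperm x z).

Definition jm (j : 'I_n) : 'M[algC]_d := star j [set i : 'I_n | (i < j)%N].

Lemma rhoVr g : rho g *m rho g^-1%g = 1%:M.
Proof. by rewrite -rhoM // mulgV rho1. Qed.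

Lemma rhoVl g : rho g^-1%g *m rho g = 1%:M.
Proof. by rewrite -rhoM // mulVg rho1. Qed.

Lemma star_conj (g : {perm 'I_n}) x (Z : {set 'I_n}) : star x Z *m rho g = rho g *m star (g x) (g @: Z).
Proof.
rewrite /star mulmx_suml mulmx_sumr big_imset /=; last by move=> y z _ _; apply: perm_inj.
apply: eq_bigr => z _; rewrite -!rhoM //; congr rho.
by rewrite -tpermJ conjgE !mulgA mulgV mul1g.
Qed.

Lemma star_adj x Z : (star x Z)^t* = star x Z.
Proof.
rewrite /star raddf_sum /= raddf_sum /=; apply: eq_bigr => z _.
by rewrite rhoV // tpermV.
Qed.

Lemma star_comm (g : {perm 'I_n}) x (Z : {set 'I_n}) : g x = x -> g @: Z = Z -> star x Z *m rho g = rho g *m star x Z.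
Proof. by move=> gx gZ; rewrite star_conj gx gZ. Qed.

Lemma jm_adj j : (jm j)^t* = jm j. Proof. exact: star_adj. Qed.

Lemma tperm_ltE (i j k l : 'I_n) : (i < k)%N -> (j < k)%N -> (tperm i j l < k)%N = (l < k)%N.
Proof. by move=> ik jk; case: tpermP => [->|->|]; rewrite ?ik ?jk. Qed.

Lemma jm_comm_tperm (i j k : 'I_n) : (i < k)%N -> (j < k)%N ->
  jm k *m rho (tperm i j) = rho (tperm i j) *m jm k.
Proof.
move=> ik jk; apply: star_comm.
  by rewrite tpermD // -val_eqE /= ltn_eqF.
apply/setP=> l; apply/imsetP/idP => [[m + ->]|lk]; first by rewrite !inE tperm_ltE.
by exists (tperm i j l); rewrite ?tpermK // !inE tperm_ltE // -[(l < k)%N](in_set (fun l : 'I_n => (l < k)%N)).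
Qed.

Lemma jm_comm_tperm_lt (i j k : 'I_n) : (k < i)%N -> (k < j)%N ->
  jm k *m rho (tperm i j) = rho (tperm i j) *m jm k.
Proof.
move=> ik jk; have fix_le (l : 'I_n) : (l <= k)%N -> tperm i j l = l.
  by move=> lk; rewrite tpermD // -val_eqE /= gtn_eqF // (leq_ltn_trans lk).
apply: star_comm; first exact: fix_le.
rewrite -[RHS]imset_id; apply: eq_in_imset => l; rewrite inE => lk.
by rewrite fix_le // ltnW.
Qed.

Lemma jm_comm j k : jm j *m jm k = jm k *m jm j.
Proof.
wlog jk : j k / (j <= k)%N.
  by move=> W; case/orP: (leq_total j k) => /W // ->.
move: jk; rewrite leq_eqVlt => /orP[/eqP/val_inj -> //|jk].
rewrite {1 3}/jm /star mulmx_suml mulmx_sumr; apply: eq_bigr => z; rewrite inE => zj.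
by rewrite jm_comm_tperm // (ltn_trans zj).
Qed.

(** The relation of the degenerate affine Hecke algebra: conjugation by (i j) carries every term of
    [jm j] except (i j) itself to a term of [jm i], and that last term squares to 1. *)
Lemma jm_succ (i j : 'I_n) : j = i.+1 :> nat ->
  rho (tperm i j) *m jm j = jm i *m rho (tperm i j) + 1%:M.
Proof.
move=> ji; rewrite {2}/jm star_conj tpermL.
have -> : tperm i j @: [set k : 'I_n | (k < i)%N] = [set k : 'I_n | (k < i)%N].
  rewrite -[RHS]imset_id; apply: eq_in_imset => l; rewrite inE => lk.
  by rewrite tpermD // -val_eqE /= ?ji gtn_eqF // ltnW.
have -> : jm j = star j [set k : 'I_n | (k < i)%N] + rho (tperm i j).
  rewrite /jm /star (bigD1 i) ?inE ?ji //= addrC tpermC; congr (_ + _).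
  apply: eq_bigl => k; rewrite !inE ltnS -val_eqE /= [RHS]ltn_neqAle andbC //.
by rewrite mulmxDr -rhoM // tperm2 rho1.
Qed.

Definition jeig (v : 'rV[algC]_d) (al : nat -> algC) :=
  forall j : 'I_n, v *m jm j = al j *: v.

Definition swapseq T (i : nat) (al : nat -> T) : nat -> T :=
  fun k => if k == i then al i.+1 else if k == i.+1 then al i else al k.

Lemma row_normP (v : 'rV[algC]_d) : (v *m v^t* == 0) = (v == 0).
Proof.
apply/eqP/eqP => [e|->]; last by rewrite mul0mx.
have /eqP := trmulC v; rewrite e mxtrace0 big_ord1 eq_sym psumr_eq0 => [/allP z|i _]; last first.
  exact: exprn_ge0.
apply/rowP=> i; have := z i (mem_index_enum _); rewrite expf_eq0 normr_eq0 /= => /eqP ->.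
by rewrite mxE.
Qed.

Lemma jeig_real (v : 'rV[algC]_d) al (j : 'I_n) : v != 0 -> jeig v al -> (al j)^* = al j.
Proof.
move=> v0 /(_ j) e; have := congr1 (fun u : 'rV_d => u *m v^t*) e; rewrite -scalemxAl.
have -> : v *m jm j *m v^t* = (al j)^* *: (v *m v^t*).
  by rewrite -mulmxA -{1}(jm_adj j) -adjmxM e linearZ /= map_mxZ -scalemxAr.
move=> /eqP; rewrite -subr_eq0 -scalerBl scaler_eq0 row_normP (negbTE v0) orbF subr_eq0.
by move=> /eqP.
Qed.

Lemma jeig_orth (v w : 'rV[algC]_d) al be (j : 'I_n) : w != 0 -> jeig v al -> jeig w be ->
  al j != be j -> v *m w^t* = 0.
Proof.
move=> w0 /(_ j) ev jw ne; have := congr1 (fun u : 'rV_d => u *m w^t*) ev; rewrite -scalemxAl.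
have -> : v *m jm j *m w^t* = be j *: (v *m w^t*).
  by rewrite -mulmxA -{1}(jm_adj j) -adjmxM jw linearZ /= map_mxZ -scalemxAr /= (jeig_real _ w0 jw).
move=> /eqP; rewrite -subr_eq0 -scalerBl scaler_eq0 subr_eq0 eq_sym (negbTE ne).
by move=> /eqP.
Qed.

Lemma jeig0 v al (j : 'I_n) : v != 0 -> jeig v al -> j = 0%N :> nat -> al j = 0.
Proof.
move=> v0 /(_ j) e j0; have : jm j = 0.
  by rewrite /jm /star big1 // => i; rewrite inE j0.
by move=> e0; move: e; rewrite e0 mulmx0 => /esym/eqP; rewrite scaler_eq0 (negbTE v0) orbF => /eqP.
Qed.

Section Adjacent.
Variables i j : 'I_n.
Hypothesis ji : j = i.+1 :> nat.
Let s := rho (tperm i j).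

Lemma adj_ss : s *m s = 1%:M.
Proof. by rewrite /s -rhoM // tperm2 rho1. Qed.

Lemma adj_s : s^t* = s. Proof. by rewrite /s rhoV // tpermV. Qed.

Lemma adj_act_lo v al : jeig v al -> v *m s *m jm i = al j *: (v *m s) - v.
Proof.
move=> jv; rewrite scalemxAl -jv -mulmxA; apply/eqP; rewrite eq_sym subr_eq; apply/eqP.
have e : jm j *m s = s *m jm i + 1%:M.
  have := congr1 (fun M => s *m M *m s) (jm_succ ji).
  by rewrite mulmxDr mulmxDl mulmx1 adj_ss !mulmxA adj_ss mul1mx -mulmxA -/s adj_ss mulmx1.
by rewrite -[in LHS]mulmxA e mulmxDr mulmx1.
Qed.

Lemma adj_act_hi v al : jeig v al -> v *m s *m jm j = al i *: (v *m s) + v.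
Proof.
by move=> jv; rewrite scalemxAl -jv -mulmxA jm_succ // mulmxDr mulmx1 mulmxA.
Qed.

(** With equal eigenvalues, [jm i] would act on the span of [v] and [v *m s] as a nontrivial Jordan
    block, which a Hermitian matrix excludes. *)
Lemma jeig_adj_neq v al : v != 0 -> jeig v al -> al i != al j.
Proof.
move=> v0 jv; apply/eqP => e; have := adj_act_lo jv; rewrite -e => e1.
have e2 : v *m s *m jm i *m v^t* = al i *: (v *m s *m v^t*).
  by rewrite -mulmxA -(jm_adj i) -adjmxM jv linearZ /= map_mxZ -scalemxAr /= (jeig_real _ v0 jv).
move/eqP: e2; rewrite e1 mulmxBl -scalemxAl subr_eq addrC -subr_eq subrr eq_sym row_normP.
by rewrite (negbTE v0).
Qed.

Lemma jeig_swap v al : v != 0 -> jeig v al ->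
  jeig (v *m s - (al j - al i)^-1 *: v) (swapseq i al).
Proof.
move=> v0 jv; have ne : al j - al i != 0 by rewrite subr_eq0 eq_sym (jeig_adj_neq v0 jv).
move=> k; rewrite /swapseq mulmxBl -scalemxAl jv.
have [/val_inj ->|ki] := eqVneq (k : nat) i.
  rewrite (adj_act_lo jv) -ji scalerBr -addrA; congr (_ + _).
  rewrite -opprD; congr (- _); rewrite !scalerA -{1}[v]scale1r -scalerDl; congr (_ *: _).
  by field.
have [/eqP kj|kj] := eqVneq (k : nat) i.+1.
  have -> : k = j by apply: val_inj; rewrite /= ji; apply/eqP.
  rewrite (adj_act_hi jv) scalerBr -addrA; congr (_ + _).
  rewrite !scalerA -[X in X - _]scale1r -!scaleNr -scalerDl; congr (_ *: _).
  by field.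
have -> : v *m s *m jm k = al k *: (v *m s).
  rewrite scalemxAl -jv -!mulmxA; congr (_ *m _); apply/esym.
  have [ik|ik] := ltnP i k; last first.
    by apply: jm_comm_tperm_lt; rewrite ?ji ?ltnS // ltn_neqAle ki.
  by apply: jm_comm_tperm; rewrite ?ji // ltn_neqAle eq_sym kj.
by rewrite scalerBr !scalerA mulrC.
Qed.

(** If the intertwined vector vanished, [v] would be an eigenvector of the involution [s] with
    eigenvalue [c], so c = 1 or c = -1. *)
Lemma jeig_swap_neq0 v al : v != 0 -> jeig v al ->
  al j != al i + 1 -> al j != al i - 1 -> v *m s - (al j - al i)^-1 *: v != 0.
Proof.
move=> v0 jv n1 n2; set c := _^-1; rewrite subr_eq0; apply/eqP => e.
have : v = (c * c) *: v by rewrite -scalerA -e scalemxAl -e -mulmxA adj_ss mulmx1.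
move/eqP; rewrite -{1}[v]scale1r -subr_eq0 -scalerBl scaler_eq0 (negbTE v0) orbF subr_eq0.
rewrite eq_sym -expr2 sqrf_eq1 /c !invr_eq1 -invrN1 (inj_eq invr_inj).
by rewrite !subr_eq [1 + _]addrC [-1 + _]addrC (negbTE n1) (negbTE n2).
Qed.

(** The intertwined vector [w] has the swapped eigenvalues, hence is orthogonal to [v]; as [w *m s]
    is a multiple of [w], it is also orthogonal to [v *m s], and therefore to itself. *)
Lemma jeig_sign v al e : v != 0 -> jeig v al -> e ^+ 2 = 1 -> e^* = e ->
  al j = al i + e -> v *m s = e *: v.
Proof.
move=> v0 jv e2 eR aj; apply/eqP; rewrite -subr_eq0.
have eV : e^-1 = e by rewrite -[LHS]mul1r -e2 expr2 mulfK // -sqrf_eq0 e2 oner_neq0.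
have jw : jeig (v *m s - e *: v) (swapseq i al).
  by have := jeig_swap v0 jv; rewrite aj addrAC subrr add0r eV.
set w := _ - _ in jw *.
have wv : w *m v^t* = 0.
  apply: (jeig_orth (j := i) v0 jw jv).
  by rewrite /swapseq eqxx -ji eq_sym (jeig_adj_neq v0 jv).
have ws : w *m s = - e *: w.
  rewrite /w mulmxBl -mulmxA adj_ss mulmx1 -scalemxAl scalerBr scalerA mulNr -expr2 e2.
  by rewrite scaleN1r opprK addrC scaleNr.
rewrite -row_normP {2}/w raddfB /= raddfB /= linearZ /= map_mxZ mulmxBr -scalemxAr wv scaler0 subr0.
by rewrite adjmxM adj_s mulmxA ws -scalemxAl wv scaler0.
Qed.
End Adjacent.

(* Otherwise the two adjacent transpositions act on v by e and -e, against the braid relation. *)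
Lemma jeig_no_braid v al (i j k : 'I_n) e : j = i.+1 :> nat -> k = j.+1 :> nat ->
  v != 0 -> jeig v al -> e ^+ 2 = 1 -> e^* = e -> al j = al i + e -> al k != al i.
Proof.
move=> ji kj v0 jv e2 eR aj; apply/eqP => ak.
have v1 : v *m rho (tperm i j) = e *: v by apply: (jeig_sign ji v0 jv).
have v2 : v *m rho (tperm j k) = - e *: v.
  apply: (jeig_sign kj v0 jv); first by rewrite sqrrN.
    by rewrite rmorphN /= eR.
  by rewrite ak aj addrK.
have : v *m rho (tperm i j * tperm j k * tperm i j)%g = v *m rho (tperm j k * tperm i j * tperm j k)%g.
  have nij : i != j by rewrite -val_eqE /= ji ltn_eqF.
  have njk : j != k by rewrite -val_eqE /= kj ltn_eqF.
  have nik : i != k by rewrite -val_eqE /= kj ji ltn_eqF // ltnW.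
  have -> : (tperm i j * tperm j k * tperm i j = tperm i k)%g.
    by rewrite -{1}tpermV -mulgA -conjgE tpermJ tpermR tpermD // eq_sym.
  have -> // : (tperm j k * tperm i j * tperm j k = tperm i k)%g.
  by rewrite -{1}tpermV -mulgA -conjgE tpermJ tpermL tpermD // eq_sym.
rewrite !rhoM // !mulmxA !(v1, v2, =^~ scalemxAl) !scalerA => /eqP.
rewrite -subr_eq0 -scalerBl scaler_eq0 (negbTE v0) orbF !mulNr !mulrN opprK !mulNr -!expr2 -exprSr.
have e0 : e != 0 by rewrite -sqrf_eq0 e2 oner_neq0.
by rewrite ?opprK -opprD oppr_eq0 -mulr2n mulrn_eq0 expf_eq0 /= (negbTE e0).
Qed.
End JucysMurphy.

(** * Eigenvalue sequences closed under admissible swaps *)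

Section ContentSequences.
Variables (n : nat) (S : (nat -> algC) -> Prop).
Hypothesis S0 : forall al, S al -> (0 < n)%N -> al 0%N = 0.
Hypothesis S_neq : forall al i, S al -> (i.+1 < n)%N -> al i != al i.+1.
Hypothesis S_swap : forall al i, S al -> (i.+1 < n)%N ->
  al i.+1 != al i + 1 -> al i.+1 != al i - 1 -> S (swapseq i al).
Hypothesis S_braid : forall al i (b : bool), S al -> (i.+2 < n)%N ->
  al i.+1 = al i + (-1) ^+ b -> al i.+2 != al i.

Lemma swapseq_lo T i (al : nat -> T) : swapseq i al i = al i.+1.
Proof. by rewrite /swapseq eqxx. Qed.

Lemma swapseq_hi T i (al : nat -> T) : swapseq i al i.+1 = al i.
Proof. by rewrite /swapseq eqxx eqn_leq ltnn. Qed.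

Lemma swapseq_lt T i k (al : nat -> T) : (k < i)%N -> swapseq i al k = al k.
Proof. by move=> ki; rewrite /swapseq !ltn_eqF // ltnS ltnW. Qed.

Lemma swapseq_gt T i k (al : nat -> T) : (i.+1 < k)%N -> swapseq i al k = al k.
Proof. by move=> ki; rewrite /swapseq !gtn_eqF // ltnW. Qed.

(** An entry without an earlier neighbour could be moved forward by admissible swaps to position 1
    and then to position 0; both sequences start with 0, which would make two adjacent entries
    equal. *)
Lemma content_neighbour q : forall al, S al -> (0 < q < n)%N ->
  exists2 i, (i < q)%N & exists b : bool, al i = al q + (-1) ^+ b.
Proof.
elim: q => // q IH al Sal /= qn.
have [/eqP e1|n1] := boolP (al q.+1 == al q + 1).
  by exists q => //; exists true; rewrite e1 expr1 addrK.
have [/eqP e2|n2] := boolP (al q.+1 == al q - 1).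
  by exists q => //; exists false; rewrite e2 expr0 addrNK.
have Ss := S_swap Sal qn n1 n2.
have [q0|q0] := posnP q.
  have n0 : (0 < n)%N by apply: leq_ltn_trans qn.
  have /eqP[] := S_neq Sal qn; rewrite q0 (S0 Sal n0).
  by rewrite -[LHS](S0 Ss n0) q0 swapseq_lo.
have [|i iq [b e]] := IH _ Ss; first by rewrite q0 ltnW.
exists i; first by rewrite ltnW.
by exists b; move: e; rewrite swapseq_lt // swapseq_lo.
Qed.

(* Admissible swaps bring the two equal entries a closer together.  Where no swap is possible the
   inner neighbours are a + 1 or a - 1; if they coincide they form a shorter gap, down to the pattern
   (a, a +- 1, a) excluded by S_braid. *)
Lemma content_gap m : forall al p q (b : bool), (q - p <= m)%N -> S al -> (p < q < n)%N -> al p = al q ->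
  exists2 i, (p < i < q)%N & al i = al p + (-1) ^+ b.
Proof.
elim: m => [al p q b|m IH al p q b lm Sal /andP[pq qn] epq].
  by rewrite leqn0 subn_eq0 => qp _ /andP[]; rewrite ltnNge qp.
have [/hasP[i]|noeq] := boolP (has (fun i => al i == al p) (iota p.+1 (q - p.+1))).
  rewrite mem_iota subnKC // => /andP[pi iq] /eqP ei.
  have [||//|j /andP[pj ji] ej] := IH al p i b _ Sal.
  - by rewrite -ltnS (leq_trans _ lm) // ltn_sub2r.
  - by rewrite pi (ltn_trans iq).
  by exists j; rewrite // pj (ltn_trans ji).
have pq1 : (p.+1 < q)%N.
  rewrite ltn_neqAle pq andbT; apply/eqP => e.
  by have := S_neq Sal (i := p); rewrite e epq eqxx => /(_ qn).
have [q' eq'] : exists q', q = q'.+1 by exists q.-1; rewrite prednK // (leq_ltn_trans _ pq).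
have pq' : (p < q')%N by rewrite -ltnS -eq'.
have nadj x y (c : bool) : x = y + (-1) ^+ c -> y = x + (-1) ^+ (~~ c) :> algC.
  by move=> ->; rewrite -addrA signrN subrr addr0.
have dec x (y : algC) : (exists c : bool, x = y + (-1) ^+ c) \/ (x != y + 1 /\ x != y - 1).
  have [/eqP e|e1] := boolP (x == y + 1); first by left; exists false; rewrite expr0.
  have [/eqP e|e2] := boolP (x == y - 1); first by left; exists true; rewrite expr1.
  by right.
have [c|[n1 n2]] := dec (al q) (al q'); last first.
  have Ss := S_swap (i := q') Sal; rewrite -eq' in Ss; have {}Ss := Ss qn n1 n2.
  have [|||i /andP[pi iq'] ei] := IH (swapseq q' al) p q' b _ Ss.
  - by rewrite -ltnS (leq_trans _ lm) // eq' ltn_sub2r // ltnS ltnW.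
  - by rewrite pq' ltnW // -eq'.
  - by rewrite swapseq_lo swapseq_lt // -eq'.
  exists i; first by rewrite pi eq' ltnW.
  by move: ei; rewrite !swapseq_lt.
case: c => c /nadj eq'q.
have [cb|cb] := eqVneq (~~ c) b.
  by exists q'; rewrite ?pq' ?eq' //= eq'q epq cb.
have ncb : ~~ c = ~~ b by case: (c) (b) cb => [] [].
have [c'|[n1 n2]] := dec (al p.+1) (al p); last first.
  have p1n : (p.+1 < n)%N by apply: ltn_trans qn.
  have Ss := S_swap (i := p) Sal p1n n1 n2.
  have [|||i /andP[pi iq'] ei] := IH (swapseq p al) p.+1 q b _ Ss.
  - by rewrite -ltnS (leq_trans _ lm) // ltn_sub2l.
  - by rewrite pq1.
  - by rewrite swapseq_hi swapseq_gt.
  exists i; first by rewrite iq' ltnW.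
  by move: ei; rewrite swapseq_hi swapseq_gt.
case: c' => c' ec'.
have [cb'|cb'] := eqVneq c' b.
  by exists p.+1; rewrite ?pq1 ?ltnSn //= ec' cb'.
have ncb' : c' = ~~ b by case: (c') (b) cb' => [] [].
have pq2 : (p.+1 < q')%N.
  rewrite ltn_neqAle pq' andbT; apply/eqP => e.
  have := S_braid (i := p) Sal _ ec'; rewrite e -eq' epq eqxx => /(_ _)/negP; apply => //.
have [|||i /andP[pi iq'] ei] := IH al p.+1 q' b _ Sal.
- by move: lm; rewrite eq'; lia.
- by rewrite pq2 ltnW // -eq'.
- by rewrite ec' eq'q epq ncb ncb'.
have /hasP[] := noeq; exists i.
  by rewrite mem_iota subnKC // (ltnW pi) eq' ltnW.
by rewrite ei ec' ncb' -addrA signrN addNr addr0.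
Qed.
End ContentSequences.

Definition rowt n (t : {ffun 'I_n -> 'I_n * 'I_n}) (x : 'I_n) : nat := (t x).1.
Definition colt n (t : {ffun 'I_n -> 'I_n * 'I_n}) (x : 'I_n) : nat := (t x).2.
Definition content n (t : {ffun 'I_n -> 'I_n * 'I_n}) (x : 'I_n) : int :=
  (colt t x)%:Z - (rowt t x)%:Z.

(* A standard tableau without prescribed shape: a growth sequence of order ideals of nat * nat. *)
Definition std n (t : {ffun 'I_n -> 'I_n * 'I_n}) : Prop :=
  [/\ injective t,
      forall x, (0 < colt t x)%N -> exists2 y : 'I_n, (y < x)%N & rowt t y = rowt t x /\ (colt t y).+1 = colt t x
    & forall x, (0 < rowt t x)%N -> exists2 y : 'I_n, (y < x)%N & (rowt t y).+1 = rowt t x /\ colt t y = colt t x].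

(** * From contents to cells *)

Section ContentCells.
Variables (n : nat) (c : nat -> int).
Hypothesis c0 : (0 < n)%N -> c 0%N = 0.
Hypothesis c_step : forall q, (0 < q < n)%N ->
  exists2 i, (i < q)%N & exists b : bool, c i = c q + (-1) ^+ b.
Hypothesis c_gap : forall p q (b : bool), (p < q < n)%N -> c p = c q ->
  exists2 i, (p < i < q)%N & c i = c p + (-1) ^+ b.

(** The number of cells on the diagonal of content [a] that are filled before time [j]. *)
Let occ (j : nat) (a : int) := count (fun i => c i == a) (iota 0 j).

Let occS j a : occ j.+1 a = (occ j a + (c j == a))%N.
Proof. by rewrite /occ -addn1 iotaD count_cat /= add0n addn0. Qed.

Let occ_mono i j a : (i <= j)%N -> (occ i a <= occ j a)%N.
Proof. by move=> ij; rewrite /occ -(subnKC ij) iotaD count_cat leq_addr. Qed.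

Let occ_lt i j : (i < j)%N -> (occ i (c i) < occ j (c i))%N.
Proof. by move=> ij; apply: leq_trans (occ_mono _ ij); rewrite occS eqxx addn1. Qed.

Let occ_inj i j : c i = c j -> occ i (c i) = occ j (c j) -> i = j.
Proof.
by move=> e eo; case: (ltngtP i j) => // /occ_lt; rewrite -?e ?eo -e ltnn.
Qed.

Let occ_ex j a k : (k < occ j a)%N -> exists2 i, (i < j)%N & c i = a /\ occ i a = k.
Proof.
elim: j => // j IH; rewrite occS; have [e|ne] := eqVneq (c j) a; last first.
  by rewrite addn0 => /IH[i ij H]; exists i => //; apply: ltnW.
rewrite addn1 ltnS leq_eqVlt => /orP[/eqP ek|/IH[i ij H]]; first by exists j.
by exists i => //; apply: ltnW.
Qed.

Let occ_last j a : (0 < occ j a)%N ->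
  exists2 i, (i < j)%N & c i = a /\ occ j a = (occ i a).+1.
Proof.
move=> p; have [|i ij [ei eo]] := @occ_ex j a (occ j a).-1; first by rewrite prednK.
by exists i => //; split=> //; rewrite eo prednK.
Qed.

(** Between two consecutive visits to a diagonal [c_gap] supplies a visit to each neighbouring one,
    so neither neighbour falls behind. *)
Let occ_gap j (b : bool) : (j < n)%N -> (occ j (c j) <= occ j (c j + (-1) ^+ b))%N.
Proof.
elim/ltn_ind: j => j IH jn.
have [->//|/occ_last[i ij [ei eo]]] := posnP (occ j (c j)).
have [|k /andP[ik kj] ek] := @c_gap i j b _ ei; first by rewrite ij.
rewrite eo -ei -ek; apply: leq_ltn_trans (occ_lt kj).
by rewrite ek; apply: leq_trans (IH i ij (ltn_trans ij jn)) (occ_mono _ (ltnW ik)).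
Qed.

(** The exponent makes the step point towards 0. If [c_step] only yields the neighbour farther from
    0, induction at that neighbour gives an earlier occurrence of [c j], and [c_gap] between the two
    occurrences gives the required entry. *)
Let c_toward j : (j < n)%N -> c j != 0 ->
  exists2 i, (i < j)%N & c i = c j + (-1) ^+ (0 < c j)%R.
Proof.
elim/ltn_ind: j => j IH jn cj0.
have j0 : (0 < j)%N by rewrite lt0n; apply: contra cj0 => /eqP e; move: jn; rewrite e => /c0 ->.
have [|i ij [b eb]] := @c_step j; first by rewrite j0.
have [eq|ne] := eqVneq b (0 < c j)%R; first by exists i => //; rewrite eb eq.
have nb : b = ~~ (0 < c j) by case: b (0 < c j) ne {eb} => [] [].
have ci0 : (c i != 0) /\ (0 < c i) = (0 < c j).
  by rewrite eb nb; case: ltrP => /= h; rewrite ?expr0 ?expr1; split; lia.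
have [|k ki ek] := IH i ij _ ci0.1; first exact: ltn_trans jn.
have ekj : c k = c j.
  by rewrite ek ci0.2 eb nb; case: (0 < c j); rewrite ?expr0 ?expr1; lia.
have kj := ltn_trans ki ij.
have [|l /andP[_ lj] el] := @c_gap k j (0 < c j)%R _ ekj; first by rewrite kj.
by exists l => //; rewrite el ekj.
Qed.

(** Strict, unlike [occ_gap]: the diagonal nearer to 0 has already been visited before the first
    visit to the diagonal of [c j]. *)
Let occ_gap_toward j : (j < n)%N -> c j != 0 ->
  (occ j (c j) < occ j (c j + (-1) ^+ (0 < c j)%R))%N.
Proof.
elim/ltn_ind: j => j IH jn cj0.
have [->|/occ_last[i ij [ei eo]]] := posnP (occ j (c j)).
  have [i ij <-] := c_toward jn cj0.
  exact: leq_ltn_trans (leq0n _) (occ_lt ij).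
have [|k /andP[ik kj] ek] := @c_gap i j (0 < c j)%R _ ei; first by rewrite ij.
rewrite eo -ei in ek *; rewrite -ek; apply: leq_ltn_trans (occ_lt kj).
rewrite ek; apply: leq_trans (occ_mono _ (ltnW ik)).
by apply: IH; rewrite ?ei // (ltn_trans ij).
Qed.

(* Entry j goes to the first free cell of the diagonal of content c j. *)
Let row j := (occ j (c j) + (if (c j < 0)%R then `|c j| else 0))%N.
Let col j := (occ j (c j) + (if (0 < c j)%R then `|c j| else 0))%N.

Let c_col_row j : c j = (col j)%:Z - (row j)%:Z.
Proof. by rewrite /row /col; have [h|h|h] := ltrgt0P (c j); lia. Qed.

Let col_prev j : (j < n)%N -> (0 < col j)%N ->
  exists2 i, (i < j)%N & row i = row j /\ (col i).+1 = col j.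
Proof.
move=> jn cj0; have [cpos|cneg] := ltrP 0 (c j).
  have cn0 : c j != 0 by rewrite gt_eqF.
  have := occ_gap_toward jn cn0; rewrite cpos expr1 => /occ_ex[i ij [ei eo]].
  exists i => //; move: cj0; rewrite /row /col ei eo; have [h|h|h] := ltrgt0P (c j); have [h'|h'|h'] := ltrgt0P (c j - 1); lia.
have := occ_gap true jn; rewrite expr1 => le.
have kp : (0 < occ j (c j))%N by move: cj0; rewrite /col ltNge cneg addn0.
have [|i ij [ei eo]] := @occ_ex j (c j - 1) (occ j (c j)).-1.
  by rewrite prednK.
exists i => //; move: cj0; rewrite /row /col ei eo; have [h|h|h] := ltrgt0P (c j); have [h'|h'|h'] := ltrgt0P (c j - 1); lia.
Qed.

Let row_prev j : (j < n)%N -> (0 < row j)%N ->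
  exists2 i, (i < j)%N & (row i).+1 = row j /\ col i = col j.
Proof.
move=> jn cj0; have [cneg|cpos] := ltrP (c j) 0.
  have cn0 : c j != 0 by rewrite lt_eqF.
  have := occ_gap_toward jn cn0; rewrite ltNge (ltW cneg) expr0 => /occ_ex[i ij [ei eo]].
  exists i => //; move: cj0; rewrite /row /col ei eo; have [h|h|h] := ltrgt0P (c j); have [h'|h'|h'] := ltrgt0P (c j + 1); lia.
have := occ_gap false jn; rewrite expr0 => le.
have kp : (0 < occ j (c j))%N by move: cj0; rewrite /row ltNge cpos addn0.
have [|i ij [ei eo]] := @occ_ex j (c j + 1) (occ j (c j)).-1.
  by rewrite prednK.
exists i => //; move: cj0; rewrite /row /col ei eo; have [h|h|h] := ltrgt0P (c j); have [h'|h'|h'] := ltrgt0P (c j + 1); lia.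
Qed.

Let row_col_le j : (j < n)%N -> (row j + col j <= j)%N.
Proof.
elim/ltn_ind: j => j IH jn.
have [r0|/row_prev[//|i ij [e1 e2]]] := posnP (row j); last first.
  have := IH i ij (ltn_trans ij jn); lia.
have [r1|/col_prev[//|i ij [e1 e2]]] := posnP (col j); first by rewrite r0 r1.
have := IH i ij (ltn_trans ij jn); lia.
Qed.

Lemma std_of_contents :
  exists2 t : {ffun 'I_n -> 'I_n * 'I_n}, std t & forall j : 'I_n, c j = content t j.
Proof.
have rn (j : 'I_n) : (row j < n)%N.
  by apply: leq_ltn_trans (ltn_ord j); have := row_col_le (ltn_ord j); lia.
have cn (j : 'I_n) : (col j < n)%N.
  by apply: leq_ltn_trans (ltn_ord j); have := row_col_le (ltn_ord j); lia.
pose t := [ffun j => (Ordinal (rn j), Ordinal (cn j))].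
have tr j : rowt t j = row j by rewrite /rowt ffunE.
have tc j : colt t j = col j by rewrite /colt ffunE.
exists t; last by move=> j; rewrite /content tr tc c_col_row.
split.
- move=> i j e; have er : row i = row j by rewrite -!tr /rowt e.
  have ec : col i = col j by rewrite -!tc /colt e.
  have eij : c i = c j by rewrite !c_col_row er ec.
  apply: val_inj; apply: occ_inj => //=.
  by move: er; rewrite /row eij => /addIn.
- move=> x; rewrite tc tr => /(col_prev (ltn_ord x))[i ix e].
  by exists (Ordinal (ltn_trans ix (ltn_ord x))); rewrite // tr tc.
move=> x; rewrite tc tr => /(row_prev (ltn_ord x))[i ix e].
by exists (Ordinal (ltn_trans ix (ltn_ord x))); rewrite // tr tc.
Qed.
End ContentCells.

(** * Growth sequences and swaps of consecutive entries *)

Section StandardTableaux.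
Variable n : nat.
Implicit Types (t : {ffun 'I_n -> 'I_n * 'I_n}) (x y i j : 'I_n).

Lemma cell_eq t t' x y : rowt t x = rowt t' y -> colt t x = colt t' y -> t x = t' y.
Proof.
rewrite /rowt /colt => /val_inj e1 /val_inj e2.
by rewrite [LHS]surjective_pairing e1 e2 -surjective_pairing.
Qed.

Lemma std_ideal t x r c : std t -> (r <= rowt t x)%N -> (c <= colt t x)%N ->
  exists2 y : 'I_n, (y <= x)%N & rowt t y = r /\ colt t y = c.
Proof.
move=> st; have [m] := ubnP (rowt t x + colt t x - (r + c)).
elim: m x => // m IH x lm rx cx; have [_ left up] := st.
case: (ltngtP r (rowt t x)) (rx) => [rlt _|//|er _].
  have [|z zx [e1 e2]] := up x; first exact: leq_ltn_trans rlt.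
  have [|||y yz H] := IH z; first by move: lm; rewrite -e1 e2; lia.
  - by rewrite -ltnS e1.
  - by rewrite e2.
  by exists y => //; apply: leq_trans yz (ltnW zx).
case: (ltngtP c (colt t x)) (cx) => [clt _|//|ec _]; last by exists x.
have [|z zx [e1 e2]] := left x; first exact: leq_ltn_trans clt.
have [|||y yz H] := IH z; first by move: lm; rewrite -e2 e1; lia.
- by rewrite e1 er.
- by rewrite -ltnS e2.
by exists y => //; apply: leq_trans yz (ltnW zx).
Qed.

Lemma std_le t x y : std t -> (rowt t x <= rowt t y)%N -> (colt t x <= colt t y)%N -> (x <= y)%N.
Proof.
move=> st r c; have [z zy [e1 e2]] := std_ideal st r c.
by have [inj _ _] := st; have <- : z = x by apply/inj/cell_eq.
Qed.

(** If the two cells are comparable, the predecessor of the cell of [j] on the way to that of [i]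
    holds an entry below [j] and not below [i], hence [i] itself. In the last two cases the cells
    are incomparable. *)
Lemma std_adjacent t i j : std t -> j = i.+1 :> nat ->
  [\/ rowt t j = rowt t i /\ colt t j = (colt t i).+1,
      rowt t j = (rowt t i).+1 /\ colt t j = colt t i,
      (rowt t i < rowt t j)%N /\ (colt t j < colt t i)%N |
      (rowt t j < rowt t i)%N /\ (colt t i < colt t j)%N].
Proof.
move=> st ji; have nle : ~~ ((rowt t j <= rowt t i) && (colt t j <= colt t i))%N.
  by apply/negP=> /andP[/(std_le st) h /h]; rewrite ji ltnn.
have [inj left up] := st.
have eqi y : (y < j)%N -> (i <= y)%N -> y = i.
  by rewrite ji ltnS => h1 h2; apply: val_inj; apply/eqP; rewrite eqn_leq h1.
have [rij|rij] := leqP (rowt t i) (rowt t j); have [cij|cij] := leqP (colt t i) (colt t j).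
- move: rij; rewrite leq_eqVlt => /orP[/eqP er|rlt].
    have [|y yj [e1 e2]] := left j.
      by move: nle; rewrite -er leqnn /= -ltnNge => /(leq_ltn_trans _); apply.
    constructor 1; have ey : y = i.
      apply: eqi => //; apply: std_le st _ _; first by rewrite e1 er.
      by move: nle; rewrite -er leqnn /= -ltnNge -e2.
    by rewrite -e2 ey.
  have [|y yj [e1 e2]] := up j; first exact: leq_ltn_trans rlt.
  constructor 2; have ey : y = i.
    by apply: eqi => //; apply: std_le st _ _; rewrite ?e2 // -ltnS e1.
  by rewrite -e1 -e2 ey.
- constructor 3; by move: nle; rewrite (ltnW cij) andbT -ltnNge => rlt; split.
- constructor 4; by move: nle; rewrite (ltnW rij) /= -ltnNge => clt; split.
- by move: nle; rewrite (ltnW rij) (ltnW cij).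
Qed.

Definition tswap t i j : {ffun 'I_n -> 'I_n * 'I_n} := [ffun x => t (tperm i j x)].

Lemma tswapK t i j : tswap (tswap t i j) i j = t.
Proof. by apply/ffunP => x; rewrite !ffunE tpermK. Qed.

Lemma tswap_im t i j : tswap t i j @: setT = t @: setT.
Proof.
apply/setP=> c; apply/imsetP/imsetP => [[x _ ->]|[x _ ->]].
  by exists (tperm i j x); rewrite ?ffunE.
by exists (tperm i j x); rewrite ?ffunE ?tpermK.
Qed.

Lemma tswap_std t i j : std t -> j = i.+1 :> nat ->
  content t j != content t i + 1 -> content t j != content t i - 1 -> std (tswap t i j).
Proof.
move=> st ji n1 n2; have [inj left up] := st.
have tr x : rowt (tswap t i j) x = rowt t (tperm i j x) by rewrite /rowt ffunE.
have tc x : colt (tswap t i j) x = colt t (tperm i j x) by rewrite /colt ffunE.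
have lt_swap y z : (y < tperm i j z)%N -> ~~ ((y == i) && (tperm i j z == j)) ->
    (tperm i j y < z)%N.
  have lij : (i < j)%N by rewrite ji.
  case: (tpermP i j z) => [->|->|/eqP zi /eqP zj];
  case: (tpermP i j y) => [->|->|/eqP yi /eqP yj];
  repeat (match goal with H : is_true (_ != _) |- _ => move: H end);
  by rewrite -?val_eqE /= ?ji; lia.
split.
- by move=> x y; rewrite !ffunE => /inj /perm_inj.
- move=> x; rewrite tc => /left[y yx [e1 e2]]; exists (tperm i j y).
    apply: lt_swap => //; apply/negP => /andP[/eqP yi /eqP xj].
    by move/eqP: n1; apply; move: e1 e2; rewrite yi xj /content; lia.
  by rewrite tr tc tpermK tr.
move=> x; rewrite tr => /up[y yx [e1 e2]]; exists (tperm i j y).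
  apply: lt_swap => //; apply/negP => /andP[/eqP yi /eqP xj].
  by move/eqP: n2; apply; move: e1 e2; rewrite yi xj /content; lia.
by rewrite tr tc tpermK tc.
Qed.

(** The entry of a cell is the number of cells with smaller key, which depends only on the set of
    cells. *)
Lemma sorted_tableau_uniq (key : 'I_n * 'I_n -> nat) t t' :
  (forall x y, (x < y)%N -> (key (t x) < key (t y))%N) ->
  (forall x y, (x < y)%N -> (key (t' x) < key (t' y))%N) ->
  t @: setT = t' @: setT -> t = t'.
Proof.
have keyE u : (forall x y, (x < y)%N -> (key (u x) < key (u y))%N) ->
    forall x y, (key (u x) < key (u y))%N = (x < y)%N.
  move=> mono x y; apply/idP/idP => [|/mono //]; case: (ltngtP x y) => //.
    by move=> /mono /ltnW; rewrite leqNgt => /negbTE ->.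
  by move=> /val_inj ->; rewrite ltnn.
have rk u : (forall x y, (x < y)%N -> (key (u x) < key (u y))%N) ->
   forall x, #|[set c in u @: setT | (key c < key (u x))%N]| = x.
  move=> mono x; have inj : injective u.
    by move=> y z e; apply: val_inj; case: (ltngtP y z) => // /mono; rewrite e ltnn.
  have -> : [set c in u @: setT | (key c < key (u x))%N] = u @: [set y : 'I_n | (y < x)%N].
    apply/setP=> c; rewrite !inE; apply/andP/imsetP => [[/imsetP[y _ ->]]|[y + ->]].
      by rewrite (keyE _ mono) => yx; exists y; rewrite ?inE.
    by rewrite inE => yx; rewrite (keyE _ mono) imset_f.
  rewrite card_imset // cardsE -sum1_card (big_ord_narrow (ltnW (ltn_ord x))) /=.
  by rewrite sum1_card card_ord.
move=> m m' e; apply/ffunP => x.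
have /imsetP[x' _ ex] : t x \in t' @: setT by rewrite -e imset_f.
by have := rk t m x; rewrite e ex (rk t' m') => /val_inj <-.
Qed.
End StandardTableaux.

(** * Joint eigenspaces of the Jucys-Murphy elements *)

Section TableauEigenspaces.
Variables (n d : nat) (rho : {perm 'I_n} -> 'M[algC]_d).
Hypothesis Urho : unitary_irrep rho.
Implicit Types (t : {ffun 'I_n -> 'I_n * 'I_n}) (v : 'rV[algC]_d).

Definition tspace t : 'M[algC]_d :=
  (\bigcap_(j : 'I_n) eigenspace (jm rho j) (content t j)%:~R)%MS.

Lemma tspaceP t v :
  reflect (forall j, v *m jm rho j = (content t j)%:~R *: v) (v <= tspace t)%MS.
Proof.
apply: (iffP sub_bigcapmxP) => [h j|h j _]; first exact/eigenspaceP/h.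
exact/eigenspaceP.
Qed.

Definition tseq t (k : nat) : algC := oapp (fun j : 'I_n => (content t j)%:~R) 0 (insub k).

Lemma tseqE t (j : 'I_n) : tseq t j = (content t j)%:~R.
Proof. by rewrite /tseq valK. Qed.

Lemma tspace_jeig t v : (v <= tspace t)%MS -> jeig rho v (tseq t).
Proof. by move=> /tspaceP h j; rewrite h tseqE. Qed.

Lemma jeig_tspace t v al : jeig rho v al -> (forall j : 'I_n, al j = (content t j)%:~R) ->
  (v <= tspace t)%MS.
Proof. by move=> jv e; apply/tspaceP => j; rewrite jv e. Qed.

(** The content lemmas are applied to the set of all sequences that have a nonzero eigenvector.
    Integrality starts from the entry 0 and passes to each entry from an earlier one at distance
    1. *)
Lemma jeig_std v al : v != 0 -> jeig rho v al -> exists2 t, std t & (v <= tspace t)%MS.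
Proof.
pose S al := exists2 v, v != 0 & jeig rho v al.
have SO be : S be -> (0 < n)%N -> be 0%N = 0.
  by case=> u u0 ju n0; apply: (jeig0 (j := Ordinal n0) u0 ju).
have Sneq be i : S be -> (i.+1 < n)%N -> be i != be i.+1.
  case=> u u0 ju i1; exact: (jeig_adj_neq Urho (i := Ordinal (ltnW i1)) (j := Ordinal i1) _ u0 ju).
have Sswap be i : S be -> (i.+1 < n)%N -> be i.+1 != be i + 1 -> be i.+1 != be i - 1 ->
    S (swapseq i be).
  case=> u u0 ju i1 n1 n2; eexists.
    exact: (jeig_swap_neq0 Urho (i := Ordinal (ltnW i1)) (j := Ordinal i1) u0 ju n1 n2).
  exact: (jeig_swap Urho (i := Ordinal (ltnW i1)) (j := Ordinal i1) _ u0 ju).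
have Sbraid be i (b : bool) : S be -> (i.+2 < n)%N -> be i.+1 = be i + (-1) ^+ b -> be i.+2 != be i.
  case=> u u0 ju i2 e; have i1 := ltnW i2.
  apply: (jeig_no_braid Urho (i := Ordinal (ltnW i1)) (j := Ordinal i1) (k := Ordinal i2) _ _ u0 ju _ _ e) => //.
    by rewrite sqrr_sign.
  by rewrite rmorph_sign.
move=> v0 jv; have Sal : S al by exists v.
have int_al k : (k < n)%N -> al k \is a Num.int.
  elim/ltn_ind: k => k IH kn; have [k0|k0] := posnP k; first by rewrite k0 (SO _ Sal) // -k0.
  have [|i ik [b e]] := content_neighbour SO Sneq Sswap Sal (q := k); first by rewrite k0.
  have -> : al k = al i - (-1) ^+ b by rewrite e addrK.
  by rewrite rpredB ?rpred_sign // IH // (ltn_trans ik).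
pose c k := Num.floor (al k).
have cE k : (k < n)%N -> (c k)%:~R = al k by move=> kn; apply/floorK/int_al.
have ceq k m : (k < n)%N -> (c k)%:~R = m%:~R :> algC -> c k = m by move=> _ /intr_inj.
have [|||t st e] := @std_of_contents n c.
- by move=> n0; apply: (ceq _ _ n0); rewrite cE // (SO _ Sal).
- move=> q qn; have [i iq [b e]] := content_neighbour SO Sneq Sswap Sal qn.
  have /andP[_ qn'] := qn; have i_n := ltn_trans iq qn'.
  exists i => //; exists b; apply: (ceq _ _ i_n).
  by rewrite rmorphD rmorph_sign /= !cE.
- move=> p q b pq e; have /andP[pq' qn] := pq; have pn := ltn_trans pq' qn.
  have [|i iq ei] := content_gap Sneq Sswap Sbraid b (leqnn _) Sal pq _.
    by rewrite -!cE // e.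
  exists i => //; have /andP[_ iq'] := iq; have i_n := ltn_trans iq' qn.
  by apply: (ceq _ _ i_n); rewrite rmorphD rmorph_sign /= !cE.
exists t => //; apply: (jeig_tspace jv) => j; by rewrite -e cE.
Qed.

Lemma exists_jeig : (0 < d)%N -> exists2 t, std t & tspace t != 0.
Proof.
move=> d0; have [|v v0 /allP sv] := common_eigenvector (As := [seq jm rho j | j : 'I_n]) d0.
  by move=> _ _ /imageP[i _ ->] /imageP[j _ ->]; apply: jm_comm.
have [a av] : exists a : 'I_n -> algC, forall j, v *m jm rho j = a j *: v.
  apply: (@fin_all_exists _ _ (fun j aj => v *m jm rho j = aj *: v)) => j; apply/sub_rVP.
  by apply: sv; apply/imageP; exists j.
have [|t st vt] := @jeig_std v (fun k => oapp a 0 (insub k)) v0.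
  by move=> j; rewrite valK av.
by exists t => //; apply: contraNneq v0 => e; rewrite -submx0 -e.
Qed.

(** Right multiplication by the intertwiner [s - c%:M] maps one eigenspace into the other, and it is
    invertible since (s - c)(s + c) = 1 - c^2 is a nonzero scalar. *)
Lemma tspace_swap_le t (i j : 'I_n) : std t -> j = i.+1 :> nat ->
  content t j != content t i + 1 -> content t j != content t i - 1 ->
  (\rank (tspace t) <= \rank (tspace (tswap t i j)))%N.
Proof.
move=> st ji n1 n2; set s := rho (tperm i j).
pose c : algC := ((content t j)%:~R - (content t i)%:~R)^-1.
have c1 : 1 - c * c != 0.
  rewrite subr_eq0 eq_sym -expr2 sqrf_eq1 /c !invr_eq1 -invrN1 (inj_eq invr_inj) -rmorphB /=.
  rewrite -[1]/(1%:~R) -rmorphN /= !eqr_int.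
  by move: n1 n2; lia.
have Bu : s - c%:M \in unitmx.
  have e : (s - c%:M) *m (s + c%:M) = (1 - c * c)%:M.
    rewrite mulmxBl !mulmxDr adj_ss // scalar_mxC -scalar_mxM opprD addrA addrK.
    by rewrite raddfB.
  have /mulmx1_unit[] // : (s - c%:M) *m ((1 - c * c)^-1 *: (s + c%:M)) = 1%:M.
  by rewrite -scalemxAr e scale_scalar_mx mulVf.
rewrite -(mxrankMfree (tspace t) (B := s - c%:M)) ?row_free_unit //; apply: mxrankS.
apply/rV_subP => _ /submxP[w ->]; rewrite mulmxA.
set v := w *m _; have vt : (v <= tspace t)%MS by apply: submxMl.
have [->|v0] := eqVneq v 0; first by rewrite mul0mx sub0mx.
have jv := tspace_jeig vt.
have := jeig_swap Urho ji v0 jv; rewrite !tseqE -/c -/s mulmxBr mul_mx_scalar => jw.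
apply: (jeig_tspace jw) => k; rewrite /swapseq -ji.
have cs : content (tswap t i j) k = content t (tperm i j k) by rewrite /content /rowt /colt !ffunE.
rewrite cs; have [/val_inj ->|ki] := eqVneq (k : nat) i; first by rewrite tpermL tseqE.
have [/val_inj ->|kj] := eqVneq (k : nat) j; first by rewrite tpermR tseqE.
by rewrite tpermD ?tseqE // eq_sym.
Qed.

Lemma tspace_swap t (i j : 'I_n) : std t -> j = i.+1 :> nat ->
  content t j != content t i + 1 -> content t j != content t i - 1 ->
  \rank (tspace (tswap t i j)) = \rank (tspace t).
Proof.
move=> st ji n1 n2; apply/eqP; rewrite eqn_leq [X in _ && X]tspace_swap_le // andbT.
rewrite -{2}(tswapK t i j); apply: tspace_swap_le => //; first exact: tswap_std.
  all: rewrite /content /rowt /colt !ffunE tpermL tpermR -!/(colt _ _) -!/(rowt _ _).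
  all: move: n1 n2; rewrite /content; lia.
Qed.

(** The assumptions on [key] ensure that consecutive entries in the wrong order never occupy
    neighbouring cells, so their swap is admissible and preserves the rank. Each such swap increases
    the bounded potential [pot]. *)
Lemma tspace_sort (key : 'I_n * 'I_n -> nat) t :
  (forall (u : {ffun 'I_n -> 'I_n * 'I_n}) (x y : 'I_n), std u -> y = x.+1 :> nat -> rowt u y = rowt u x -> colt u y = (colt u x).+1 ->
     (key (u x) < key (u y))%N) ->
  (forall (u : {ffun 'I_n -> 'I_n * 'I_n}) (x y : 'I_n), std u -> y = x.+1 :> nat -> rowt u y = (rowt u x).+1 -> colt u y = colt u x ->
     (key (u x) < key (u y))%N) ->
  injective key -> std t ->
  exists u, [/\ std u, u @: setT = t @: setT, \rank (tspace u) = \rank (tspace t) &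
     forall x y : 'I_n, (x < y)%N -> (key (u x) < key (u y))%N].
Proof.
move=> kr kc ki; pose K := \max_c key c.
pose pot u := (\sum_(x : 'I_n) x * key (u x))%N.
have potK u : (pot u <= n * (n * K))%N.
  rewrite -[X in (_ <= X * _)%N]card_ord -sum_nat_const; apply: leq_sum => x _.
  by apply: leq_mul; [apply: ltnW | apply: leq_bigmax].
have [m] := ubnP (n * (n * K) - pot t); elim: m t => // m IH t lm st.
have [/forallP srt|] := boolP [forall x : 'I_n, forall y : 'I_n, (y == x.+1 :> nat) ==> (key (t x) < key (t y))%N].
  exists t; split=> // x y xy.
  have [k] := ubnP (y - x); elim: k y xy => // k IHk y xy lk.
  have y1 : (y.-1 < n)%N by apply: leq_ltn_trans (ltn_ord y); apply: leq_pred.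
  have ky : (key (t (Ordinal y1)) < key (t y))%N.
    have /forallP/(_ y)/implyP := srt (Ordinal y1); apply; rewrite /= prednK //.
    exact: leq_ltn_trans xy.
  have [e|ne] := eqVneq x (Ordinal y1); first by rewrite e.
  apply: ltn_trans ky; apply: IHk => /=; move: ne xy lk; rewrite -val_eqE /=; lia.
rewrite negb_forall => /existsP[x]; rewrite negb_forall => /existsP[y].
rewrite negb_imply -leqNgt => /andP[/eqP yx kle].
have nxy : x != y by rewrite -val_eqE /= yx ltn_eqF.
have klt : (key (t y) < key (t x))%N.
  rewrite ltn_neqAle kle andbT; apply: contra nxy => /eqP /ki.
  by have [inj _ _] := st => /inj ->.
have [n1 n2] : content t y != content t x + 1 /\ content t y != content t x - 1.
  have [[e1 e2]|[e1 e2]|h|h] := std_adjacent st yx; last 2 first.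
  - by rewrite /content; move: h => []; split; lia.
  - by rewrite /content; move: h => []; split; lia.
  - by have := kr t x y st yx e1 e2; rewrite ltnNge kle.
  - by have := kc t x y st yx e1 e2; rewrite ltnNge kle.
have sst := tswap_std st yx n1 n2.
have [|u [su iu ru ku]] := IH (tswap t x y) _ sst; last first.
  by exists u; rewrite iu ru tswap_im tspace_swap.
have lt_pot : (pot t < pot (tswap t x y))%N.
  rewrite /pot (bigD1 x) //= (bigD1 y) 1?eq_sym //= [X in (_ < X)%N](bigD1 x) //=.
  rewrite [X in (_ < _ + X)%N](bigD1 y) 1?eq_sym //= !ffunE tpermL tpermR !addnA.
  have -> : (\sum_(i | (i != x) && (i != y)) i * key (tswap t x y i) =
             \sum_(i | (i != x) && (i != y)) i * key (t i))%N.
    by apply: eq_bigr => z /andP[zx zy]; rewrite ffunE tpermD // eq_sym.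
  by rewrite ltn_add2r yx; nia.
have := potK (tswap t x y); lia.
Qed.
End TableauEigenspaces.

(** * Young subgroups and the shape of the tableaux *)

Section ColourStabilisers.
Variable n : nat.
Implicit Types (phi psi : 'I_n -> nat) (g h : {perm 'I_n}) (b : bool).

Definition stab phi : {set {perm 'I_n}} := [set s : {perm 'I_n} | [forall x, phi (s x) == phi x]].

Lemma stabP phi (s : {perm 'I_n}) : reflect (forall x, phi (s x) = phi x) (s \in stab phi).
Proof. by rewrite inE; apply: (iffP forallP) => h x; apply/eqP. Qed.

Lemma stab_group_set phi : group_set (stab phi).
Proof.
apply/group_setP; split=> [|s u /stabP hs /stabP hu]; apply/stabP=> x; rewrite ?perm1 //.
by rewrite permM hu hs.
Qed.
Canonical stab_group phi := Group (stab_group_set phi).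

Lemma card_stab_neq0 phi : #|stab phi|%:R != 0 :> algC.
Proof. by rewrite pnatr_eq0 -lt0n cardG_gt0. Qed.

Lemma tperm_stab phi x y : phi x = phi y -> tperm x y \in stab phi.
Proof. by move=> e; apply/stabP => z; case: tpermP => [->|->|]. Qed.

(* The trivial character for b = false, the sign character for b = true. *)
Definition lin b g : algC := (-1) ^+ (b && odd_perm g).

Lemma linM b g h : lin b (g * h)%g = lin b g * lin b h.
Proof. by case: b; rewrite /lin /= ?mul1r // odd_permM signr_addb. Qed.

Lemma linJ b g h : lin b (g ^ h)%g = lin b g.
Proof. by rewrite /lin odd_permJ. Qed.

Lemma linV b g : lin b g^-1%g = lin b g.
Proof. by rewrite /lin odd_permV. Qed.

Lemma lin_sqr b g : lin b g * lin b g = 1.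
Proof. by rewrite /lin -expr2 sqrr_sign. Qed.

(** By Frobenius reciprocity, the multiplicity of ['chi_i] in the character induced from [lin b] on
    the Young subgroup [stab phi]. *)
Definition colmult (i : Iirr (Sn n)) b phi : algC :=
  #|stab phi|%:R^-1 * \sum_(h in stab phi) lin b h * 'chi_i h.

Section Projector.
Variables (d : nat) (rho : {perm 'I_n} -> 'M[algC]_d).
Hypothesis Urho : unitary_irrep rho.

Definition colproj b phi : 'M[algC]_d :=
  #|stab phi|%:R^-1 *: \sum_(h in stab phi) lin b h *: rho h.

Lemma idem_tr_rank (e : 'M[algC]_d) : e *m e = e -> \tr e = (\rank e)%:R.
Proof.
move=> ee; have := mulmx_base e; have := row_base_free e; have := col_base_full e.
move: (col_base e) (row_base e) => C R /row_fullP[C' CC'] /row_freeP[R' RR'] defe.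
have RC : R *m C = 1%:M.
  have : C' *m ((C *m R) *m (C *m R)) *m R' = C' *m (C *m R) *m R' by rewrite defe ee.
  by rewrite !mulmxA CC' !mul1mx -!mulmxA RR' !mulmx1.
by rewrite -{1}defe mxtrace_mulC RC mxtrace1.
Qed.

Lemma colproj_fix b phi m (U : 'M[algC]_(m, d)) :
  (forall h, h \in stab phi -> U *m rho h = lin b h *: U) -> U *m colproj b phi = U.
Proof.
move=> fixU; rewrite /colproj -scalemxAr mulmx_sumr.
under eq_bigr => h hh do rewrite -scalemxAr fixU // scalerA lin_sqr scale1r.
by rewrite sumr_const -scaler_nat scalerA mulVf ?scale1r // card_stab_neq0.
Qed.

Lemma colproj_act b phi h : h \in stab phi -> colproj b phi *m rho h = lin b h *: colproj b phi.
Proof.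
move=> hh; rewrite /colproj -scalemxAl scalerA mulrC -scalerA; congr (_ *: _).
rewrite mulmx_suml scaler_sumr [RHS](reindex_inj (mulIg h)) /=.
apply: eq_big => [g|g _]; first by rewrite groupMr.
by rewrite -scalemxAl -rhoM // scalerA linM mulrCA lin_sqr mulr1.
Qed.

Lemma colproj_tr b phi : \tr (colproj b phi) = (\rank (colproj b phi))%:R.
Proof. by apply: idem_tr_rank; apply: colproj_fix => h; apply: colproj_act. Qed.

Lemma colmultE (i : Iirr (Sn n)) b phi : (forall g, \tr (rho g) = 'chi_i g) ->
  colmult i b phi = (\rank (colproj b phi))%:R.
Proof.
move=> tri; rewrite -colproj_tr /colproj mxtraceZ raddf_sum /=; congr (_ * _).
by apply: eq_bigr => h _; rewrite mxtraceZ tri.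
Qed.
End Projector.

Lemma colmult_nat i b phi : exists m : nat, colmult i b phi = m%:R.
Proof.
have [d [rho urho tri]] := irr_unitary i erefl.
by exists (\rank (colproj rho b phi)); apply: colmultE.
Qed.

(** Injectivity of the joint colouring says that its stabiliser, the intersection of [stab phi] with
    a conjugate of [stab psi], is trivial; these [x] correspond to the 0-1 matrices with prescribed
    row and column sums. *)
Definition pair_inj phi psi (x : {perm 'I_n}) := injectiveb [ffun j => (phi j, psi (x j))].

Lemma conj_stab psi h (x : {perm 'I_n}) : (h ^ x \in stab psi)%g = (h \in stab (psi \o x)).
Proof.
apply/stabP/stabP => [H j|H j] /=.
  by have := H (x j); rewrite conjgE !permM permK.
by have := H ((x^-1)%g j); rewrite /= conjgE !permM permKV.
Qed.

(* A transposition in the intersection cancels the sum, so only trivial intersections count. *)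
Lemma sum_sign_stabs phi psi x :
  \sum_(h in stab phi) (if (h ^ x)%g \in stab psi then lin true (h ^ x)%g else 0)
    = (pair_inj phi psi x)%:R.
Proof.
rewrite -big_mkcondr /=.
have inL h : (h \in stab phi) && ((h ^ x)%g \in stab psi) = (h \in stab phi :&: stab (psi \o x)).
  by rewrite conj_stab in_setI.
rewrite (eq_bigl _ _ inL) (eq_bigr _ (fun h _ => linJ true h x)).
have [/injectiveP inj|] := boolP (pair_inj phi psi x).
  rewrite (big_pred1 1%g) ?/lin ?odd_perm1 // => h; apply/idP/eqP => [|->].
    rewrite in_setI => /andP[/stabP H1 /stabP H2]; apply/permP => j; rewrite perm1.
    by apply: inj; rewrite !ffunE H1; have /= -> := H2 j.
  exact: group1.
move=> /injectivePn[j [k njk]]; rewrite !ffunE => -[e1 e2].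
have tL : tperm j k \in stab phi :&: stab (psi \o x) by rewrite in_setI !tperm_stab.
set Sm := \sum_(h | _) _; have : Sm = - Sm.
  rewrite {1}/Sm (reindex_inj (mulIg (tperm j k))) /= -sumrN.
  apply: eq_big => [h|h _]; first by rewrite groupMr.
  by rewrite linM [lin _ (tperm _ _)]/lin odd_tperm njk mulrN1.
by move=> /eqP; rewrite -addr_eq0 -mulr2n mulrn_eq0 /= => /eqP.
Qed.

Lemma card_conj_eq h (k : {perm 'I_n}) : #|[set x : {perm 'I_n} | (h ^ x)%g == k]| = (#|'C[h]%g| * (k \in (h ^: setT)%g))%N.
Proof.
have [/imsetP[x0 _ ->]|nk] := boolP (k \in _).
  rewrite muln1 -(card_rcoset 'C[h]%g x0); apply: eq_card => x; rewrite inE mem_rcoset cent1E.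
  rewrite [X in _ = (_ == X)]conjgC (inj_eq (mulgI _)) conjgM -[RHS](inj_eq (conjg_inj x0)) conjgKV.
  exact: eq_sym.
rewrite muln0; apply: eq_card0 => x; rewrite inE; apply: contraNF nk => /eqP <-.
by rewrite imset_f ?inE.
Qed.

(** The left side is the inner product of the two induced characters. The second orthogonality
    relation replaces the sum over [i] by a sum over conjugating elements [x], each of which
    contributes as in [sum_sign_stabs]. *)
Lemma mackey phi psi :
  \sum_i colmult i false phi * colmult i true psi =
    #|[set x | pair_inj phi psi x]|%:R / (#|stab phi|%:R * #|stab psi|%:R).
Proof.
have conj_mult i : colmult i true psi = #|stab psi|%:R^-1 * \sum_(k in stab psi) lin true k * ('chi_i k)^*.
  congr (_ * _); rewrite (reindex_inj invg_inj) /=; apply: eq_big => [k|k _]; first exact: groupV.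
  by rewrite linV irr_inv.
under eq_bigr => i _ do rewrite conj_mult /colmult mulrACA.
rewrite -mulr_sumr -invfM mulrC; congr (_ / _).
under eq_bigr => i _ do rewrite mulr_suml; rewrite exchange_big /=.
have -> : \sum_(h in stab phi) \sum_(i : Iirr (Sn n)) (lin false h * 'chi_i h) * (\sum_(k in stab psi) lin true k * ('chi_i k)^*)
  = \sum_(h in stab phi) \sum_x (if (h ^ x)%g \in stab psi then lin true (h ^ x)%g else 0).
  apply: eq_bigr => h _; under eq_bigr => i _ do rewrite mulr_sumr; rewrite exchange_big /=.
  rewrite [RHS](partition_big (fun x => (h ^ x)%g) xpredT) //= [LHS]big_mkcond /=.
  apply: eq_bigr => k _; have [kK|kK] := boolP (k \in _); last first.
    by rewrite big1 // => x /eqP ->; rewrite (negbTE kK).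
  under eq_bigr => i _ do rewrite /lin /= mul1r mulrCA; rewrite -mulr_sumr.
  rewrite second_orthogonality_relation ?inE //.
  under [RHS]eq_bigr => x /eqP -> do rewrite kK.
  rewrite sumr_const -[RHS]mulr_natr; congr (_ * _).
  transitivity (#|[set x : {perm 'I_n} | (h ^ x)%g == k]|%:R : algC); last first.
    by congr (_%:R); apply: eq_card => x; rewrite !inE.
  by rewrite card_conj_eq natrM mulr_natr setTI class_sym; case: (_ \in _).
rewrite exchange_big /=; under eq_bigr do rewrite sum_sign_stabs.
rewrite -natr_sum -sum1_card [in RHS]big_mkcond /=; congr (_%:R).
by apply: eq_bigr => x _; rewrite inE; case: (pair_inj _ _ _).
Qed.
End ColourStabilisers.

(** * Adjacent transpositions and sorted tableaux *)

Section AdjacentGeneration.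
Variable n : nat.

(** The colour classes of a nondecreasing colouring are intervals, so transpositions of neighbours
    inside a class generate the stabiliser; this is phrased as an induction principle. *)
Lemma adjacent_gen (phi : 'I_n -> nat) (P : {perm 'I_n} -> Prop) :
  (forall x y : 'I_n, (x <= y)%N -> (phi x <= phi y)%N) ->
  P 1%g -> (forall g h, P g -> P h -> P (g * h)%g) ->
  (forall i j : 'I_n, j = i.+1 :> nat -> phi i = phi j -> P (tperm i j)) ->
  forall h, h \in stab phi -> P h.
Proof.
move=> mono P1 PM Padj.
have Pt m : forall x y : 'I_n, (x < y)%N -> (y - x <= m)%N -> phi x = phi y -> P (tperm x y).
  elim: m => [x y xy|m IH x y xy lm e]; first by rewrite leqn0 subn_eq0 leqNgt xy.
  have y1 : (y.-1 < n)%N by apply: leq_ltn_trans (ltn_ord y); apply: leq_pred.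
  pose z := Ordinal y1; have yz : y = z.+1 :> nat by rewrite /= prednK // (leq_ltn_trans _ xy).
  have xz : (x <= z)%N by rewrite -ltnS -yz.
  have ez : phi z = phi y.
    by apply/eqP; rewrite eqn_leq mono ?yz //= -e mono.
  have [xe|ne] := eqVneq x z; first by rewrite xe; apply: Padj.
  have Pzy := Padj z y yz ez.
  have xltz : (x < z)%N by rewrite ltn_neqAle ne.
  have -> : tperm x y = (tperm z y * tperm x z * tperm z y)%g.
    apply/esym; rewrite -{1}tpermV -mulgA -conjgE tpermJ tpermL tpermD //; first by rewrite eq_sym.
    by rewrite -val_eqE /= gtn_eqF.
  apply: (PM _ _ (PM _ _ Pzy _) Pzy); apply: IH => //; last by rewrite ez.
  by rewrite -ltnS (leq_trans _ lm) // yz subSn.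
have Pt' x y : x != y -> phi x = phi y -> P (tperm x y).
  move=> nxy e; case: (ltngtP x y) => xy; first exact: (Pt (y - x)%N).
    by rewrite tpermC; apply: (Pt (x - y)%N).
  by rewrite (val_inj xy) eqxx in nxy.
move=> h; have [m] := ubnP #|[set x | h x != x]|; elim: m h => // m IH h lm hh.
have [/forallP fix_h|] := boolP [forall x, h x == x].
  by have -> : h = 1%g by apply/permP => x; rewrite perm1; apply/eqP.
rewrite negb_forall => /existsP[x hx].
have ehx : phi x = phi (h x) by rewrite (stabP _ _ hh).
pose h' := (h * tperm x (h x))%g.
have -> : h = (h' * tperm x (h x))%g by rewrite /h' -mulgA tperm2 mulg1.
apply: PM; last by apply: Pt'; rewrite // eq_sym.
apply: IH; last by rewrite groupM ?tperm_stab.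
rewrite -ltnS; apply: leq_ltn_trans lm; apply: proper_card; apply/properP; split.
  apply/subsetP => y; rewrite !inE; apply: contra => /eqP hy.
  rewrite permM hy tpermD //; first by apply: contra hx => /eqP ->; rewrite hy.
  by apply: contra hx => /eqP e; rewrite -(inj_eq (@perm_inj _ h)) e hy.
by exists x; rewrite inE // permM tpermR eqxx.
Qed.
End AdjacentGeneration.

Section SortedTableaux.
Variables (n d : nat) (rho : {perm 'I_n} -> 'M[algC]_d).
Hypothesis Urho : unitary_irrep rho.
Implicit Types (t : {ffun 'I_n -> 'I_n * 'I_n}).

Definition rowkey (c : 'I_n * 'I_n) : nat := (c.1 * n + c.2)%N.
Definition colkey (c : 'I_n * 'I_n) : nat := (c.2 * n + c.1)%N.

Lemma rowkey_inj : injective rowkey.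
Proof.
move=> [a b] [a' b'] e; have n0 : (0 < n)%N by apply: leq_ltn_trans (ltn_ord a).
have := congr1 (fun k => k %/ n)%N e; have := congr1 (fun k => k %% n)%N e.
rewrite /rowkey /= !modnMDl !divnMDl // !divn_small // !modn_small // !addn0.
by move=> /val_inj -> /val_inj ->.
Qed.

Lemma colkey_inj : injective colkey.
Proof. by move=> [a b] [a' b'] /(@rowkey_inj (b, a) (b', a')) [-> ->]. Qed.

Lemma key_lt_le (a a' b b' : 'I_n) : (a * n + b < a' * n + b')%N -> (a <= a')%N.
Proof. by move=> h; rewrite leqNgt; apply/negP => h'; have := ltn_ord b'; nia. Qed.

Lemma tspace_act t (i j : 'I_n) (b : bool) : j = i.+1 :> nat ->
  content t j = content t i + (-1) ^+ b ->
  tspace rho t *m rho (tperm i j) = (-1) ^+ b *: tspace rho t.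
Proof.
move=> ji e; apply/row_matrixP => k; rewrite row_mul linearZ /=.
have vt : (row k (tspace rho t) <= tspace rho t)%MS by apply: row_sub.
have [->|v0] := eqVneq (row k (tspace rho t)) 0; first by rewrite mul0mx scaler0.
apply: (jeig_sign Urho ji v0 (tspace_jeig vt)).
- by rewrite sqrr_sign.
- by rewrite rmorph_sign.
by rewrite !tseqE e rmorphD rmorph_sign.
Qed.

Lemma tspace_act_stab t (b : bool) phi :
  (forall x y : 'I_n, (x <= y)%N -> (phi x <= phi y)%N) ->
  (forall i j : 'I_n, j = i.+1 :> nat -> phi i = phi j -> content t j = content t i + (-1) ^+ b) ->
  forall h, h \in stab phi -> tspace rho t *m rho h = lin b h *: tspace rho t.
Proof.
move=> mono cont; apply: (adjacent_gen mono).
- by rewrite (rho1 Urho) /lin odd_perm1 andbF mulmx1 scale1r.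
- by move=> g h eg eh; rewrite (rhoM Urho) mulmxA eg -scalemxAl eh scalerA linM.
move=> i j ji eij; have nij : i != j by rewrite -val_eqE /= ji ltn_eqF.
by rewrite (tspace_act ji (cont _ _ ji eij)) /lin odd_tperm nij andbT.
Qed.

(** In row reading order, consecutive entries of one row sit in neighbouring cells and their
    contents differ by 1, so the transposition acts by +1. Columns give -1 in the same way. *)
Lemma sorted_rows_act t : std t ->
  (forall x y : 'I_n, (x < y)%N -> (rowkey (t x) < rowkey (t y))%N) ->
  forall h, h \in stab (rowt t) -> tspace rho t *m rho h = lin false h *: tspace rho t.
Proof.
move=> st srt; apply: tspace_act_stab => [x y|i j ji e].
  by rewrite leq_eqVlt => /orP[/eqP/val_inj -> //|/srt /key_lt_le].
have [[e1 e2]|[e1 e2]|[e1 e2]|[e1 e2]] := std_adjacent st ji.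
- by rewrite /content e2 e1 expr0 -addn1 PoszD addrAC.
- by move: e1; rewrite e; lia.
- by rewrite e ltnn in e1.
by rewrite e ltnn in e1.
Qed.

Lemma sorted_cols_act t : std t ->
  (forall x y : 'I_n, (x < y)%N -> (colkey (t x) < colkey (t y))%N) ->
  forall h, h \in stab (colt t) -> tspace rho t *m rho h = lin true h *: tspace rho t.
Proof.
move=> st srt; apply: tspace_act_stab => [x y|i j ji e].
  by rewrite leq_eqVlt => /orP[/eqP/val_inj -> //|/srt /key_lt_le].
have [[e1 e2]|[e1 e2]|[e1 e2]|[e1 e2]] := std_adjacent st ji.
- by move: e2; rewrite e; lia.
- by rewrite /content e2 e1 expr1 -addn1 PoszD opprD addrA.
- by rewrite e ltnn in e2.
by rewrite e ltnn in e2.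
Qed.

Lemma rank_tspace_le b phi t :
  (forall h, h \in stab phi -> tspace rho t *m rho h = lin b h *: tspace rho t) ->
  (\rank (tspace rho t) <= \rank (colproj rho b phi))%N.
Proof. by move=> /colproj_fix <-; apply: mxrankM_maxr. Qed.

Lemma sort_rows t : std t -> exists u, [/\ std u, u @: setT = t @: setT,
  \rank (tspace rho u) = \rank (tspace rho t) &
  forall x y : 'I_n, (x < y)%N -> (rowkey (u x) < rowkey (u y))%N].
Proof.
move=> st; apply: tspace_sort st => //; last exact: rowkey_inj.
- by move=> u x y _ _; rewrite /rowkey -!/(rowt u _) -!/(colt u _) => -> ->; rewrite addnS.
move=> u x y _ _; rewrite /rowkey -!/(rowt u _) -!/(colt u _) => -> ->.
by rewrite ltn_add2r ltn_pmul2r // (leq_ltn_trans _ (ltn_ord x)).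
Qed.

Lemma sort_cols t : std t -> exists u, [/\ std u, u @: setT = t @: setT,
  \rank (tspace rho u) = \rank (tspace rho t) &
  forall x y : 'I_n, (x < y)%N -> (colkey (u x) < colkey (u y))%N].
Proof.
move=> st; apply: tspace_sort st => //; last exact: colkey_inj.
- move=> u x y _ _; rewrite /colkey -!/(rowt u _) -!/(colt u _) => -> ->.
  by rewrite ltn_add2r ltn_pmul2r // (leq_ltn_trans _ (ltn_ord x)).
by move=> u x y _ _; rewrite /colkey -!/(rowt u _) -!/(colt u _) => -> ->; rewrite addnS.
Qed.
End SortedTableaux.

(** * Counting colours and the Gale-Ryser inequalities *)

Section ColourCounting.
Variable n : nat.
Implicit Types (phi psi : 'I_n -> nat) (t : {ffun 'I_n -> 'I_n * 'I_n}).

Definition cnt phi r : nat := #|[set x | phi x == r]|.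
Definition below psi c : nat := #|[set x | (psi x < c)%N]|.
Definition rowpart phi psi r c : nat := #|[set x | (phi x == r) && (psi x < c)%N]|.

Lemma below_split phi psi R c : (forall x, (phi x < R)%N) ->
  below psi c = (\sum_(r < R) rowpart phi psi r c)%N.
Proof.
move=> pR; rewrite /below -sum1_card (partition_big (fun x => Ordinal (pR x)) xpredT) //=.
apply: eq_bigr => r _; rewrite /rowpart -sum1_card; apply: eq_bigl => x.
by rewrite !inE andbC -val_eqE.
Qed.

Lemma belowS psi c : below psi c.+1 = (below psi c + cnt psi c)%N.
Proof.
rewrite /below /cnt -cardsUI.
have -> : [set x | (psi x < c)%N] :&: [set x | psi x == c] = set0.
  by apply/setP=> x; rewrite !inE; apply/negP => /andP[h /eqP e]; rewrite e ltnn in h.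
rewrite cards0 addn0; apply: eq_card => x; rewrite !inE.
by rewrite ltnS leq_eqVlt orbC.
Qed.

Lemma below_perm psi (s : {perm 'I_n}) c : below (psi \o s) c = below psi c.
Proof.
rewrite /below -[RHS](card_imset _ (@perm_inj _ s^-1%g)); apply: eq_card => x.
rewrite !inE; apply/idP/imsetP => [h|[y + ->]]; last by rewrite !inE /= permKV.
by exists (s x); rewrite ?permK ?inE.
Qed.

Lemma rowpart_le phi psi r c : injective (fun x => (phi x, psi x)) ->
  (rowpart phi psi r c <= minn (cnt phi r) c)%N.
Proof.
move=> inj; rewrite leq_min subset_leq_card /=; last first.
  by apply/subsetP => x; rewrite !inE => /andP[].
case: c => [|c]; first by rewrite leqn0 cards_eq0; apply/eqP/setP => x; rewrite !inE andbF.
rewrite /rowpart -[X in (_ <= X)%N]card_ord -(@card_in_imset _ _ (fun x => inord (psi x) : 'I_c.+1)).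
  exact: max_card.
move=> x y; rewrite !inE => /andP[/eqP ex lx] /andP[/eqP ey ly] e.
by apply: inj; rewrite ex ey; congr (_, _); rewrite -(inordK lx) e inordK.
Qed.

Lemma gale_ryser phi psi R c : (forall x, (phi x < R)%N) -> injective (fun x => (phi x, psi x)) ->
  (below psi c <= \sum_(r < R) minn (cnt phi r) c)%N.
Proof. by move=> pR inj; rewrite (below_split _ _ pR); apply: leq_sum => r _; apply: rowpart_le. Qed.

Lemma gale_ryser_eq phi psi R c : (forall x, (phi x < R)%N) -> injective (fun x => (phi x, psi x)) ->
  below psi c = (\sum_(r < R) minn (cnt phi r) c)%N ->
  forall r : 'I_R, rowpart phi psi r c = minn (cnt phi r) c.
Proof.
move=> pR inj; rewrite (below_split _ _ pR) => e r; apply/eqP.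
have [_ ] := leqif_sum (fun (r : 'I_R) (_ : true) => (rowpart_le r c inj, erefl) : leqif _ _ _).
by rewrite e eqxx => /esym/forallP/(_ r).
Qed.

Lemma std_pair_inj t : std t -> injective (fun x => (rowt t x, colt t x)).
Proof. by case=> inj _ _ x y [e1 e2]; apply/inj/cell_eq. Qed.

Lemma std_rowpart t r c : std t -> rowpart (rowt t) (colt t) r c = minn (cnt (rowt t) r) c.
Proof.
move=> st; apply/eqP; rewrite eqn_leq rowpart_le /=; last exact: std_pair_inj.
case: c => [|c]; first by rewrite minn0.
have [/existsP[x /andP[/eqP rx cx]]|] := boolP [exists x, (rowt t x == r) && (c <= colt t x)%N].
  apply: leq_trans (geq_minr _ _) _; rewrite -[X in (X <= _)%N]card_ord.
  have ex (k : 'I_c.+1) : exists y : 'I_n, rowt t y = r /\ colt t y = k.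
    have [||y _ H] := @std_ideal _ t x r k st; rewrite ?rx //; last by exists y.
    by apply: leq_trans cx; rewrite -ltnS.
  have [f fP] := fin_all_exists ex.
  rewrite -[X in (X <= _)%N](card_imset (f := f)); last first.
    by move=> k l e; apply: val_inj; rewrite /= -(fP k).2 -(fP l).2 e.
  apply/subset_leq_card/subsetP => _ /imsetP[k _ ->]; rewrite inE.
  by rewrite (fP k).1 (fP k).2 eqxx ltn_ord.
rewrite negb_exists => /forallP h; apply: leq_trans (geq_minl _ _) _.
apply/subset_leq_card/subsetP => x; rewrite !inE => /eqP e; rewrite e eqxx /=.
by have := h x; rewrite e eqxx /= -ltnNge => /leq_trans; apply.
Qed.

Lemma rowt_lt t x : (rowt t x < n)%N. Proof. exact: ltn_ord. Qed.

Lemma std_below t c : std t -> below (colt t) c = (\sum_(r < n) minn (cnt (rowt t) r) c)%N.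
Proof.
move=> st; rewrite (below_split _ _ (rowt_lt t)).
by apply: eq_bigr => r _; apply: std_rowpart.
Qed.

Lemma std_col_cnt t x : std t -> (rowt t x < cnt (colt t) (colt t x))%N.
Proof.
move=> st; rewrite -[X in (X <= _)%N]card_ord.
have ex (k : 'I_(rowt t x).+1) : exists y : 'I_n, rowt t y = k /\ colt t y = colt t x.
  have kx : (k <= rowt t x)%N by rewrite -ltnS.
  by have [y _ H] := std_ideal st kx (leqnn (colt t x)); exists y.
have [f fP] := fin_all_exists ex.
rewrite -[X in (X <= _)%N](card_imset (f := f)); last first.
  by move=> k l e; apply: val_inj; rewrite /= -(fP k).1 -(fP l).1 e.
apply/subset_leq_card/subsetP => _ /imsetP[k _ ->]; rewrite inE.
by rewrite (fP k).2.
Qed.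

Lemma im_cnt t u (f : 'I_n * 'I_n -> nat) r : injective t -> injective u ->
  t @: setT = u @: setT -> cnt (f \o t) r = cnt (f \o u) r.
Proof.
move=> it iu e.
have E v : injective v -> cnt (f \o v) r = #|[set c in v @: setT | f c == r]|.
  move=> iv; rewrite /cnt -(card_imset _ iv); apply: eq_card => c.
  apply/imsetP/idP => [[x + ->]|]; first by rewrite !inE => h; rewrite imset_f.
  by rewrite inE => /andP[/imsetP[x _ ->] h]; exists x; rewrite ?inE.
by rewrite !E // e.
Qed.

Lemma im_perm (T : finType) (f g : 'I_n -> T) : injective f -> injective g ->
  {subset [set f x | x in setT] <= [set g x | x in setT]} ->
  exists s : {perm 'I_n}, forall x, f x = g (s x).
Proof.
move=> fi gi sub.
have ex x : exists y, f x = g y.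
  by have /imsetP[y _ e] := sub (f x) (imset_f f (in_setT x)); exists y.
have [s sP] := fin_all_exists ex.
have si : injective s by move=> x y e; apply: fi; rewrite !sP e.
by exists (perm si) => x; rewrite permE.
Qed.

Lemma recolour phi psi : (forall r, cnt phi r = cnt psi r) ->
  exists s : {perm 'I_n}, forall x, phi x = psi (s x).
Proof.
move=> e; have pe : perm_eq [tuple phi x | x < n] [tuple psi x | x < n].
  apply/allP => r _; apply/eqP; rewrite /= !count_map.
  have E (f : 'I_n -> nat) : count (fun x => f x == r) (Finite.enum 'I_n) = cnt f r.
    by rewrite /cnt cardE /enum_mem size_filter; apply: eq_count => x; rewrite /= inE.
  exact: (etrans (E phi) (etrans (e r) (esym (E psi)))).
have /tuple_permP[s es] := pe.
exists s => x; have := congr1 (fun u => nth 0%N u x) es.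
rewrite -!tnth_nth !tnth_mktuple //.
Qed.

(** Equality in Gale-Ryser forces the cells (row of j in t, column of x j in u) to be exactly those
    of [t]. Two admissible [x] therefore differ by a permutation preserving rows on one side and
    columns on the other: they lie in a single double coset. *)
Lemma card_pair_inj_le t u : std t -> std u -> t @: setT = u @: setT ->
  (#|[set x | pair_inj (rowt t) (colt u) x]| <= #|stab (rowt t)| * #|stab (colt u)|)%N.
Proof.
move=> st su e; have [it _ _] := st; have [iu _ _] := su.
pose F (x : {perm 'I_n}) (j : 'I_n) := ((t j).1, (u (x j)).2).
have Fi x : pair_inj (rowt t) (colt u) x -> injective (F x).
  move=> /injectiveP inj j k [e1 e2]; apply: inj; rewrite !ffunE /rowt /colt e1.
  by rewrite e2.
have Fim x j : pair_inj (rowt t) (colt u) x -> F x j \in t @: setT.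
  move=> px; have /injectiveP inj := px.
  have inj' : injective (fun j => (rowt t j, (colt u \o x) j)).
    by move=> k l ekl; apply: inj; rewrite !ffunE.
  pose r := (t j).1; pose c := cnt (rowt t) r.
  have cntE r' : cnt (colt u) r' = cnt (colt t) r'.
    by apply: (@im_cnt u t (fun c => c.2 : nat)).
  (* With [c] the length of row [r], equality puts every point of that row into a column below
     [c]. *)
  have be : below (colt u \o x) c = (\sum_(r < n) minn (cnt (rowt t) r) c)%N.
    rewrite below_perm -std_below //; elim: (c) => [|k IH]; last by rewrite !belowS IH cntE.
    by rewrite /below; apply: eq_card => k; rewrite !inE.
  have := gale_ryser_eq (rowt_lt t) inj' be r; rewrite minnn => eq_r.
  have sub : [set k | (rowt t k == r) && ((colt u \o x) k < c)%N] = [set k | rowt t k == r].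
    apply/eqP; rewrite eqEcard; apply/andP; split; last by rewrite -/(rowpart _ _ _ _) eq_r.
    by apply/subsetP => k; rewrite !inE => /andP[].
  have : j \in [set k | rowt t k == r] by rewrite inE.
  rewrite -sub inE /= => /andP[_ lt_c].
  have [y /andP[/eqP ry cy]] : exists y, (rowt t y == r) && (colt u (x j) <= colt t y)%N.
    apply/existsP; apply: contraLR lt_c; rewrite negb_exists -leqNgt => /forallP h.
    have -> : c = rowpart (rowt t) (colt t) r (colt u (x j)).
      apply: eq_card => k; rewrite !inE; have := h k.
      by case: (_ == _) => //=; rewrite ltnNge => ->.
    by rewrite std_rowpart // geq_minr.
  have [||z _ [e1 e2]] := @std_ideal _ t y r (colt u (x j)) st; rewrite ?ry //.
  apply/imsetP; exists z => //; rewrite /F [RHS]surjective_pairing; congr (_, _).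
    by apply: val_inj; rewrite /= -[RHS]/(rowt t z) e1.
  by apply: val_inj; rewrite /= -[RHS]/(colt t z) e2.
have [->|[x0]] := set_0Vmem [set x | pair_inj (rowt t) (colt u) x]; first by rewrite cards0.
rewrite inE => px0.
have Fx0 : [set F x0 j | j in setT] = t @: setT.
  apply/eqP; rewrite eqEcard (card_imset _ (Fi _ px0)) (card_imset _ it) leqnn andbT.
  by apply/subsetP => _ /imsetP[j _ ->]; apply: Fim.
rewrite -cardsX; apply: leq_trans (leq_imset_card (fun hk => (hk.1 * x0 * hk.2)%g) _).
apply/subset_leq_card/subsetP => x; rewrite inE => px.
have [|s sP] := im_perm (Fi _ px) (Fi _ px0).
  by move=> _ /imsetP[j _ ->]; rewrite Fx0 Fim.
have s1 j : (t j).1 = (t (s j)).1 by case: (sP j).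
have s2 j : (u (x j)).2 = (u (x0 (s j))).2 by case: (sP j).
apply/imsetP; exists (s, ((s * x0)^-1 * x)%g); last by rewrite /= mulKVg.
rewrite in_setX /=; apply/andP; split; apply/stabP => z; first by rewrite /rowt -s1.
rewrite permM /colt s2; congr (val (u _).2).
by rewrite -!permM mulVg perm1.
Qed.
End ColourCounting.

(** * Partitions, diagrams and colourings *)

Section PartitionColours.

Lemma big_nth_minn (nu : seq nat) c :
  (\sum_(r < size nu) minn (nth 0 nu r) c = \sum_(p <- nu) minn p c)%N.
Proof. by rewrite (big_nth 0%N) big_mkord. Qed.

Lemma block_of_cons m mu x :
  block_of (m :: mu) x = if (x < m)%N then 0%N else (block_of mu (x - m)).+1.
Proof.
rewrite /block_of /= take0 /= addn0.
have -> : [seq sumn (take i.+1 (m :: mu)) | i <- iota 1 (size mu)] =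
          [seq (m + s)%N | s <- [seq sumn (take i.+1 mu) | i <- iota 0 (size mu)]].
  by rewrite -map_comp (iotaDl 1 0) -map_comp; apply: eq_map => i.
rewrite count_map; case: ltnP => h.
  rewrite add0n; apply/eqP; rewrite -leqn0 leqNgt -has_count.
  by apply/hasPn => s _ /=; rewrite -ltnNge (leq_trans h) ?leq_addr.
by rewrite add1n; congr _.+1; apply: eq_count => s /=; rewrite leq_subRL.
Qed.

Lemma block_of_lt mu x : (x < sumn mu)%N -> (block_of mu x < size mu)%N.
Proof.
elim: mu x => //= m mu IH x h; rewrite block_of_cons; case: (ltnP x m) => // mx.
by rewrite ltnS IH // ltn_subLR.
Qed.

Lemma count_block_of mu r :
  count (fun x => block_of mu x == r) (iota 0 (sumn mu)) = nth 0%N mu r.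
Proof.
elim: mu r => [r|m mu IH r]; first by rewrite nth_nil.
rewrite [sumn _]/= iotaD count_cat add0n.
have -> : count (fun x => block_of (m :: mu) x == r) (iota 0 m) = if r == 0%N then m else 0%N.
  rewrite (@eq_in_count _ _ (fun=> r == 0%N)) => [|x]; last first.
    by rewrite mem_iota add0n block_of_cons => /andP[_ ->]; rewrite eq_sym.
  by case: (r == 0%N); rewrite ?count_predT ?size_iota ?count_pred0.
have -> : count (fun x => block_of (m :: mu) x == r) (iota m (sumn mu)) =
    count (fun x => (block_of mu x).+1 == r) (iota 0 (sumn mu)).
  rewrite -[X in iota X _]addn0 iotaDl count_map; apply: eq_count => x /=.
  by rewrite block_of_cons ltnNge leq_addr /= addKn.
case: r => [|r] /=; last by rewrite add0n -IH; apply: eq_count.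
by rewrite (@eq_count _ _ pred0) ?count_pred0 ?addn0.
Qed.

Lemma cnt_block_of n mu r : sumn mu = n -> cnt (fun x : 'I_n => block_of mu x) r = nth 0%N mu r.
Proof.
move=> <-; rewrite -count_block_of /cnt cardE [in LHS]/enum_mem size_filter -enumT -val_enum_ord count_map.
by apply: eq_count => x; rewrite /= inE.
Qed.

Lemma sum_count_minn (nu : seq nat) c :
  (\sum_(k < c) count (fun p => k < p) nu = \sum_(p <- nu) minn p c)%N.
Proof.
elim: nu => [|p nu IH]; first by rewrite big_nil big1.
rewrite big_cons -IH /= big_split /=; congr (_ + _)%N.
elim: c {IH} => [|c IHc]; first by rewrite big_ord0 minn0.
by rewrite big_ord_recr /= IHc; case: ltnP; lia.
Qed.

Variables (n : nat) (nu : seq nat).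
Hypothesis nuP : is_partition n nu.

Lemma part_sorted : sorted geq nu. Proof. by have /and3P[] := nuP. Qed.
Lemma part_pos p : p \in nu -> (0 < p)%N. Proof. by have /and3P[_ /allP h _] := nuP; apply: h. Qed.
Lemma part_sum : sumn nu = n. Proof. by have /and3P[_ _ /eqP] := nuP. Qed.

Lemma part_noninc i j : (i <= j)%N -> (nth 0 nu j <= nth 0 nu i)%N.
Proof.
move=> ij; have [js|js] := ltnP j (size nu); last by rewrite [X in (X <= _)%N]nth_default.
have gtr : transitive geq by move=> y x z; rewrite /geq /= => h1 h2; apply: leq_trans h2 h1.
exact: (sorted_leq_nth gtr leqnn 0%N part_sorted _ _ (leq_ltn_trans ij js) js ij).
Qed.

Lemma part_size : (size nu <= n)%N.
Proof.
rewrite -part_sum sumnE -[X in (X <= _)%N]muln1 -sum1_size big_seq [X in (_ <= X)%N]big_seq.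
by rewrite muln1; apply: leq_sum => p /part_pos.
Qed.

Lemma part_le r : (nth 0 nu r <= n)%N.
Proof.
have [rs|rs] := ltnP r (size nu); last by rewrite nth_default.
rewrite -part_sum sumnE (big_nth 0%N) big_mkord.
by rewrite (bigD1 (Ordinal rs)) //= leq_addr.
Qed.

Lemma count_gt_nth r c : (r < count (fun p => c < p)%N nu)%N = (c < nth 0 nu r)%N.
Proof.
have -> : count (fun p => c < p)%N nu = #|[set a : 'I_(size nu) | (c < nth 0 nu a)%N]|.
  rewrite -[in LHS](mkseq_nth 0%N nu) /mkseq count_map -val_enum_ord count_map.
  by rewrite cardE [in RHS]/enum_mem size_filter -enumT; apply: eq_count => x; rewrite /= inE.
apply/idP/idP => [|h].
  apply: contraLR; rewrite -!leqNgt => h.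
  have [rs|rs] := leqP (size nu) r; first by rewrite (leq_trans (max_card _)) // card_ord.
  rewrite -[X in (_ <= X)%N](card_ord r) -[X in (_ <= X)%N](card_imset (f := widen_ord (ltnW rs))); last first.
    by move=> a b /(congr1 val) /= /val_inj.
  apply/subset_leq_card/subsetP => a; rewrite inE => ca; apply/imsetP.
  have ar : (a < r)%N.
    by rewrite ltnNge; apply: contraL ca => /part_noninc h'; rewrite -leqNgt (leq_trans h').
  by exists (Ordinal ar); rewrite //; apply: val_inj.
have rs : (r < size nu)%N.
  by rewrite ltnNge; apply: contraL h => rs; rewrite nth_default.
rewrite -[X in (X <= _)%N](card_ord r.+1) -[X in (X <= _)%N](card_imset (f := widen_ord rs)); last first.
  by move=> a b /(congr1 val) /= /val_inj.
apply/subset_leq_card/subsetP => _ /imsetP[a _ ->]; rewrite inE /=.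
by apply: leq_trans h _; apply: part_noninc; rewrite -ltnS.
Qed.

Lemma nth_conj c : nth 0%N (conj_part nu) c = count (fun p => c < p)%N nu.
Proof.
have [h|h] := ltnP c (head 0%N nu).
  by rewrite /conj_part (nth_map 0%N) ?size_iota // nth_iota.
rewrite nth_default ?size_map ?size_iota //; apply/esym/eqP.
by rewrite -leqn0 leqNgt count_gt_nth nth0 -leqNgt.
Qed.

Lemma sumn_conj : sumn (conj_part nu) = n.
Proof.
rewrite sumnE /conj_part big_map.
have -> : iota 0 (head 0%N nu) = index_iota 0 (head 0%N nu) by rewrite /index_iota subn0.
rewrite big_mkord sum_count_minn.
rewrite -big_nth_minn -part_sum sumnE [RHS](big_nth 0%N) big_mkord; apply: eq_bigr => r _.
by apply/minn_idPl; rewrite -nth0 part_noninc.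
Qed.

Definition rowcol (x : 'I_n) : nat := block_of nu x.
Definition colcol (x : 'I_n) : nat := block_of (conj_part nu) x.

Lemma cnt_rowcol r : cnt rowcol r = nth 0%N nu r.
Proof. exact: cnt_block_of part_sum. Qed.

Lemma cnt_colcol c : cnt colcol c = count (fun p => c < p)%N nu.
Proof. by rewrite -nth_conj; apply: cnt_block_of sumn_conj. Qed.

Lemma rowcol_lt x : (rowcol x < size nu)%N.
Proof. by apply: block_of_lt; rewrite part_sum. Qed.

Lemma below_cnt (psi : 'I_n -> nat) c : below psi c = (\sum_(k < c) cnt psi k)%N.
Proof.
elim: c => [|c IH]; last by rewrite belowS big_ord_recr IH.
by rewrite big_ord0 /below; apply: eq_card0 => x; rewrite inE.
Qed.

Lemma below_colcol c : below colcol c = (\sum_(p <- nu) minn p c)%N.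
Proof.
by rewrite below_cnt -sum_count_minn; apply: eq_bigr => k _; rewrite cnt_colcol.
Qed.

Definition diagram : {set 'I_n * 'I_n} := [set c | is_cell nu (nat_of_ord c.1, nat_of_ord c.2)].

Lemma diagram_sum (P : nat -> nat -> bool) :
  #|[set c in diagram | P c.1 c.2]| =
    (\sum_(a < n) \sum_(b < n) ((b < nth 0 nu a) && P a b))%N.
Proof.
rewrite pair_big /= -sum1_card big_mkcond /=; apply: eq_bigr => -[a b] _.
by rewrite !inE /is_cell /=; case: (_ && _).
Qed.

Lemma sum_lt_ord m k : (\sum_(b < m) (b < k) = minn k m)%N.
Proof.
elim: m => [|m IH]; first by rewrite big_ord0 minn0.
by rewrite big_ord_recr /= IH; case: ltnP; lia.
Qed.

Lemma card_diagram : #|diagram| = n.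
Proof.
have -> : diagram = [set c in diagram | xpredT c] by apply/setP => c; rewrite !inE andbT.
rewrite (diagram_sum (fun _ _ => true)).
have -> : (\sum_(a < n) \sum_(b < n) ((b < nth 0 nu a) && true) = \sum_(a < n) nth 0 nu a)%N.
  apply: eq_bigr => a _; under eq_bigr do rewrite andbT.
  by rewrite sum_lt_ord; apply/minn_idPl/part_le.
rewrite -[RHS]part_sum sumnE [RHS](big_nth 0%N) big_mkord.
rewrite (big_ord_widen n (fun a => nth 0%N nu a) part_size) [LHS](bigID (fun a : 'I_n => (a < size nu)%N)) /=.
by rewrite [X in (_ + X)%N]big1 ?addn0 // => a; rewrite -leqNgt => h; rewrite nth_default.
Qed.

Lemma diagram_row r : #|[set c in diagram | c.1 == r :> nat]| = nth 0%N nu r.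
Proof.
rewrite (diagram_sum (fun a _ => a == r)).
have [rn|rn] := ltnP r n; last first.
  rewrite nth_default ?(leq_trans part_size) //; apply: big1 => a _; apply: big1 => b _.
  by rewrite ltn_eqF ?andbF // (leq_trans _ rn).
rewrite (bigD1 (Ordinal rn)) //= eqxx [X in (_ + X)%N]big1 => [|a]; last first.
  by rewrite -val_eqE /= => /negbTE ->; apply: big1 => b _; rewrite andbF.
by under eq_bigr do rewrite andbT; rewrite sum_lt_ord addn0; apply/minn_idPl/part_le.
Qed.

Lemma diagram_col k : #|[set c in diagram | c.2 == k :> nat]| = count (fun p => k < p)%N nu.
Proof.
rewrite (diagram_sum (fun _ b => b == k)) exchange_big /=.
have [kn|kn] := ltnP k n; last first.
  rewrite big1 => [|b _]; last first.
    by apply: big1 => a _; rewrite ltn_eqF ?andbF // (leq_trans _ kn).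
  apply/esym/eqP; rewrite -leqn0 leqNgt count_gt_nth -leqNgt.
  exact: leq_trans (part_le 0) kn.
rewrite (bigD1 (Ordinal kn)) //= eqxx [X in (_ + X)%N]big1 => [|b]; last first.
  by rewrite -val_eqE /= => /negbTE ->; apply: big1 => a _; rewrite andbF.
rewrite addn0; under eq_bigr do rewrite andbT.
under eq_bigr => a _ do rewrite -count_gt_nth.
rewrite sum_lt_ord; apply/minn_idPl.
exact: leq_trans (count_size _ _) part_size.
Qed.

(** Number the cells of the diagram: row and column indices together are injective and have the same
    colour counts as [rowcol] and [colcol], so suitable permutations transform one pair of
    colourings into the other. *)
Lemma exists_pair_inj : exists x, pair_inj rowcol colcol x.
Proof.
pose e (x : 'I_n) := enum_val (cast_ord (esym card_diagram) x).
have ei : injective e by move=> x y /enum_val_inj /cast_ord_inj.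
have cntE (f : 'I_n * 'I_n -> nat) r : cnt (f \o e) r = #|[set c in diagram | f c == r]|.
  rewrite /cnt -(card_imset _ ei); apply: eq_card => c.
  apply/imsetP/idP => [[x + ->]|]; first by rewrite !inE /= => ->; have := enum_valP (cast_ord (esym card_diagram) x); rewrite inE => ->.
  rewrite inE => /andP[cD fc]; exists (cast_ord card_diagram (enum_rank_in cD c)).
    by rewrite inE /= /e cast_ordK enum_rankK_in.
  by rewrite /e cast_ordK enum_rankK_in.
have [s1 h1] : exists s : {perm 'I_n}, forall x, ((fun c : 'I_n * 'I_n => c.1 : nat) \o e) x = rowcol (s x).
  by apply: recolour => r; rewrite cntE diagram_row cnt_rowcol.
have [s2 h2] : exists s : {perm 'I_n}, forall x, ((fun c : 'I_n * 'I_n => c.2 : nat) \o e) x = colcol (s x).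
  by apply: recolour => r; rewrite cntE diagram_col cnt_colcol.
exists (s1^-1 * s2)%g; apply/injectiveP => j k; rewrite !ffunE !permM => -[e1 e2].
apply: (@perm_inj _ s1^-1%g); apply: ei.
rewrite [LHS]surjective_pairing [RHS]surjective_pairing; congr (_, _); apply: val_inj.
  by have /= -> := h1 (s1^-1 j)%g; have /= -> := h1 (s1^-1 k)%g; rewrite !permKV.
by have /= -> := h2 (s1^-1 j)%g; have /= -> := h2 (s1^-1 k)%g.
Qed.

Lemma syt_im t : t \in syt n nu -> t @: setT = diagram.
Proof.
rewrite inE => /and3P[/injectiveP ti /forallP tc _]; apply/eqP.
rewrite eqEcard card_diagram card_imset // cardsT card_ord leqnn andbT.
by apply/subsetP => _ /imsetP[x _ ->]; rewrite inE; apply: tc.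
Qed.

Lemma syt_stdP t : reflect (std t /\ forall x, t x \in diagram) (t \in syt n nu).
Proof.
apply: (iffP idP) => [ts|[st tD]].
  have im := syt_im ts; move: (ts); rewrite inE => /and3P[/injectiveP ti /forallP tc /forallP tl].
  have lt x y : (rowt t y = rowt t x /\ colt t y = (colt t x).+1) \/
      (rowt t y = (rowt t x).+1 /\ colt t y = colt t x) -> (x < y)%N.
    move=> H; have /forallP/(_ y)/implyP := tl x; apply; rewrite /cell_of /=.
    by case: H => -[]; rewrite /rowt /colt => -> ->; rewrite !eqxx ?orbT.
  have ex x r c : (r < n)%N -> (c < nth 0 nu r)%N -> (r <= rowt t x)%N -> exists y, rowt t y = r /\ colt t y = c.
    move=> rn cr _; have cn : (c < n)%N := leq_trans cr (part_le r).
    have : (Ordinal rn, Ordinal cn) \in t @: setT by rewrite im inE.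
    by move=> /imsetP[y _ e]; exists y; rewrite /rowt /colt -e.
  split; last by move=> x; rewrite -im imset_f.
  split=> // x pos.
    have [|y [e1 e2]] := ex x (rowt t x) (colt t x).-1 (rowt_lt t x) _ (leqnn _).
      by rewrite prednK //; apply: ltnW; apply: tc x.
    exists y; last by rewrite e1 e2 prednK.
    by apply: lt; left; rewrite e1 e2 prednK.
  have [|||y [e1 e2]] := ex x (rowt t x).-1 (colt t x).
  - by apply: leq_ltn_trans (rowt_lt t x); apply: leq_pred.
  - by apply: leq_trans (tc x) _; apply: part_noninc; apply: leq_pred.
  - exact: leq_pred.
  exists y; last by rewrite e1 e2 prednK.
  by apply: lt; right; rewrite e1 e2 prednK.
have [ti left up] := st; rewrite inE; apply/and3P; split; first exact/injectiveP.
  by apply/forallP => x; have := tD x; rewrite inE.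
apply/forallP => x; apply/forallP => y; apply/implyP.
rewrite /cell_of /= -!/(rowt t _) -!/(colt t _) => /orP[] /andP[/eqP e1 /eqP e2].
  have [|z zy [f1 f2]] := left y; first by rewrite e2.
  by have <- : z = x by apply/ti/cell_eq; [rewrite f1 e1 | apply/eqP; rewrite -eqSS f2 e2].
have [|z zy [f1 f2]] := up y; first by rewrite e1.
by have <- : z = x by apply/ti/cell_eq; [apply/eqP; rewrite -eqSS f1 e1 | rewrite f2 e2].
Qed.
End PartitionColours.

(** * Frobenius reciprocity and multiplicities in induced characters *)

Lemma frobenius_reciprocity n (H : {group {perm 'I_n}}) (phi chi : {perm 'I_n} -> algC) :
  (forall g x, chi (g ^ x)%g = chi g) ->
  dot_fun (Sn n) (ind_fun (Sn n) H phi) chi = #|H|%:R^-1 * \sum_(h in H) phi h * (chi h)^*.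
Proof.
move=> chiJ; rewrite /dot_fun /ind_fun.
under eq_bigr => g _ do rewrite -mulrA mulr_suml.
rewrite -mulr_sumr mulrCA; congr (_ * _); rewrite exchange_big /=.
rewrite (eq_bigr (fun _ => \sum_(h in H) phi h * (chi h)^*)) => [|x _].
  by rewrite sumr_const -[X in _ * X]mulr_natl mulKf // pnatr_eq0 -lt0n cardG_gt0.
rewrite (reindex_inj (conjg_inj x^-1%g)) /= [RHS]big_mkcond [LHS]big_mkcond /=.
apply: eq_bigr => h _; rewrite inE conjgKV chiJ.
by case: ifP => // _; rewrite mul0r.
Qed.

Lemma chi_irrJ n (i : Iirr (Sn n)) (g x : {perm 'I_n}) : 'chi_i (g ^ x)%g = 'chi_i g.
Proof. by rewrite cfunJ ?inE. Qed.

Lemma colmultV n (i : Iirr (Sn n)) b phi :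
  colmult i b phi = #|stab phi|%:R^-1 * \sum_(h in stab phi) lin b h * ('chi_i h)^*.
Proof.
congr (_ * _); rewrite (reindex_inj invg_inj) /=; apply: eq_big => [k|k _]; first exact: groupV.
by rewrite linV irr_inv.
Qed.

Lemma young_stab n mu : young n mu = stab (fun x : 'I_n => block_of mu x) :> {set _}.
Proof. exact: (genGid (stab_group (fun x : 'I_n => block_of mu x))). Qed.

Lemma dot_young n mu (i : Iirr (Sn n)) :
  dot_fun (Sn n) (ind_fun (Sn n) (young n mu) (fun _ => 1)) 'chi_i =
    colmult i false (fun x : 'I_n => block_of mu x).
Proof.
rewrite frobenius_reciprocity; last exact: chi_irrJ.
by rewrite colmultV -young_stab; congr (_ * _); apply: eq_bigr => h _; rewrite /lin expr0.
Qed.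

Lemma dot_young_sign n mu (i : Iirr (Sn n)) :
  dot_fun (Sn n) (ind_fun (Sn n) (young n mu) (@sign_fun n)) 'chi_i =
    colmult i true (fun x : 'I_n => block_of mu x).
Proof.
rewrite frobenius_reciprocity; last exact: chi_irrJ.
by rewrite colmultV -young_stab.
Qed.

Lemma colmult_pair_inj n (i : Iirr (Sn n)) phi psi :
  colmult i false phi != 0 -> colmult i true psi != 0 -> exists x, pair_inj phi psi x.
Proof.
move=> m1 m2; apply/existsP; rewrite -[[exists x, _]]negbK negb_exists; apply/negP => /forallP h.
have /eqP := mackey phi psi.
have -> : [set x | pair_inj phi psi x] = set0 by apply/setP => x; rewrite !inE (negbTE (h x)).
rewrite cards0 mul0r psumr_eq0 => [/allP/(_ i (mem_index_enum _))|j _].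
  by rewrite mulf_eq0 (negbTE m1) (negbTE m2).
by have [a ->] := colmult_nat j false phi; have [b ->] := colmult_nat j true psi; rewrite mulr_ge0.
Qed.

(** The product is one term of the nonnegative Mackey sum, which a single double coset bounds by
    1. *)
Lemma colmult_le1 n (i : Iirr (Sn n)) t u : std t -> std u -> t @: setT = u @: setT ->
  colmult i false (rowt t) * colmult i true (colt u) <= 1.
Proof.
move=> st su e; have nn j : 0 <= colmult j false (rowt t) * colmult j true (colt u).
  by have [a ->] := colmult_nat j false (rowt t); have [b ->] := colmult_nat j true (colt u); rewrite mulr_ge0.
apply: le_trans (_ : \sum_j colmult j false (rowt t) * colmult j true (colt u) <= 1).
  by rewrite (bigD1 i) //= lerDl sumr_ge0.
rewrite mackey ler_pdivrMr ?mul1r -?natrM ?ler_nat ?card_pair_inj_le //.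
by rewrite ltr0n muln_gt0 !cardG_gt0.
Qed.

(** * The Young basis of the character indexed by a partition *)

Section Specht.
Variables (n : nat) (nu : seq nat).
Implicit Types (t u : {ffun 'I_n -> 'I_n * 'I_n}).
Hypothesis nuP : is_partition n nu.

(** If the choice in [irr_index] failed, every term of the Mackey sum would vanish, against
    [exists_pair_inj]. *)
Lemma irr_index_ex : exists2 i : Iirr (Sn n), irr_index n nu = Some i &
  colmult i false (@rowcol n nu) != 0 /\ colmult i true (@colcol n nu) != 0.
Proof.
rewrite /irr_index; case: pickP => [i|none].
  by rewrite dot_young dot_young_sign => /andP[h1 h2]; exists i.
have [x px] := exists_pair_inj nuP.
have := mackey (@rowcol n nu) (@colcol n nu); rewrite big1 => [/esym/eqP|i _].
  rewrite mulf_eq0 invr_eq0 mulf_eq0 !(negbTE (card_stab_neq0 _)) !orbF pnatr_eq0 cards_eq0.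
  by move=> /eqP/setP/(_ x); rewrite !inE px.
by have := none i; rewrite dot_young dot_young_sign => /negbT; rewrite negb_and !negbK
  => /orP[] /eqP h; rewrite h ?mul0r ?mulr0.
Qed.

Variables (i : Iirr (Sn n)) (d : nat) (rho : {perm 'I_n} -> 'M[algC]_d).
Hypothesis Urho : unitary_irrep rho.
Hypothesis rho_tr : forall g, \tr (rho g) = 'chi_i g.
Hypothesis mrow : colmult i false (@rowcol n nu) != 0.
Hypothesis mcol : colmult i true (@colcol n nu) != 0.

Lemma below_im t u c : std t -> std u -> t @: setT = u @: setT -> below (colt t) c = below (colt u) c.
Proof.
case=> ti _ _ [ui _ _] e; rewrite !below_cnt; apply: eq_bigr => k _.
exact: (@im_cnt _ t u (fun c => c.2 : nat)).
Qed.

(** Sorting by rows makes the eigenspace invariant under the row stabiliser, sorting by columns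
    makes the column stabiliser act by the sign, and neither changes the rank; so the rank is a
    lower bound for both multiplicities. *)
Lemma colmult_sorted t : std t -> tspace rho t != 0 -> exists t1 t2,
  [/\ std t1 /\ std t2, t1 @: setT = t @: setT, t2 @: setT = t @: setT,
    exists2 m1 : nat, colmult i false (rowt t1) = m1%:R & (\rank (tspace rho t) <= m1)%N &
    exists2 m2 : nat, colmult i true (colt t2) = m2%:R & (\rank (tspace rho t) <= m2)%N].
Proof.
move=> st t0.
have [t1 [s1 i1 r1 o1]] := sort_rows Urho st; have [t2 [s2 i2 r2 o2]] := sort_cols Urho st.
exists t1, t2; split=> //.
  exists (\rank (colproj rho false (rowt t1))); first exact: colmultE.
  by rewrite -r1; apply: rank_tspace_le; apply: sorted_rows_act.
exists (\rank (colproj rho true (colt t2))); first exact: colmultE.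
by rewrite -r2; apply: rank_tspace_le; apply: sorted_cols_act.
Qed.

(* Gale-Ryser for the rows of nu against the columns of t, and for the rows of t against the columns
   of nu, bounds the column counts of t from both sides. *)
Lemma tspace_shape t : std t -> tspace rho t != 0 -> t \in syt n nu.
Proof.
move=> st t0; have rk : (0 < \rank (tspace rho t))%N by rewrite lt0n mxrank_eq0.
have [t1 [t2 [[s1 s2] i1 i2 [m1 e1 l1] [m2 e2 l2]]]] := colmult_sorted st t0.
have n1 : colmult i false (rowt t1) != 0 by rewrite e1 pnatr_eq0 -lt0n (leq_trans rk).
have n2 : colmult i true (colt t2) != 0 by rewrite e2 pnatr_eq0 -lt0n (leq_trans rk).
have belowE c : below (colt t) c = (\sum_(p <- nu) minn p c)%N.
  apply/eqP; rewrite eqn_leq; apply/andP; split.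
    have [x /injectiveP inj] := colmult_pair_inj mrow n2.
    rewrite (below_im _ st s2) // -(below_perm _ x) -big_nth_minn.
    under eq_bigr => r _ do rewrite -(cnt_rowcol nuP).
    apply: gale_ryser; first exact: rowcol_lt.
    by move=> j k e; apply: inj; rewrite !ffunE.
  have [x /injectiveP inj] := colmult_pair_inj n1 mcol.
  rewrite (below_im _ st s1) // std_below // -(below_colcol nuP) -(below_perm _ x).
  apply: gale_ryser; first exact: rowt_lt.
  by move=> j k e; apply: inj; rewrite !ffunE.
apply/(syt_stdP nuP); split=> // x; rewrite inE -/(is_cell _ _) /is_cell /= -(count_gt_nth nuP).
have := std_col_cnt x st; have := belowS (colt t) (colt t x); rewrite !belowE -!sum_count_minn.
by rewrite big_ord_recr /= => /addnI <-.
Qed.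

(** A nonzero rank bounds two multiplicities from below whose product is at most 1. *)
Lemma tspace_rank_le1 t : std t -> (\rank (tspace rho t) <= 1)%N.
Proof.
move=> st; have [->|t0] := eqVneq (tspace rho t) 0; first by rewrite mxrank0.
have rk : (0 < \rank (tspace rho t))%N by rewrite lt0n mxrank_eq0.
have [t1 [t2 [[s1 s2] i1 i2 [m1 e1 l1] [m2 e2 l2]]]] := colmult_sorted st t0.
have := colmult_le1 i s1 s2 (etrans i1 (esym i2)); rewrite e1 e2 -natrM (ler_nat _ _ 1) => le1.
apply: leq_trans le1; apply: leq_trans l1 _; apply: leq_pmulr; exact: leq_trans rk l2.
Qed.

Lemma dim_gt0 : (0 < d)%N.
Proof.
have : 'chi_i 1%g != 0 by apply: irr1_neq0.
by rewrite -rho_tr rho1 // mxtrace1 pnatr_eq0 lt0n.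
Qed.

(** Some tableau has a nonzero eigenspace, and it has shape [nu]; both tableaux sort to the same row
    reading tableau, and sorting preserves the rank. *)
Lemma tspace_rank1 t : t \in syt n nu -> \rank (tspace rho t) = 1%N.
Proof.
move=> ts; have [st tD] := elimT (syt_stdP nuP _) ts.
have [t0 st0 nz0] := exists_jeig Urho dim_gt0.
have ts0 := tspace_shape st0 nz0.
have [u [su iu ru ou]] := sort_rows Urho st; have [u0 [su0 iu0 ru0 ou0]] := sort_rows Urho st0.
have eu : u = u0 by apply: (sorted_tableau_uniq ou ou0); rewrite iu iu0 !(syt_im nuP).
apply/eqP; rewrite eqn_leq tspace_rank_le1 //= -ru eu ru0 lt0n mxrank_eq0 //.
Qed.

(** By induction on the entry: if the two cells on the common diagonal differed, the inner one would
    already be occupied, in the other tableau, by a smaller entry on which the tableaux agree. *)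
Lemma content_inj t u : std t -> std u -> (forall x, content t x = content u x) -> t = u.
Proof.
move=> st su e; apply/ffunP => x.
have [m] := ubnP (x : nat); elim: m x => // m IH x; rewrite ltnS => xm.
have [it _ _] := st; have [iu _ _] := su.
have ex := e x; rewrite /content in ex.
have [rle|rlt] := leqP (rowt t x) (rowt u x).
  have cle : (colt t x <= colt u x)%N by lia.
  have [y yx [e1 e2]] := std_ideal su rle cle.
  move: yx; rewrite leq_eqVlt => /orP[/eqP/val_inj yx|yx].
    by subst y; apply: cell_eq.
  have : t y = t x by rewrite IH ?(leq_trans yx) //; apply: cell_eq.
  by move=> /it eyx; rewrite eyx ltnn in yx.
have cle : (colt u x <= colt t x)%N by lia.
have [y yx [e1 e2]] := std_ideal st (ltnW rlt) cle.
move: yx; rewrite leq_eqVlt => /orP[/eqP/val_inj yx|yx].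
  by subst y; apply: cell_eq.
have : u y = u x by rewrite -IH ?(leq_trans yx) //; apply: cell_eq.
by move=> /iu eyx; rewrite eyx ltnn in yx.
Qed.

Definition ybasis : 'M[algC]_(#|syt n nu|, d) :=
  \matrix_(a < #|syt n nu|) nz_row (tspace rho (enum_val a)).

Lemma ybasis_row a : row a ybasis = nz_row (tspace rho (enum_val a)).
Proof. exact: rowK. Qed.

Lemma ybasis_sub a : (row a ybasis <= tspace rho (enum_val a))%MS.
Proof. by rewrite ybasis_row nz_row_sub. Qed.

Lemma ybasis_neq0 a : row a ybasis != 0.
Proof. by rewrite ybasis_row nz_row_eq0 -mxrank_eq0 tspace_rank1 // enum_valP. Qed.

Lemma tspace_sub_ybasis t : t \in syt n nu -> (tspace rho t <= ybasis)%MS.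
Proof.
move=> ts; have <- : enum_val (enum_rank_in ts t) = t by apply: enum_rankK_in.
set a := enum_rank_in _ _; apply: submx_trans (row_sub a _).
have [_ <-] := mxrank_leqif_sup (ybasis_sub a).
by rewrite rank_rV ybasis_neq0 tspace_rank1 // enum_valP.
Qed.

Lemma ybasis_orth a b : a != b -> row a ybasis *m (row b ybasis)^t* = 0.
Proof.
move=> nab; have [sa _] := elimT (syt_stdP nuP _) (enum_valP a).
have [sb _] := elimT (syt_stdP nuP _) (enum_valP b).
have /existsP[j nj] : [exists j, content (enum_val a) j != content (enum_val b) j].
  rewrite -[X in is_true X]negbK negb_exists; apply: contra nab => /forallP h.
  by apply/eqP/enum_val_inj/content_inj => // x; apply/eqP; rewrite -[_ == _]negbK.
apply: (jeig_orth Urho (j := j) (ybasis_neq0 b) (tspace_jeig (ybasis_sub a)) (tspace_jeig (ybasis_sub b))).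
by rewrite !tseqE eqr_int.
Qed.

Lemma ybasis_free : row_free ybasis.
Proof.
have [N NE] : exists N, forall b, N b = ((row b ybasis *m (row b ybasis)^t*) 0 0)^-1 by eexists.
apply/row_freeP; exists (ybasis^t* *m diag_mx (\row_b N b)).
have G a b : (ybasis *m ybasis^t*) a b = (row a ybasis *m (row b ybasis)^t*) 0 0.
  by rewrite !mxE; apply: eq_bigr => j _; rewrite !mxE.
rewrite mulmxA; apply/matrixP => a b; rewrite mul_mx_diag [LHS]mxE G [X in _ * X]mxE NE [RHS]mxE.
have [->|nab] := eqVneq a b; last by rewrite ybasis_orth // mxE mul0r.
rewrite divff //; apply: contra (ybasis_neq0 b) => /eqP e; rewrite -row_normP.
by apply/eqP/matrixP => x y; rewrite !ord1 e mxE.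
Qed.

(** The row space is invariant under adjacent transpositions, so irreducibility applies: for
    neighbouring cells the transposition acts by a sign, and otherwise it produces a multiple of the
    same vector plus a vector in the eigenspace of the swapped tableau. *)
Lemma ybasis_full : (1%:M <= ybasis)%MS.
Proof.
have [t0 st0 nz0] := exists_jeig Urho dim_gt0.
have ts0 := tspace_shape st0 nz0.
apply: (rho_irr Urho).
  by apply: contra nz0 => /eqP e; have := tspace_sub_ybasis ts0; rewrite e => /submx0null ->.
suff gen h : h \in stab (fun _ : 'I_n => 0%N) -> stablemx ybasis (rho h).
  by move=> g; apply: gen; apply/stabP.
move: h; apply: adjacent_gen => //.
- by rewrite rho1 // stablemxC.
- by move=> g h hg hh; rewrite rhoM // stablemxM.
move=> j k kj _; apply/row_subP => a; rewrite row_mul.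
set t := enum_val a; have ts : t \in syt n nu := enum_valP a.
have [st tD] := elimT (syt_stdP nuP _) ts.
have vt : (row a ybasis <= tspace rho t)%MS := ybasis_sub a.
have v0 := ybasis_neq0 a; have jv := tspace_jeig vt.
have sign (b : bool) : content t k = content t j + (-1) ^+ b -> (row a ybasis *m rho (tperm j k) <= ybasis)%MS.
  move=> e; have -> : row a ybasis *m rho (tperm j k) = (-1) ^+ b *: row a ybasis.
    apply: (jeig_sign Urho kj v0 jv); first by rewrite sqrr_sign.
      by rewrite rmorph_sign.
    by rewrite !tseqE e rmorphD rmorph_sign.
  by rewrite scalemx_sub // row_sub.
have far : content t k != content t j + 1 -> content t k != content t j - 1 ->
    (row a ybasis *m rho (tperm j k) <= ybasis)%MS.
  move=> n1 n2; set v := row a _ in vt v0 jv *.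
  have jw := jeig_swap Urho kj v0 jv.
  rewrite -[v *m _](subrK ((tseq t k - tseq t j)^-1 *: v)) addmx_sub //; last first.
    by rewrite scalemx_sub // row_sub.
  have ts' : tswap t j k \in syt n nu.
    apply/(syt_stdP nuP); split; first exact: tswap_std.
    by move=> x; rewrite ffunE.
  apply: submx_trans (tspace_sub_ybasis ts').
  apply: (jeig_tspace jw) => l; rewrite /swapseq -kj.
  have cs : content (tswap t j k) l = content t (tperm j k l) by rewrite /content /rowt /colt !ffunE.
  rewrite cs; have [/val_inj ->|lj] := eqVneq (l : nat) j; first by rewrite tpermL tseqE.
  have [/val_inj ->|lk] := eqVneq (l : nat) k; first by rewrite tpermR tseqE.
  by rewrite tpermD ?tseqE // eq_sym.
have [[e1 e2]|[e1 e2]|[e1 e2]|[e1 e2]] := std_adjacent st kj.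
- by apply: (sign false); rewrite /content e2 e1 expr0 -addn1 PoszD addrAC.
- by apply: (sign true); rewrite /content e2 e1 expr1 -addn1 PoszD opprD addrA.
- by apply: far; rewrite /content; lia.
by apply: far; rewrite /content; lia.
Qed.

Lemma dim_num_syt : d = num_syt n nu.
Proof.
have := ybasis_full; rewrite sub1mx => /eqP <-; exact/eqP/ybasis_free.
Qed.

Lemma jm_eigenvalue j c : eigenvalue (jm rho j) c -> exists2 t, t \in syt n nu & c = (content t j)%:~R.
Proof.
move=> /eigenvalueP[v vj v0].
have /submxP[w ew] : (v <= ybasis)%MS := submx_trans (submx1 v) ybasis_full.
pose D := diag_mx (\row_a (content (enum_val a : {ffun 'I_n -> 'I_n * 'I_n}) j)%:~R : 'rV[algC]_#|syt n nu|).
have AD : ybasis *m jm rho j = D *m ybasis.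
  apply/row_matrixP => a; rewrite row_mul mul_diag_mx.
  have /tspaceP -> := ybasis_sub a.
  by apply/rowP => k; rewrite !mxE.
have /(row_free_inj ybasis_free) wD : w *m D *m ybasis = (c *: w) *m ybasis.
  by rewrite -mulmxA -AD mulmxA -ew vj ew -scalemxAl.
have w0 : w != 0 by apply: contraNneq v0 => w0; rewrite ew w0 mul0mx.
have /existsP[a wa] : [exists a, w 0 a != 0].
  rewrite -[X in is_true X]negbK negb_exists; apply: contra w0 => /forallP h.
  by apply/eqP/rowP => a; rewrite mxE; apply/eqP; rewrite -[_ == _]negbK.
exists (enum_val a); first exact: enum_valP.
move/rowP/(_ a): wD; rewrite mul_mx_diag !mxE mulrC => /(mulIf wa) ->.
by [].
Qed.

Lemma jm_eigenvalue_le (b : nat) j c : (head 0%N nu <= b)%N -> (size nu <= b)%N ->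
  eigenvalue (jm rho j) c -> `|c| <= b%:R.
Proof.
move=> hb sb /jm_eigenvalue[t /(syt_stdP nuP)[_ /(_ j)] + ->].
rewrite inE /is_cell /= -/(rowt t j) -/(colt t j) => cj.
have cb : (colt t j < b)%N.
  by apply: leq_trans cj _; apply: leq_trans hb; rewrite -nth0 (part_noninc nuP).
have rb : (rowt t j < b)%N.
  by apply: leq_trans sb; rewrite ltnNge; apply: contraL cj => h; rewrite nth_default.
rewrite -intr_norm -[b%:R]/((b%:Z)%:~R) ler_int /content; lia.
Qed.
End Specht.

(** * Character bounds *)

Section FrobeniusNorm.
Variable d : nat.
Implicit Types (W M U : 'M[algC]_d).

Definition fro W : algC := \tr (W *m W^t*).

Lemma froE W : fro W = \sum_i \sum_j `|W i j| ^+ 2.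
Proof. exact: trmulC. Qed.

Lemma fro1 : fro 1%:M = d%:R.
Proof. by rewrite /fro trmx1 map_mx1 mulmx1 mxtrace1. Qed.

Lemma froZ (a : algC) W : fro (a *: W) = `|a| ^+ 2 * fro W.
Proof.
rewrite !froE mulr_sumr; apply: eq_bigr => i _; rewrite mulr_sumr; apply: eq_bigr => j _.
by rewrite mxE normrM exprMn.
Qed.

Lemma fro_unitary U W : U^t* *m U = 1%:M -> fro (U *m W) = fro W.
Proof. by move=> uU; rewrite /fro adjmxM mulmxA mxtrace_mulC !mulmxA uU mul1mx. Qed.

Lemma fro_hermitian M W (be : algC) : M^t* = M -> 0 <= be ->
  (forall a, eigenvalue M a -> `|a| <= be) -> fro (M *m W) <= be ^+ 2 * fro W.
Proof.
move=> hM be0 ev.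
have nM : M \is normalmx by apply/normalmxP; rewrite hM.
have uP := spectral_unitarymx M; move/orthomx_spectralP: nM.
move: (spectralmx M) (spectral_diag M) uP => P D uP; rewrite invmx_unitary // => defM.
have PP : P *m P^t* = 1%:M by apply/unitarymxP.
have PP' : P^t* *m P = 1%:M by apply: mulmx1C.
have P'P : (P^t*)^t* *m P^t* = 1%:M by rewrite trmxCK.
have evD k : `|D 0 k| <= be.
  apply: ev; apply/eigenvalueP; exists (row k P).
    by rewrite defM -row_mul !mulmxA PP mul1mx row_mul row_diag_mx -scalemxAl -rowE.
  apply/eqP => e; have : (P *m P^t*) k k = 0.
    rewrite mxE big1 // => j _; have /rowP/(_ j) := e; rewrite !mxE => ->; by rewrite mul0r.
  by rewrite PP mxE eqxx => /eqP; rewrite oner_eq0.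
rewrite defM -!mulmxA fro_unitary // -(fro_unitary W PP').
rewrite !froE mulr_sumr; apply: ler_sum => k _; rewrite mulr_sumr; apply: ler_sum => j _.
rewrite mul_diag_mx mxE normrM exprMn ler_wpM2r ?exprn_ge0 //.
by rewrite lerXn2r ?nnegrE.
Qed.

Lemma tr_le_fro W (be : algC) : 0 < be -> fro W <= be ^+ 2 * d%:R -> `|\tr W| <= be * d%:R.
Proof.
move=> be0 le; apply: le_trans (ler_norm_sum _ _ _) _.
(* The inequality of arithmetic and geometric means, entry by entry, replaces Cauchy-Schwarz and its
   square roots. *)
apply: le_trans (_ : \sum_i (`|W i i| ^+ 2 / be + be) / 2 <= _).
  apply: ler_sum => i _; rewrite ler_pdivlMr // -(ler_pM2r be0) mulrDl divfK ?gt_eqF //.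
  rewrite -subr_ge0; suff -> : `|W i i| ^+ 2 + be * be - `|W i i| * 2 * be = (`|W i i| - be) ^+ 2.
    by rewrite -realEsqr rpredB ?ger0_real // ltW.
  by ring.
have diag : \sum_i `|W i i| ^+ 2 <= fro W.
  rewrite froE; apply: ler_sum => i _; rewrite (bigD1 i) //= lerDl sumr_ge0 // => j _.
  exact: exprn_ge0.
rewrite -mulr_suml big_split /= -mulr_suml sumr_const card_ord -mulr_natr.
have le1 : (\sum_i `|W i i| ^+ 2) / be <= be * d%:R.
  by rewrite ler_pdivrMr //; apply: le_trans (le_trans diag le) _; rewrite expr2 mulrAC.
by rewrite mul1r ler_pdivrMr ?ltr0n // -[be *+ d]mulr_natr [leRHS]mulr_natr mulr2n lerD2r.
Qed.
End FrobeniusNorm.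

(** * Removing moved points one at a time *)

Section StarBound.
Variables (n d b : nat) (rho : {perm 'I_n} -> 'M[algC]_d).
Hypothesis Urho : unitary_irrep rho.
Hypothesis jm_ev : forall j c, eigenvalue (jm rho j) c -> `|c| <= b%:R.

Lemma rho_unitary g : (rho g)^t* *m rho g = 1%:M.
Proof. by rewrite (rhoV Urho) rhoVl. Qed.

Lemma fro_rho g W : fro (rho g *m W) = fro W.
Proof. exact/fro_unitary/rho_unitary. Qed.

Lemma card_ord_lt m k : (k <= m)%N -> #|[set z : 'I_m | (z < k)%N]| = k.
Proof.
move=> km; rewrite cardsE -sum1_card.
transitivity (\sum_(z < m | (z < k)%N) 1)%N; first exact: eq_bigl.
by rewrite (big_ord_narrow km) /= sum1_card card_ord.
Qed.

(** Up to conjugation only the size of [Z] matters. The colours 0, 1 and 2 mark the set, the centre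
    and the remaining points, and [recolour] supplies the conjugating permutation. *)
Lemma star_jm (x : 'I_n) (Z : {set 'I_n}) : x \notin Z ->
  exists (j : 'I_n) (g : {perm 'I_n}), star rho x Z *m rho g = rho g *m jm rho j.
Proof.
move=> xZ; have qn : (#|Z| < n)%N.
  rewrite -[X in (_ < X)%N]card_ord; apply: proper_card; apply/properP; split; first exact/subsetP.
  by exists x.
pose j := Ordinal qn; exists j.
pose phi (z : 'I_n) := if z == x then 1%N else if z \in Z then 0%N else 2.
pose psi (z : 'I_n) := if z == j then 1%N else if (z < j)%N then 0%N else 2.
have c0 : cnt phi 0 = cnt psi 0.
  have -> : cnt phi 0 = #|Z|.
    apply: eq_card => z; rewrite inE /phi; have [->|_] := eqVneq z x; first by rewrite (negbTE xZ).
    by case: (z \in Z).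
  have -> : cnt psi 0 = #|[set z : 'I_n | (z < j)%N]|.
    apply: eq_card => z; rewrite !inE /psi; have [->|_] := eqVneq z j; first by rewrite ltnn.
    by case: (z < j)%N.
  by rewrite (card_ord_lt (ltnW qn)).
have c1 : cnt phi 1 = cnt psi 1.
  rewrite /cnt (_ : [set _ | _] = [set x]) ?cards1; last first.
    by apply/setP=> z; rewrite !inE /phi; case: (z == x) => //; case: (z \in Z).
  rewrite (_ : [set _ | _] = [set j]) ?cards1 //.
  by apply/setP=> z; rewrite !inE /psi; case: (z == j) => //; case: (z < j)%N.
have c2 : cnt phi 2 = cnt psi 2.
  have tot (f : 'I_n -> nat) : (forall z, (f z < 3)%N) -> (cnt f 0 + cnt f 1 + cnt f 2 = n)%N.
    move=> f3; have : below f 3 = n.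
      by rewrite /below (_ : [set _ | _] = setT) ?cardsT ?card_ord //; apply/setP => z; rewrite !inE f3.
    by rewrite below_cnt !big_ord_recr big_ord0 /=.
  have := tot phi; have := tot psi; rewrite c0 c1 => h1 h2.
  apply: (@addnI (cnt psi 0 + cnt psi 1)%N); rewrite h1 ?h2 // => z.
    by rewrite /phi; case: ifP => //; case: ifP.
  by rewrite /psi; case: ifP => //; case: ifP.
have [g gP] : exists g : {perm 'I_n}, forall z, phi z = psi (g z).
  apply: recolour => -[|[|[|r]]] //; rewrite /cnt (_ : [set _ | _] = set0) ?cards0; last first.
    by apply/setP => z; rewrite !inE /phi; case: ifP => //; case: ifP.
  rewrite (_ : [set _ | _] = set0) ?cards0 //.
  by apply/setP => z; rewrite !inE /psi; case: ifP => //; case: ifP.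
exists g; rewrite star_conj // /jm; congr (_ *m _).
have -> : g x = j.
  have := gP x; rewrite /phi eqxx /psi; by case: eqP => //; case: ifP.
congr (star _ _ _); apply/setP => z; rewrite inE; apply/imsetP/idP => [[y yZ ->]|zj].
  have := gP y; rewrite /phi yZ; case: eqP => [yx|_]; first by rewrite -yx yZ in xZ.
  by rewrite /psi; case: eqP => //; case: ifP.
exists (g^-1 z)%g; last by rewrite permKV.
have := gP (g^-1 z)%g; rewrite permKV /psi zj; case: eqP => [e|_]; first by rewrite e ltnn in zj.
by rewrite /phi; case: eqP => // _; case: ifP.
Qed.

Lemma fro_star (x : 'I_n) (Z : {set 'I_n}) (W : 'M[algC]_d) : x \notin Z -> fro (star rho x Z *m W) <= b%:R ^+ 2 * fro W.
Proof.
move=> /star_jm[j [g e]].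
have -> : star rho x Z *m W = rho g *m (jm rho j *m (rho g^-1%g *m W)).
  by rewrite !mulmxA -e -[_ *m rho g *m _]mulmxA rhoVr // mulmx1.
rewrite fro_rho -(fro_rho g^-1%g W); apply: fro_hermitian => //; first exact: jm_adj.
exact: jm_ev.
Qed.

(** A pair consists of a moved point and its set of fixed points. Disjointness of the sets lets the
    transpositions of the later pairs commute with the star inserted for an earlier one. *)
Definition peelable (q : nat) (g : {perm 'I_n}) (L : seq ('I_n * {set 'I_n})) : Prop :=
  [/\ uniq (map fst L), (forall p p' : 'I_n * {set 'I_n}, p \in L -> p' \in L -> g p.1 != p'.1),
      (forall p : 'I_n * {set 'I_n}, p \in L -> #|p.2| = q /\ forall z, z \in p.2 -> g z = z) &
      pairwise (fun p p' : 'I_n * {set 'I_n} => [disjoint p.2 & p'.2]) L].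

(* With w = g y and g2 = g (y w), conjugating g by (y z) turns it into g2 (w z), because g2 fixes
   both y and z. *)
Lemma peel q L : forall (g : {perm 'I_n}) (M : 'M[algC]_d), peelable q g L ->
  (forall p : 'I_n * {set 'I_n}, p \in L -> forall z, z \in p.2 ->
     rho (tperm p.1 z) *m M = M *m rho (tperm p.1 z)) ->
  exists g' M', q%:R ^+ size L * \tr (rho g *m M) = \tr (rho g' *m M') /\
     fro M' <= b%:R ^+ (2 * size L) * fro M.
Proof.
elim: L => [|[y Z] L IH] g M.
  by exists g, M; rewrite muln0 !expr0 !mul1r.
move=> [/= /andP[yL uL] gL fixL /andP[/allP disj disjL]] comM.
have inL p : p \in L -> p \in (y, Z) :: L by move=> h; rewrite inE h orbT.
have in0 : (y, Z) \in (y, Z) :: L by rewrite inE eqxx.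
have [qZ fixZ] := fixL _ in0; rewrite /= in qZ fixZ.
set w := g y; have wy : w != y by apply: (gL _ _ in0 in0).
have gw : g w != w by rewrite /w (inj_eq (@perm_inj _ g)).
have wZ : w \notin Z by apply: contra gw => /fixZ ->.
have yZ : y \notin Z by apply/negP => /fixZ e; rewrite /w e eqxx in wy.
pose g2 := (g * tperm y w)%g.
have gE : g = (g2 * tperm y w)%g by rewrite /g2 -mulgA tperm2 mulg1.
have g2y : g2 y = y by rewrite permM -/w tpermR.
have g2Z z : z \in Z -> g2 z = z.
  move=> zZ; rewrite permM fixZ // tpermD //; first by apply: contra yZ => /eqP ->.
  by apply: contra wZ => /eqP ->.
have pL p : p \in L -> (p.1 != y) && (p.1 != w).
  move=> h; apply/andP; split; last by rewrite eq_sym; apply: (gL _ _ in0 (inL _ h)).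
  by apply: contraNneq yL => <-; apply/mapP; exists p.
have step : q%:R * \tr (rho g *m M) = \tr (rho g2 *m (star rho w Z *m M)).
  rewrite -qZ mulr_natl -sumr_const /star mulmx_suml mulmx_sumr raddf_sum /=.
  apply: eq_bigr => z zZ; set s := tperm y z.
  have -> : rho (tperm w z) = rho s^-1%g *m rho (tperm y w) *m rho s.
    have nzw : z != w by apply: contraNneq wZ => <-.
    by rewrite -!(rhoM Urho) -mulgA -conjgE tpermJ tpermL tpermD // 1?eq_sym // tpermC.
  have comm_s : (s * g2 = g2 * s)%g.
    rewrite /s; apply/permP => v; rewrite [LHS]permM [RHS]permM.
    case: (tpermP y z v) => [->|->|/eqP vy /eqP vz]; first by rewrite g2y tpermL g2Z.
      by rewrite g2y (g2Z z zZ) tpermR.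
    rewrite tpermD // eq_sym.
      by apply: contra vy => /eqP e; rewrite -(inj_eq (@perm_inj _ g2)) e g2y.
    by apply: contra vz => /eqP e; rewrite -(inj_eq (@perm_inj _ g2)) e g2Z.
  have -> : rho g2 *m (rho s^-1%g *m rho (tperm y w) *m rho s *m M) =
      rho (g2 * s^-1)%g *m rho (tperm y w) *m M *m rho s.
    by rewrite (rhoM Urho g2 s^-1%g) -!mulmxA (comM _ in0 z zZ).
  rewrite [RHS]mxtrace_mulC !mulmxA -(rhoM Urho s) mulgA comm_s -mulgA mulgV mulg1.
  by rewrite -(rhoM Urho g2) -gE.
have [||g' [M' [e le]]] := IH g2 (star rho w Z *m M).
- split=> //.
  + move=> p p' hp hp'; have /andP[py pw] := pL _ hp; have /andP[py' pw'] := pL _ hp'.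
    rewrite permM; case: tpermP => [_|_|_ _]; first by rewrite eq_sym.
      by rewrite eq_sym.
    by apply: gL; apply: inL.
  + move=> p hp; have [qp fixp] := fixL _ (inL _ hp); split=> // z zp.
    have zfix := fixp z zp.
    rewrite permM zfix tpermD //; first by apply: contraNneq wy => e; rewrite /w e zfix.
    by apply: contraNneq gw => e; rewrite e zfix.
- move=> p hp z zp; have [qp fixp] := fixL _ (inL _ hp); have zfix := fixp z zp.
  have /andP[py pw] := pL _ hp.
  have zw : z != w by apply: contraNneq gw => <-; rewrite zfix.
  have zZ : z \notin Z.
    by have := disj _ hp; rewrite disjoint_sym => /pred0P/(_ z) /=; rewrite zp => /negbT.
  have pZ : p.1 \notin Z.
    by apply/negP => /fixZ e; have := gL _ _ (inL _ hp) (inL _ hp); rewrite e eqxx.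
  rewrite mulmxA -star_comm //; last first.
  + rewrite -[RHS]imset_id; apply: eq_in_imset => v vZ; rewrite tpermD //.
      by apply: contraNneq pZ => ->.
    by apply: contraNneq zZ => ->.
  + by rewrite tpermD.
  by rewrite -!mulmxA comM // inL.
exists g', M'; split.
  by rewrite exprSr -mulrA step e.
apply: le_trans le _; rewrite mulnS addnC exprD -mulrA ler_wpM2l ?exprn_ge0 ?fro_star //.
Qed.

Lemma choose_disjoint q (ys : seq 'I_n) : forall F : {set 'I_n}, (size ys * q <= #|F|)%N ->
  exists L : seq ('I_n * {set 'I_n}), [/\ map fst L = ys,
    (forall p : 'I_n * {set 'I_n}, p \in L -> #|p.2| = q /\ p.2 \subset F) &
    pairwise (fun p p' : 'I_n * {set 'I_n} => [disjoint p.2 & p'.2]) L].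
Proof.
elim: ys => [|y ys IH] F; first by exists [::].
rewrite /= mulSn => le.
have [Z ZF cZ] : exists2 Z : {set 'I_n}, Z \subset F & #|Z| = q.
  exists [set x in take q (enum F)].
    by apply/subsetP => x; rewrite inE => /mem_take; rewrite mem_enum.
  rewrite cardsE (card_uniqP _) ?take_uniq ?enum_uniq // size_take -cardE.
  by case: ltnP => // h; apply/eqP; rewrite eqn_leq h (leq_trans (leq_addr _ _) le).
have [|L [e subL dL]] := IH (F :\: Z).
  by rewrite cardsD (setIidPr ZF) cZ leq_subRL ?(leq_trans (leq_addr _ _) le).
exists ((y, Z) :: L); split=> /=; first by rewrite e.
  move=> p; rewrite inE => /predU1P[->|/subL[c s]] //; split=> //.
  by apply: subset_trans s _; apply: subsetDl.
rewrite dL andbT; apply/allP => p /subL[_ s] /=.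
rewrite disjoint_sym disjoints_subset; apply: subset_trans s _.
by rewrite setDE subsetIr.
Qed.

Definition supp (g : {perm 'I_n}) : {set 'I_n} := [set x | g x != x].

(** For [Y] of maximal size, every moved point lies in [Y], in its image or in its preimage under
    [g], whence the factor 3. *)
Lemma independent_moved (g : {perm 'I_n}) : exists Y : {set 'I_n},
  [/\ Y \subset supp g, forall y y', y \in Y -> y' \in Y -> g y != y' & (#|supp g| <= 3 * #|Y|)%N].
Proof.
pose P (Y : {set 'I_n}) := (Y \subset supp g) && [forall y in Y, forall y' in Y, g y != y'].
have P0 : P set0.
  by rewrite /P sub0set; apply/forall_inP => y; rewrite inE.
case: (arg_maxnP (fun Y : {set 'I_n} => #|Y|) P0) => Y /andP[sY indY] maxY.
have indY' y y' : y \in Y -> y' \in Y -> g y != y'.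
  by move=> hy hy'; have /forall_inP/(_ y hy)/forall_inP/(_ y' hy') := indY.
exists Y; split=> //.
have sub : supp g \subset Y :|: [set g y | y in Y] :|: [set (g^-1)%g y | y in Y].
  apply/subsetP => x; rewrite inE => gx; apply: contraT; rewrite !inE !negb_or => /andP[/andP[xY n1] n2].
  have : (#|x |: Y| <= #|Y|)%N; last by rewrite cardsU1 xY add1n ltnn.
  apply: maxY; apply/andP; split; first by rewrite subUset sub1set inE gx.
  apply/forall_inP => y; rewrite !inE => /orP[/eqP ->|hy]; apply/forall_inP => y'; rewrite !inE => /orP[/eqP ->|hy'] //.
  - by apply: contra n2 => /eqP e; apply/imsetP; exists y'; rewrite // -e permK.
  - by apply: contra n1 => /eqP e; apply/imsetP; exists y.
  - exact: indY'.
apply: leq_trans (subset_leq_card sub) _.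
apply: leq_trans (leq_card_setU _ _) _; rewrite mulSn mul2n -addnn addnA leq_add //; last exact: leq_imset_card.
by apply: leq_trans (leq_card_setU _ _) _; rewrite leq_add2l leq_imset_card.
Qed.

Hypothesis b0 : (0 < b)%N.

(** The summand 2 admits a third of the support rounded up, so p = 1 is available for every
    nontrivial [g]. *)
Theorem char_bound_small_support g p q : (3 * p <= #|supp g| + 2)%N -> (#|supp g| + p * q <= n)%N ->
  q%:R ^+ p * `|\tr (rho g)| <= b%:R ^+ p * d%:R.
Proof.
move=> p3 pq; have [Y [sY indY cY]] := independent_moved g.
pose ys := take p (enum Y).
have sz : size ys = p by rewrite size_takel // -cardE; lia.
have [|L [eL subL dL]] := @choose_disjoint q ys (~: supp g).
  by rewrite sz cardsCs setCK card_ord leq_subRL; lia.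
have Lp : size L = p by rewrite -sz -eL size_map.
have inY x : x \in L -> x.1 \in Y.
  move=> h; have : x.1 \in ys by rewrite -eL; apply/mapP; exists x.
  by move=> /mem_take; rewrite mem_enum.
have [||g' [M' [e le]]] := @peel q L g 1%:M.
- split=> //; first by rewrite eL take_uniq ?enum_uniq.
    by move=> x x' /inY h /inY h'; apply: indY.
  move=> x /subL[c s]; split=> // z zx; have := subsetP s z zx.
  by rewrite !inE negbK => /eqP.
- by move=> x _ z _; rewrite mulmx1 mul1mx.
rewrite Lp mulmx1 fro1 in e le.
rewrite -[X in X * _]ger0_norm ?exprn_ge0 // -normrM e.
apply: tr_le_fro; first by rewrite exprn_gt0 // ltr0n.
by rewrite fro_rho -exprM mulnC.
Qed.
End StarBound.

Lemma partition_porbits (T : finType) (s : {perm T}) : partition (porbits s) setT.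
Proof.
apply/and3P; split.
- apply/eqP/setP => x; rewrite in_setT; apply/bigcupP.
  by exists (porbit s x); rewrite ?porbit_id // imset_f.
- apply/trivIsetP => _ _ /imsetP[x _ ->] /imsetP[y _ ->]; apply: contraR => /pred0Pn[z /andP[zx zy]].
  have /eqP <- : porbit s z == porbit s x by rewrite eq_porbit_mem.
  by rewrite eq_porbit_mem.
by apply/imsetP => -[x _ e]; have := porbit_id s x; rewrite -e inE.
Qed.

(** * Recursion along the symmetric groups of initial segments *)

Section PermRecursion.
Variable n : nat.
Implicit Types (g h : {perm 'I_n}).

Definition fixge (k : nat) : {set {perm 'I_n}} :=
  [set h : {perm 'I_n} | [forall x : 'I_n, (k <= x)%N ==> (h x == x)]].

Lemma fixgeP k h : reflect (forall x : 'I_n, (k <= x)%N -> h x = x) (h \in fixge k).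
Proof.
rewrite inE; apply: (iffP forallP) => H x; last by apply/implyP => /H ->.
by move=> kx; have /implyP/(_ kx)/eqP := H x.
Qed.

Lemma fixge0 : fixge 0 = [set 1%g].
Proof.
apply/setP => h; rewrite in_set1; apply/fixgeP/eqP => [H|-> x _]; last by rewrite perm1.
by apply/permP => x; rewrite perm1 H.
Qed.

Lemma fixge_n : fixge n = setT.
Proof. by apply/setP => h; rewrite in_setT; apply/fixgeP => x; rewrite leqNgt ltn_ord. Qed.

(** The decomposition into the cosets of the transpositions (j k) with j < k and of the identity; it
    is the recursion behind products of shifted Jucys-Murphy elements. *)
Lemma sum_fixge (V : nmodType) (G : {perm 'I_n} -> V) (k : 'I_n) :
  \sum_(h in fixge k.+1) G h =
  \sum_(h in fixge k) (G h + \sum_(j : 'I_n | (j < k)%N) G (tperm j k * h)%g).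
Proof.
rewrite (partition_big (fun h => (h^-1)%g k) (fun j : 'I_n => (j <= k)%N)) /=; last first.
  move=> h /fixgeP H; rewrite leqNgt; apply/negP => kj.
  by have := H _ kj; rewrite permKV => e; rewrite -e ltnn in kj.
transitivity (\sum_(j : 'I_n | (j <= k)%N) \sum_(h in fixge k) G (tperm j k * h)%g).
  apply: eq_bigr => j jk; rewrite (reindex_inj (mulgI (tperm j k))) /=; apply: eq_bigl => h.
  apply/andP/fixgeP => [[/fixgeP H /eqP e] x kx|H].
    have hk : h k = k by have := permKV (tperm j k * h)%g k; rewrite e permM tpermL.
    move: kx; rewrite leq_eqVlt => /orP[/eqP/val_inj <- //|kx].
    have := H x kx; rewrite permM tpermD // -val_eqE /= ltn_eqF //.
    exact: leq_ltn_trans kx.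
  split; last by apply/eqP/(@perm_inj _ (tperm j k * h)%g); rewrite permKV permM tpermL H.
  apply/fixgeP => x kx; rewrite permM tpermD ?H ?(ltnW kx) // -val_eqE /= ltn_eqF //.
  exact: leq_ltn_trans kx.
rewrite exchange_big /=; apply: eq_bigr => h _.
rewrite (bigD1 k) //= tperm1 mul1g; congr (_ + _); apply: eq_bigl => j.
by rewrite ltn_neqAle andbC.
Qed.

Definition cyc h : nat := #|porbits h|.

Lemma cyc_tperm (j k : 'I_n) h : h \in fixge k -> (j < k)%N ->
  (cyc (tperm j k * h)).+1 = cyc h.
Proof.
move=> /fixgeP H jk; have := porbits_mul_tperm h j k; rewrite /= -/(cyc _) -/(cyc h).
have hk : h k = k by apply: H.
have njk : j != k by rewrite -val_eqE /= ltn_eqF.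
have -> : j \notin porbit h k.
  apply/porbitP => -[i e]; move: njk; rewrite e permX; have -> : iter i h k = k by elim: i {e} => //= i ->.
  by rewrite eqxx.
by rewrite njk /= addn2 addn1 => -[].
Qed.

Lemma cyc1 : cyc 1%g = n.
Proof.
have -> : cyc 1%g = #|[set [set x] | x : 'I_n]|.
  apply: eq_card => C; apply/imsetP/imsetP => [[x _ ->]|[x _ ->]]; exists x => //.
    apply/setP => y; rewrite inE; apply/porbitP/eqP => [[i]|->]; first by rewrite expg1n perm1.
    by exists 0%N; rewrite perm1.
  apply/setP => y; rewrite inE; apply/eqP/porbitP => [->|[i]]; last by rewrite expg1n perm1.
  by exists 0%N; rewrite perm1.
by rewrite card_imset ?card_ord //; apply: set1_inj.
Qed.

(** The rising factorial x (x + 1) ... (x + n - 1), which generates the cycle counts, at x = 2. *)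
Lemma sum_2cyc : (\sum_(h : {perm 'I_n}) 2 ^ cyc h = n.+1`!)%N.
Proof.
pose R k := (\sum_(h in fixge k) 2 ^ cyc h)%N.
have RS (k : 'I_n) : (2 * R k.+1 = k.+2 * R k)%N.
  rewrite /R [in LHS](sum_fixge (V := nat)) !big_distrr /=; apply: eq_bigr => h hk.
  rewrite mulnDr big_distrr /= (eq_bigr (fun _ => 2 ^ cyc h)%N) => [|j jk]; last first.
    by rewrite -(cyc_tperm hk jk) expnS.
  rewrite sum_nat_cond_const -mulnDl; congr (_ * _)%N; rewrite -[k.+2]/(2 + k)%N; congr (_ + _)%N.
  by rewrite -[RHS](card_ord_lt (ltnW (ltn_ord k))); apply: eq_card => j; rewrite !inE.
have Rk k : (k <= n)%N -> (2 ^ k * R k = 2 ^ n * k.+1`!)%N.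
  elim: k => [_|k IH kn].
    by rewrite /R fixge0 big_set1 cyc1 expn0 mul1n muln1.
  have e : (2 * R k.+1 = k.+2 * R k)%N := RS (Ordinal kn).
  have {}IH := IH (ltnW kn); move: (R k.+1) (R k) e IH => r1 r0 e IH.
  by rewrite expnSr -mulnA e mulnCA IH (factS k.+1) mulnCA.
have := Rk n (leqnn n); rewrite /R fixge_n => /eqP.
rewrite eqn_pmul2l ?expn_gt0 // => /eqP <-; by apply: eq_bigl => h; rewrite in_setT.
Qed.

(** There are N^(cyc h) such words. Words are counted in place of the power because the lower bound
    on the trace regroups the sum by words and their stabilisers. *)
Definition fixwords N h : {set {ffun 'I_n -> 'I_N}} :=
  [set w : {ffun 'I_n -> 'I_N} | [forall x, w (h x) == w x]].

Lemma fixwordsP N h (w : {ffun 'I_n -> 'I_N}) : reflect (forall x, w (h x) = w x) (w \in fixwords N h).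
Proof. by rewrite inE; apply: (iffP forallP) => H x; apply/eqP. Qed.

Lemma fixwords1 N : #|fixwords N 1%g| = (N ^ n)%N.
Proof.
have -> : fixwords N 1%g = setT.
  by apply/setP => w; rewrite in_setT; apply/fixwordsP => x; rewrite perm1.
by rewrite cardsT card_ffun !card_ord.
Qed.

Lemma fixwords_tperm N (j k : 'I_n) h : h \in fixge k -> (j < k)%N ->
  (N * #|fixwords N (tperm j k * h)%g| = #|fixwords N h|)%N.
Proof.
move=> /fixgeP H jk; have hk : h k = k by apply: H.
have njk : j != k by rewrite -val_eqE /= ltn_eqF.
pose upd (p : {ffun 'I_n -> 'I_N} * 'I_N) : {ffun 'I_n -> 'I_N} := [ffun x => if x == k then p.2 else p.1 x].
have fixE (w : {ffun 'I_n -> 'I_N}) : w \in fixwords N (tperm j k * h)%g -> w k = w j /\ forall x, w (h x) = w x.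
  move=> /fixwordsP F; have e : w k = w j by have := F j; rewrite permM tpermL hk.
  split=> // x; have := F (tperm j k x); rewrite permM tpermK => ->.
  by case: tpermP => [->|->|].
have hx x : x != k -> h x != k.
  by move=> nx; rewrite -hk (inj_eq (@perm_inj _ h)).
rewrite mulnC -[X in (_ * X)%N](card_ord N) -cardsT -cardsX -(card_in_imset (f := upd)).
  apply: eq_card => w; apply/imsetP/fixwordsP => [[[u c]] + -> x|Fw].
    rewrite inE => /andP[/fixE[e F] _]; rewrite !ffunE /=.
    by have [->|nx] := eqVneq x k; rewrite ?hk ?eqxx // (negbTE (hx x nx)) F.
  exists ([ffun x => if x == k then w j else w x], w k); last first.
    by apply/ffunP => x; rewrite !ffunE /=; case: eqVneq => // ->.
  rewrite in_setX in_setT andbT; apply/fixwordsP => x; rewrite permM !ffunE.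
  case: (tpermP j k x) => [->|->|/eqP xj /eqP xk].
  - by rewrite hk eqxx (negbTE njk).
  - by rewrite eqxx (negbTE (hx j njk)) Fw.
  by rewrite (negbTE (hx x xk)) (negbTE xk) Fw.
move=> [u c] [u' c'] /=; rewrite !in_setX !in_setT !andbT /= => /fixE[e _] /fixE[e' _] E.
have ecc : c = c' by have /ffunP/(_ k) := E; rewrite !ffunE /= eqxx.
have eu x : x != k -> u x = u' x by move=> nx; have /ffunP/(_ x) := E; rewrite !ffunE /= (negbTE nx).
congr (_, _) => //; apply/ffunP => x; have [->|nx] := eqVneq x k; last exact: eu.
by rewrite e e' eu.
Qed.

Lemma cyc_supp g : (2 * cyc g + #|supp g| <= 2 * n)%N.
Proof.
pose F := [set x : 'I_n | g x == x].
have cF : (#|F| + #|supp g| = n)%N.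
  rewrite -[RHS]card_ord -(cardC F); congr (_ + _)%N; apply: eq_card => x.
  by rewrite !inE.
have part := partition_porbits g.
have := card_partition part; rewrite cardsT card_ord => tot.
have fixC : (#|[set C in porbits g | #|C| == 1%N]| <= #|F|)%N.
  apply: leq_trans (leq_imset_card (fun x => [set x]) F).
  apply/subset_leq_card/subsetP => C; rewrite inE => /andP[/imsetP[x _ ->] /cards1P[y e]].
  have ex : x = y by have : x \in porbit g x := porbit_id g x; rewrite e inE => /eqP.
  subst y; apply/imsetP; exists x => //; rewrite inE -in_set1 -e.
  by apply/porbitP; exists 1%N; rewrite expg1.
have le : (2 * cyc g <= n + #|[set C in porbits g | #|C| == 1%N]|)%N.
  rewrite [X in (_ <= X + _)%N]tot /cyc -!sum1_card big_distrr /=.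
  rewrite [X in (_ <= _ + X)%N](eq_bigl (fun C => (C \in porbits g) && (#|C| == 1%N))) => [|C]; last by rewrite inE.
  rewrite big_mkcondr /= -big_split /=; apply: leq_sum => C CP.
  have : (0 < #|C|)%N by have /imsetP[x _ ->] := CP; rewrite card_gt0; apply/set0Pn; exists x; apply: porbit_id.
  by case: (#|C|) => [|[|k]].
lia.
Qed.
End PermRecursion.

(** * A lower bound for the degree *)

Section DimensionBound.
Variables (n : nat) (nu : seq nat) (b : nat).
Hypothesis nuP : is_partition n nu.
Variables (i : Iirr (Sn n)) (d : nat) (rho : {perm 'I_n} -> 'M[algC]_d).
Hypothesis Urho : unitary_irrep rho.
Hypothesis rho_tr : forall g, \tr (rho g) = 'chi_i g.
Hypothesis mrow : colmult i false (@rowcol n nu) != 0.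
Hypothesis jm_ev : forall j c, eigenvalue (jm rho j) c -> `|c| <= b%:R.
Hypothesis b0 : (0 < b)%N.
Hypothesis bnu : (size nu <= b)%N.

(* Up to a power of b, Q k is b^n times the product of the b + X_j for j < k. *)
Let Q k : 'M[algC]_d := \sum_(h in fixge n k) #|fixwords b h|%:R *: rho h.

Lemma Q_step (k : 'I_n) : b%:R *: Q k.+1 = (b%:R%:M + jm rho k) *m Q k.
Proof.
rewrite /Q sum_fixge scaler_sumr mulmxDl mul_scalar_mx scaler_sumr mulmx_sumr -big_split /=.
apply: eq_bigr => h hk; rewrite scalerDr; congr (_ + _).
rewrite scaler_sumr /jm /star mulmx_suml; apply: eq_big => [j|j jk]; first by rewrite inE.
by rewrite scalerA -natrM (fixwords_tperm _ hk jk) -scalemxAr -rhoM // tpermC.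
Qed.

Lemma Q_fro k : (k <= n)%N -> (b%:R ^+ 2) ^+ k * fro (Q k) <= ((2 * b)%N%:R ^+ 2) ^+ k * ((b ^ n)%N%:R ^+ 2 * d%:R).
Proof.
elim: k => [_|k IH kn].
  rewrite !expr0 !mul1r /Q fixge0 big_set1 fixwords1 rho1 // froZ fro1.
  by rewrite normr_nat.
have le1 : fro (b%:R *: Q (Ordinal kn).+1) <= (2 * b)%N%:R ^+ 2 * fro (Q k).
  rewrite Q_step; apply: fro_hermitian => //.
    by rewrite raddfD /= raddfD /= jm_adj // tr_scalar_mx map_scalar_mx /= conjC_nat.
  move=> a /eigenvalueP[v va v0].
  have ea : eigenvalue (jm rho (Ordinal kn)) (a - b%:R).
    by apply/eigenvalueP; exists v => //; rewrite scalerBl -va mulmxDr mul_mx_scalar addrAC subrr add0r.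
  rewrite -[a](subrK b%:R) mul2n -addnn natrD; apply: le_trans (ler_normD _ _) _.
  by rewrite normr_nat lerD2r; apply: jm_ev ea.
move: le1; rewrite froZ normr_nat /= => le1.
rewrite [X in X * fro _]exprSr -mulrA; apply: le_trans (ler_wpM2l _ le1) _; first by rewrite !exprn_ge0.
rewrite mulrCA [in X in _ <= X]exprS -[X in _ <= X]mulrA ler_wpM2l ?exprn_ge0 //.
exact: IH (ltnW kn).
Qed.

Lemma colmult_perm (phi : 'I_n -> nat) (x : {perm 'I_n}) : colmult i false (phi \o x) = colmult i false phi.
Proof.
have inS h : (h \in stab (phi \o x)) = (h ^ x \in stab phi)%g by rewrite conj_stab.
rewrite /colmult; congr (_^-1 * _).
  congr (_%:R); rewrite -[RHS](cardJg _ x^-1%g); apply: eq_card => h.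
  by rewrite mem_conjgV inS.
rewrite [RHS](reindex_inj (conjg_inj x)) /=; apply: eq_big => [h|h _]; first exact: inS.
by rewrite linJ cfunJ // inE.
Qed.

(** Exchanging the sums weights each word [w] by the order of its stabiliser times the multiplicity
    of the trivial character there. The rearrangements of the word [rowcol] have multiplicity at
    least 1, and each arises from at most as many permutations as its stabiliser has elements, so
    these words alone give n!. *)
Lemma sum_chi_fixwords_ge : n`!%:R <= \sum_(h : {perm 'I_n}) #|fixwords b h|%:R * 'chi_i h.
Proof.
have rlt x : (@rowcol n nu x < b)%N by apply: leq_trans (rowcol_lt nuP x) bnu.
pose w0 (x : {perm 'I_n}) : {ffun 'I_n -> 'I_b} := [ffun y => Ordinal (rlt (x y))].
pose m (w : {ffun 'I_n -> 'I_b}) := colmult i false (fun x => w x).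
have m_ge0 w : 0 <= m w by rewrite /m; have [a ->] := colmult_nat i false (fun x => w x).
have m_w0 x : 1 <= m (w0 x).
  have -> : m (w0 x) = colmult i false (@rowcol n nu).
    rewrite -(colmult_perm _ x) /m /colmult.
    have -> : stab (fun y => w0 x y) = stab (@rowcol n nu \o x).
      by apply/setP => h; apply/stabP/stabP => H y; have := H y; rewrite !ffunE /=.
    by [].
  by have [a e] := colmult_nat i false (@rowcol n nu); move: mrow; rewrite e pnatr_eq0 -lt0n ler1n.
have -> : \sum_(h : {perm 'I_n}) #|fixwords b h|%:R * 'chi_i h =
    \sum_(w : {ffun 'I_n -> 'I_b}) #|stab (fun x => w x)|%:R * m w.
  under [RHS]eq_bigr => w _ do rewrite /m /colmult mulrA mulfV ?card_stab_neq0 // mul1r big_mkcond.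
  rewrite exchange_big /=; apply: eq_bigr => h _.
  rewrite -sum1_card natr_sum mulr_suml big_mkcond /=; apply: eq_bigr => w _.
  have -> : (w \in fixwords b h) = (h \in stab (fun x => w x)).
    by apply/fixwordsP/stabP => H x; [rewrite H | apply: val_inj; apply: H].
  by rewrite /lin expr0 !mul1r.
have -> : n`!%:R = \sum_(x : {perm 'I_n}) 1 :> algC.
  by rewrite sumr_const -card_Sn; congr (_%:R); apply: eq_card => x; rewrite !inE.
apply: le_trans (_ : \sum_x m (w0 x) <= _); first by apply: ler_sum.
rewrite (partition_big w0 xpredT) //=; apply: ler_sum => w _.
rewrite (eq_bigr (fun _ => m w)) => [|x /eqP <- //].
rewrite sumr_const -[leLHS]mulr_natl ler_wpM2r // ler_nat.
have [x0 /eqP e0|none] := pickP [pred x | w0 x == w]; last first.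
  by rewrite (eq_card (B := pred0)) ?card0.
rewrite -(card_rcoset _ x0); apply/subset_leq_card/subsetP => x hx; have /eqP ex : w0 x == w := hx.
rewrite mem_rcoset; apply/stabP => y.
have -> : w y = w0 x y by rewrite ex.
have -> : w ((x * x0^-1)%g y) = w0 x0 ((x * x0^-1)%g y) by rewrite e0.
by rewrite !ffunE /= permM permKV.
Qed.
Lemma dim_lower_bound : n`!%:R <= (2 * b)%N%:R ^+ n * d%:R :> algC.
Proof.
have := sum_chi_fixwords_ge.
have -> : \sum_(h : {perm 'I_n}) #|fixwords b h|%:R * 'chi_i h = \tr (Q n).
  rewrite /Q raddf_sum /= fixge_n; apply: eq_big => [h|h _]; first by rewrite in_setT.
  by rewrite mxtraceZ rho_tr.
move=> lower.
have b2 : 0 < (2 * b)%N%:R :> algC by rewrite ltr0n muln_gt0.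
have le1 : fro (Q n) <= ((2 * b)%N%:R ^+ n) ^+ 2 * d%:R.
  have := Q_fro (leqnn n); rewrite natrX [b%:R ^+ n ^+ 2]exprAC [_ ^+ 2 ^+ n in X in _ <= X * _]exprAC mulrCA.
  by rewrite ler_pM2l // !exprn_gt0 // ltr0n.
apply: le_trans (tr_le_fro (exprn_gt0 n b2) le1); apply: le_trans (lower) _.
by apply: real_ler_norm; apply: ger0_real; apply: le_trans lower.
Qed.
End DimensionBound.

(** * Centralizers *)

Section CentralizerCounting.
Variables (n : nat) (s : {perm 'I_n}).
Implicit Types (g : {perm 'I_n}) (x y z : 'I_n).

Definition bases : {set 'I_n} := transversal (porbits s) setT.

Lemma card_bases : #|bases| = cyc s.
Proof. exact: card_transversal (transversalP (partition_porbits s)). Qed.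

Lemma bases_cover x : exists2 b, b \in bases & x \in porbit s b.
Proof.
have tr := transversalP (partition_porbits s); have /and3P[/eqP cov triv _] := partition_porbits s.
have CP : porbit s x \in porbits s by apply: imset_f.
exists (transversal_repr x bases (porbit s x)).
  exact: (repr_mem_transversal tr).
by rewrite porbit_sym; apply: (repr_mem_pblock tr).
Qed.

Lemma cent_pow g k x : g \in 'C[s]%g -> g ((s ^+ k)%g x) = (s ^+ k)%g (g x).
Proof.
move=> /cent1P cg; have c : commute g (s ^+ k)%g by apply/commuteX/commute_sym.
by rewrite -!permM c.
Qed.

Lemma cent_eq_bases g h : g \in 'C[s]%g -> h \in 'C[s]%g -> {in bases, g =1 h} -> g = h.
Proof.
move=> cg ch e; apply/permP => x; have [b bB /porbitP[k ->]] := bases_cover x.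
by rewrite !cent_pow // e.
Qed.

(** Distributing the product gives a sum over all maps from base points to points; the centralizer
    injects into these maps and the remaining terms are nonnegative. The case n = 0 is separate
    because the expansion needs a default point. *)
Lemma centralizer_weight (wt : 'I_n -> 'I_n -> algC) : (forall b z, 0 <= wt b z) ->
  \sum_(g in 'C[s]%g) \prod_(b in bases) wt b (g b) <= \prod_(b in bases) \sum_z wt b z.
Proof.
move=> wt0; have [n0|n0] := posnP n.
  have noI (x : 'I_n) : False by have := leq_ltn_trans (leq0n x) (ltn_ord x); rewrite [X in (_ < X)%N]n0.
  rewrite [leRHS]big1 => [|b _]; last by case: (noI b).
  rewrite (eq_bigr (fun _ => 1)) => [|g _]; last by rewrite big1 // => b; case: (noI b).
  rewrite sumr_const -[leRHS]/(1%:R) ler_nat; apply/card_le1_eqP => g h _ _.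
  by apply/permP => x; case: (noI x).
have x0 : 'I_n := Ordinal n0.
rewrite (big_distr_big x0) /=.
pose F g : {ffun 'I_n -> 'I_n} := [ffun b => if b \in bases then g b else x0].
have FE g b : b \in bases -> F g b = g b by move=> hb; rewrite ffunE hb.
have Finj : {in 'C[s]%g &, injective F}.
  move=> g h cg ch e; apply: cent_eq_bases => // b hb.
  by have /ffunP/(_ b) := e; rewrite !FE.
rewrite [leRHS](bigID (mem (F @: 'C[s]%g))) /= -[leLHS]addr0 lerD //; last first.
  by apply: sumr_ge0 => f _; apply: prodr_ge0.
have -> : \sum_(f in pffun_on x0 (mem bases) xpredT | f \in F @: 'C[s]%g) \prod_(b in bases) wt b (f b)
   = \sum_(f in F @: 'C[s]%g) \prod_(b in bases) wt b (f b).
  apply: eq_bigl => f; apply: andb_idl => /imsetP[g _ ->].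
  apply/pffun_onP; split; last by [].
  by apply/subsetP => b; rewrite inE ffunE; case: ifP; rewrite ?eqxx.
rewrite big_imset //=; apply: ler_sum => g _; rewrite le_eqVlt; apply/orP; left; apply/eqP.
by apply: eq_bigr => b hb; rewrite FE.
Qed.

Lemma card_cent_le : #|'C[s]%g|%:R <= n%:R ^+ cyc s :> algC.
Proof.
have h := @centralizer_weight (fun _ _ => 1) (fun _ _ => ler01).
have e1 : \sum_(g in 'C[s]%g) \prod_(b in bases) 1 = #|'C[s]%g|%:R :> algC.
  have e0 : \prod_(b in bases) 1 = 1 :> algC by apply: big1.
  by rewrite e0 sumr_const.
rewrite -e1; apply: le_trans h _.
by rewrite sumr_const card_ord prodr_const card_bases.
Qed.
End CentralizerCounting.

(** * The order of a centralizer *)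

Section CentralizerOrder.
Variables (n : nat) (s : {perm 'I_n}).
Implicit Types (g : {perm 'I_n}) (x y z : 'I_n) (P : {set {set 'I_n}}).

Lemma pow_porbit x : (s ^+ #|porbit s x|)%g x = x.
Proof. by rewrite permX iter_porbit. Qed.

(** Sends s^k a to s^k c for k below the length of the cycle of [a]; between cycles of equal length
    this commutes with [s]. *)
Definition transport a c z : 'I_n := (s ^+ index z (traject s a #|porbit s a|))%g c.

Lemma porbit_index a z : z \in porbit s a ->
  (index z (traject s a #|porbit s a|) < #|porbit s a|)%N /\
  (s ^+ index z (traject s a #|porbit s a|))%g a = z.
Proof.
rewrite porbit_traject => h; have lt : (index z (traject s a #|porbit s a|) < #|porbit s a|)%N.
  by rewrite -[X in (_ < X)%N](size_traject s a) index_mem.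
by split=> //; rewrite permX -(nth_traject s lt a) nth_index.
Qed.

Lemma index_pow a k : (k < #|porbit s a|)%N -> index ((s ^+ k)%g a) (traject s a #|porbit s a|) = k.
Proof.
move=> lt; rewrite permX -(nth_traject s lt a) index_uniq ?size_traject //.
exact: uniq_traject_porbit.
Qed.

Lemma index_self a : index a (traject s a #|porbit s a|) = 0%N.
Proof. by have := card_porbit_neq0 s a; case: #|_| => //= m _; rewrite eqxx. Qed.

Lemma transport_mem a c z : transport a c z \in porbit s c.
Proof. exact: mem_porbit. Qed.

Lemma transport_s a c z : #|porbit s a| = #|porbit s c| -> z \in porbit s a ->
  transport a c (s z) = s (transport a c z).
Proof.
move=> e /porbit_index[]; rewrite /transport; set k := index z _ => lt ez.
have -> : s z = (s ^+ k.+1)%g a by rewrite expgSr permM ez.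
rewrite -permM -expgSr; have := lt; rewrite leq_eqVlt => /orP[/eqP ek|lt'].
  by rewrite ek pow_porbit index_self expg0 perm1 e pow_porbit.
by rewrite index_pow.
Qed.

Lemma transportK a c z : #|porbit s a| = #|porbit s c| -> z \in porbit s a ->
  transport c a (transport a c z) = z.
Proof.
by move=> e /porbit_index[lt ez]; rewrite {1}/transport index_pow -?e //.
Qed.

Lemma porbit_s x y : (s x \in porbit s y) = (x \in porbit s y).
Proof.
by rewrite -!eq_porbit_mem -[s x]/((s ^+ 1)%g x) porbit_perm.
Qed.

(** Within one cycle a power of [s] restricted to that cycle does it; for two cycles, the involution
    exchanging them by [transport]. *)
Lemma cent_swap x y : #|porbit s x| = #|porbit s y| ->
  exists g, [/\ perm_on (porbit s x :|: porbit s y) g, g \in 'C[s]%g & g x = y].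
Proof.
move=> e; have [yx|nyx] := boolP (y \in porbit s x).
  have /porbitP[k ek] := yx.
  have sN (m : nat) : (s ^+ m)%g \in ('N(porbit s x | 'P))%g.
    by apply/astabsP => z; rewrite /= apermE -!eq_porbit_mem porbit_perm.
  exists (restr_perm (porbit s x) (s ^+ k)%g); split.
  - apply: subset_trans (restr_perm_on _ _) _; exact: subsetUl.
  - apply/cent1P/commute_sym; apply/permP => z; rewrite !permM.
    have [zx|zx] := boolP (z \in porbit s x).
      by rewrite !restr_permE ?sN ?porbit_s // -!permM -expgS -expgSr.
    by rewrite !(out_perm (restr_perm_on _ _)) ?porbit_s.
  by rewrite restr_permE ?sN ?porbit_id // -ek.
pose f z := if z \in porbit s x then transport x y z else
            if z \in porbit s y then transport y x z else z.
have disj z : z \in porbit s y -> z \notin porbit s x.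
  move=> zy; apply: contra nyx; rewrite -!eq_porbit_mem => /eqP <-.
  by rewrite eq_porbit_mem porbit_sym.
have fK : involutive f.
  move=> z; rewrite /f; have [zx|zx] := boolP (z \in porbit s x).
    by rewrite (negbTE (disj _ (transport_mem x y z))) transport_mem transportK.
  have [zy|zy] := boolP (z \in porbit s y); first by rewrite transport_mem transportK.
  by rewrite (negbTE zx) (negbTE zy).
exists (perm (inv_inj fK)); split.
- apply/subsetP => z; rewrite inE permE /f in_setU; apply: contraR.
  by rewrite negb_or => /andP[/negbTE -> /negbTE ->].
- apply/cent1P/commute_sym; apply/permP => z; rewrite !permM !permE /f !porbit_s.
  by do 2?case: ifP => // ?; rewrite transport_s.
by rewrite permE /f porbit_id /transport index_self expg0 perm1.
Qed.

Definition cent_on P : {group {perm 'I_n}} := ('C[s] :&: perm.Sym_group (cover P))%G.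

Lemma cent_onP P g : reflect (g \in 'C[s]%g /\ forall x, x \notin cover P -> g x = x) (g \in cent_on P).
Proof.
apply: (iffP setIP) => [[h1 h2]|[h1 h2]]; split=> //.
  by move: h2; rewrite inE => /out_perm; apply.
by rewrite inE; apply/subsetP => x; rewrite inE; apply: contraR => /h2 ->.
Qed.

Lemma porbit_cent g x : g \in 'C[s]%g -> porbit s (g x) = g @: porbit s x.
Proof.
move=> cg; apply/setP => z; apply/porbitP/imsetP => [[k ->]|[y /porbitP[k ->] ->]].
  by exists ((s ^+ k)%g x); rewrite ?mem_porbit // cent_pow.
by exists k; rewrite cent_pow.
Qed.

(** Orbit-stabiliser at a point [x] of a cycle [C]: the orbit is the union of the cycles in [P] of
    the same length, and an element fixing [x] fixes all of [C], so the stabiliser is the same group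
    for [P] without [C]. *)
Lemma card_cent_on P : P \subset porbits s ->
  #|cent_on P| = (\prod_(1 <= i < n.+1)
     (i ^ #|[set C in P | #|C| == i]| * #|[set C in P | #|C| == i]|`!))%N.
Proof.
have [m] := ubnP #|P|; elim: m P => // m IH P; rewrite ltnS => Pm PS.
have /and3P[_ triv _] := partition_porbits s.
have covP x : (x \in cover P) = (porbit s x \in P).
  apply/bigcupP/idP => [[C CP xC]|h]; last by exists (porbit s x); rewrite ?porbit_id.
  have /imsetP[y _ eC] := subsetP PS C CP; move: xC CP; rewrite eC -eq_porbit_mem => /eqP -> //.
have [P0|[C CP]] := set_0Vmem P.
  have -> : cent_on P = 1%G.
    apply/group_inj/setP => g; apply/cent_onP/set1gP => [[_ h]|->]; last by split; rewrite ?group1 // => x _; rewrite perm1.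
    by apply/permP => x; rewrite perm1 h // covP P0 inE.
  rewrite cards1 big1 // => i _; rewrite (_ : [set _ | _] = set0) ?cards0 //.
  by apply/setP => D; rewrite P0 !inE.
have /imsetP[x _ eC] := subsetP PS C CP.
pose P' := P :\ C; pose i0 := #|C|.
have xP : porbit s x \in P by rewrite -eC.
rewrite -(card_orbit_stab 'P%act (cent_on P) x).
have stabE : ('C_(cent_on P)[x | 'P])%g = cent_on P'.
  apply/setP => g; rewrite inE; apply/andP/cent_onP => [[/cent_onP[cg h] /astab1P gx]|[cg h]].
    split=> // z; rewrite /= apermE in gx.
    have [zP|zP _] := boolP (z \in cover P); last exact: h.
    have [zx _|zx] := boolP (z \in porbit s x).
      by have /porbitP[k ->] := zx; rewrite cent_pow // gx.
    case/negP; apply/bigcupP; exists (porbit s z); rewrite ?porbit_id // !inE -covP zP andbT eC.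
    by rewrite eq_porbit_mem.
  have sub z : z \notin cover P -> z \notin cover P'.
    by apply: contra => /bigcupP[D]; rewrite inE => /andP[_ DP] zD; apply/bigcupP; exists D.
  split; first by apply/cent_onP; split=> // z /sub /h.
  apply/astab1P; rewrite /= apermE; apply: h; apply/negP => /bigcupP[D].
  rewrite !inE => /andP[nD DP] xD; case/negP: nD.
  have /imsetP[y _ eD] := subsetP PS D DP; move: xD; rewrite eC eD -eq_porbit_mem => /eqP ->.
  by [].
have orbE : orbit 'P (cent_on P) x = \bigcup_(D in [set D in P | #|D| == i0]) D.
  apply/setP => y; apply/orbitP/bigcupP => [[g /cent_onP[cg h] <-]|[D]].
    exists (porbit s (g x)); rewrite ?porbit_id // inE; apply/andP; split.
      rewrite -covP; apply: contraT => ng; have e := perm_inj (h _ ng).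
      by rewrite e covP xP in ng.
    by rewrite porbit_cent // card_imset ?/i0 ?eC //; apply: perm_inj.
  rewrite inE => /andP[DP /eqP cD] yD.
  have /imsetP[w _ eD] := subsetP PS D DP.
  have eyD : porbit s y = D by move: yD; rewrite eD -eq_porbit_mem => /eqP.
  have [|g [og cg gx]] := @cent_swap x y; first by rewrite -eC eyD cD.
  exists g => //; apply/cent_onP; split=> // z zP; apply: (out_perm og).
  rewrite in_setU negb_or; apply/andP; split; apply: contra zP; rewrite covP -eq_porbit_mem => /eqP -> //.
  by rewrite eyD.
have cardO : #|orbit 'P%act (cent_on P) x| = (i0 * #|[set D in P | #|D| == i0]|)%N.
  have tr' : trivIset [set D in P | #|D| == i0].
    apply: trivIsetS triv; apply/subsetP => D; rewrite inE => /andP[DP _]; exact: (subsetP PS).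
  rewrite orbE -/(cover _); move/eqP: tr' => <-.
  rewrite (eq_bigr (fun _ => i0)) => [|D]; last by rewrite inE => /andP[_ /eqP].
  by rewrite sum_nat_const mulnC.
have lt' : (#|P'| < m)%N by apply: leq_trans Pm; rewrite (cardsD1 C P) CP.
have PS' : P' \subset porbits s by apply: subset_trans (subD1set _ _) PS.
rewrite stabE cardO (IH P') //.
have i0n : (1 <= i0 < n.+1)%N.
  rewrite /i0 eC lt0n card_porbit_neq0 ltnS -[X in (_ <= X)%N]card_ord; exact: max_card.
have mem_i0 : i0 \in index_iota 1 n.+1 by rewrite mem_index_iota.
rewrite [in LHS](bigD1_seq i0) ?iota_uniq //= [in RHS](bigD1_seq i0) ?iota_uniq //=.
have other i : i != i0 -> [set D in P' | #|D| == i] = [set D in P | #|D| == i].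
  move=> ni; apply/setP => D; rewrite !inE.
  by case: eqP => //= ->; rewrite -/i0 eq_sym (negbTE ni) andbF.
rewrite mulnA; congr (_ * _)%N; last by apply: eq_bigr => i ni; rewrite other.
have -> : #|[set D in P | #|D| == i0]| = #|[set D in P' | #|D| == i0]|.+1.
  rewrite (cardsD1 C) inE CP eqxx add1n; congr _.+1; apply: eq_card => D.
  by rewrite !inE andbA.
by rewrite mulnACA -expnS -factS.
Qed.

Lemma sumn_cycle_type : sumn (cycle_type s) = n.
Proof.
rewrite /cycle_type; have p := permEl (perm_sort geq [seq #|C| | C : {set 'I_n} <- enum (porbits s)]).
rewrite sumnE (perm_big _ p) /= big_map big_enum /=.
by have := card_partition (partition_porbits s); rewrite cardsT card_ord.
Qed.

Lemma count_cycle_type i : count_mem i (cycle_type s) = #|[set C in porbits s | #|C| == i]|.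
Proof.
rewrite /cycle_type; have p := permEl (perm_sort geq [seq #|C| | C : {set 'I_n} <- enum (porbits s)]).
rewrite (seq.permP p) count_map -sum1_card -sum1_count big_enum_cond /=.
by apply: eq_bigl => C; rewrite inE.
Qed.

Theorem card_centralizer : #|'C[s]%g| = zlambda (cycle_type s).
Proof.
rewrite /zlambda sumn_cycle_type; under eq_bigr => i _ do rewrite !count_cycle_type.
rewrite -card_cent_on //; apply: eq_card => g.
apply/idP/cent_onP => [cg|[]//]; split=> // x.
by have /and3P[/eqP -> _ _] := partition_porbits s; rewrite in_setT.
Qed.
End CentralizerOrder.

(** * Commuting pairs counted by support *)

Section CommutingPairs.
Variable n : nat.

Lemma card_setwise_stab (A : {set 'I_n}) :
  (#|[set s : {perm 'I_n} | s @: A == A]| <= #|A|`! * (n - #|A|)`!)%N.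
Proof.
have cA : #|~: A| = (n - #|A|)%N by rewrite cardsCs setCK card_ord.
rewrite -cA -(perm.card_Sym A) -(perm.card_Sym (~: A)) -cardsX.
pose F (s : {perm 'I_n}) := (restr_perm A s, restr_perm (~: A) s).
have N1 (s : {perm 'I_n}) : s @: A == A -> s \in ('N(A | 'P))%g.
  move=> /eqP e; apply/astabsP => z; rewrite /= apermE -{1}e mem_imset //; exact: perm_inj.
have N2 (s : {perm 'I_n}) : s @: A == A -> s \in ('N(~: A | 'P))%g.
  move=> /eqP e; apply/astabsP => z; rewrite /= apermE !in_setC -{1}e mem_imset //; exact: perm_inj.
rewrite -(card_in_imset (f := F)) => [|s u]; last first.
  rewrite !inE => hs hu [e1 e2]; apply/permP => x.
  have [xA|xA] := boolP (x \in A).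
    by rewrite -(restr_permE (N1 _ hs) xA) e1 restr_permE ?N1.
  have xA' : x \in ~: A by rewrite inE.
  by rewrite -(restr_permE (N2 _ hs) xA') e2 restr_permE ?N2.
apply/subset_leq_card/subsetP => _ /imsetP[s _ ->].
by rewrite in_setX !inE !restr_perm_on.
Qed.

(* An s commuting with g preserves the support A of g: there are 'C(n, t) choices of A, at most
   t! (n - t)! of s, and t! of g. *)
Lemma sum_commuting_supp t : (t <= n)%N ->
  (\sum_(s : {perm 'I_n}) #|[set g in 'C[s]%g | #|supp g| == t]| <= n`! * t`!)%N.
Proof.
move=> tn; pose T := [set A : {set 'I_n} | #|A| == t].
apply: leq_trans (_ : \sum_(A in T) \sum_(s : {perm 'I_n} | s @: A == A) #|[set g : {perm 'I_n} | perm_on A g]| <= _)%N.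
  rewrite (exchange_big_dep xpredT) //=; apply: leq_sum => s _.
  rewrite -sum1_card (partition_big (@supp n) (fun A => (A \in T) && (s @: A == A))) /=.
    apply: leq_sum => A _; rewrite -[leqRHS]sum1_card sum1_card; rewrite sum1_card.
    apply/subset_leq_card/subsetP => g /andP[_ /eqP <-]; by rewrite inE; apply/subsetP => x; rewrite !inE.
  move=> g; rewrite inE => /andP[cg /eqP cg2]; rewrite inE cg2 eqxx /=; apply/eqP/setP => x.
  apply/imsetP/idP => [[y + ->]|].
    rewrite !inE; apply: contra => /eqP e; apply/eqP/(@perm_inj _ s).
    by move/cent1P: cg => cg; rewrite -e -!permM cg.
  rewrite inE => gx; exists ((s^-1)%g x); last by rewrite permKV.
  rewrite inE; apply: contra gx => /eqP e; apply/eqP.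
  by move/cent1P: cg => cg; rewrite -{1}[x](permKV s) -permM -cg permM e permKV.
apply: leq_trans (_ : \sum_(A in T) (t`! * (n - t)`! * t`!) <= _)%N.
  apply: leq_sum => A; rewrite inE => /eqP cA.
  have -> : #|[set g : {perm 'I_n} | perm_on A g]| = t`! by rewrite -cA -(perm.card_Sym A).
  rewrite sum_nat_cond_const leq_mul2r; apply/orP; right.
  have := card_setwise_stab A; rewrite cA; apply: leq_trans.
  by apply/subset_leq_card/subsetP => s; rewrite !inE.
rewrite sum_nat_const card_draws card_ord !mulnA -[('C(n, t) * _ * _)%N]mulnA bin_fact //.
Qed.
End CommutingPairs.

(** * Bounds for character ratios *)

Section CharacterFacts.
Variables (n : nat) (nu : seq nat).
Hypothesis nuP : is_partition n nu.
Notation f := (num_syt n nu).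
Notation X := (@chi n nu).

Lemma specht_irrep : exists (i : Iirr (Sn n)) (rho : {perm 'I_n} -> 'M[algC]_f),
  [/\ forall g, X g = 'chi_i g, unitary_irrep rho, forall g, \tr (rho g) = 'chi_i g,
      colmult i false (@rowcol n nu) != 0 & colmult i true (@colcol n nu) != 0].
Proof.
have [i ei [mr mc]] := irr_index_ex nuP.
have [d [rho urho tri]] := irr_unitary i erefl.
have ed := dim_num_syt nuP urho tri mr mc; subst d.
by exists i, rho; split=> // g; rewrite /chi ei.
Qed.

Lemma chi1 : X 1%g = f%:R.
Proof. by have [i [rho [-> urho <- _ _]]] := specht_irrep; rewrite rho1 // mxtrace1. Qed.

Lemma num_syt_gt0 : (0 < f)%N.
Proof. by have [i [rho [_ urho tri mr mc]]] := specht_irrep; apply: (dim_gt0 urho tri). Qed.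

Lemma chiJ g x : X (g ^ x)%g = X g.
Proof. by have [i [rho [XE _ _ _ _]]] := specht_irrep; rewrite !XE chi_irrJ. Qed.

Lemma chi_sqr_le g : `|X g| ^+ 2 <= n%:R ^+ cyc g.
Proof.
have [i [rho [XE _ _ _ _]]] := specht_irrep; rewrite XE.
apply: le_trans (card_cent_le g).
have Gg : g \in Sn n by rewrite inE.
have := second_orthogonality_relation g Gg; rewrite class_refl mulr1n setTI => <-.
by rewrite (bigD1 i) //= -normCK lerDl sumr_ge0 // => j _; rewrite -normCK exprn_ge0.
Qed.

Variable b : nat.
Hypothesis b0 : (0 < b)%N.
Hypothesis b_row : (head 0%N nu <= b)%N.
Hypothesis b_col : (size nu <= b)%N.

Lemma chi_small_support g p q : (3 * p <= #|supp g| + 2)%N -> (#|supp g| + p * q <= n)%N ->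
  q%:R ^+ p * `|X g| <= b%:R ^+ p * f%:R.
Proof.
move=> h1 h2; have [i [rho [-> urho tri mr mc]]] := specht_irrep; rewrite -tri.
apply: char_bound_small_support => // j c.
exact: (jm_eigenvalue_le nuP urho tri mr mc b_row b_col).
Qed.

Lemma num_syt_lower : (n`! <= (2 * b) ^ n * f)%N.
Proof.
have [i [rho [_ urho tri mr mc]]] := specht_irrep.
have := dim_lower_bound nuP urho tri mr
  (fun j c => jm_eigenvalue_le nuP urho tri mr mc b_row b_col) b0 b_col.
by rewrite -natrX -natrM ler_nat.
Qed.

Variable al : nat.
Hypothesis b_al : (b ^ 2 <= al ^ 2 * n)%N.

Definition char_ratio (g : {perm 'I_n}) : algC := `|X g| / f%:R.

Lemma num_syt_pos : 0 < f%:R :> algC.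
Proof. by rewrite ltr0n num_syt_gt0. Qed.

Lemma ratio_ge0 g : 0 <= char_ratio g.
Proof. by rewrite divr_ge0 ?normr_ge0 // ltW ?num_syt_pos. Qed.

Lemma ratio_small_support g p q : (3 * p <= #|supp g| + 2)%N -> (#|supp g| + p * q <= n)%N ->
  char_ratio g ^+ 2 * (q ^ (2 * p))%N%:R <= ((al ^ 2 * n) ^ p)%N%:R.
Proof.
move=> h1 h2; apply: le_trans (_ : ((b ^ 2) ^ p)%N%:R <= _); last first.
  by rewrite ler_nat; case: (p) => [|p'] //; rewrite leq_exp2r.
have := chi_small_support h1 h2; rewrite -ler_pdivrMr ?num_syt_pos // -mulrA -/(char_ratio g) => h.
have : (q%:R ^+ p * char_ratio g) ^+ 2 <= (b%:R ^+ p) ^+ 2.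
  by apply: lerXn2r => //; rewrite nnegrE; [rewrite mulr_ge0 ?exprn_ge0 ?ratio_ge0 | rewrite exprn_ge0].
rewrite exprMn => h'; rewrite mulrC natrX [(2 * p)%N]mulnC exprM.
by apply: le_trans h' _; rewrite natrX natrX -!exprM [(p * 2)%N]mulnC.
Qed.

(** Both m^m m! <= (2m)! and the bound 4^m on the central binomial coefficient are elementary. *)
Lemma expn_le_fact m : (m ^ m <= 4 ^ m * m`!)%N.
Proof.
have le1 : (m ^ m * m`! <= (2 * m)`!)%N.
  have H k : (m ^ k * m`! <= (k + m)`!)%N.
    elim: k => [|k IH]; first by rewrite mul1n.
    by rewrite expnS addSn factS -mulnA leq_mul // ltnW // ltnS leq_addl.
  by rewrite mul2n -addnn.
have le2 : ('C(2 * m, m) <= 4 ^ m)%N.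
  rewrite -[4%N]/(2 ^ 2)%N -expnM -[X in (_ <= X ^ _)%N]/(1 + 1)%N Pascal.
  have mlt : (m < (2 * m).+1)%N by lia.
  by rewrite (bigD1 (Ordinal mlt)) //= !exp1n !muln1 leq_addr.
have := @bin_fact (2 * m) m; rewrite leq_pmull // => /(_ isT).
have -> : (2 * m - m = m)%N by lia.
move=> e; rewrite -e mulnA leq_pmul2r ?fact_gt0 // in le1.
by apply: leq_trans le1 _; rewrite leq_pmul2r ?fact_gt0.
Qed.

(** The degree bound and [expn_le_fact] give n^n <= (8b)^n f, hence n^n <= (64 al^2)^n f^2. The
    fourth power enters because [cyc_supp] bounds twice the number of cycles. *)
Lemma ratio_large_support g :
  char_ratio g ^+ 4 * (n ^ #|supp g|)%N%:R <= ((64 * al ^ 2) ^ (2 * n))%N%:R.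
Proof.
have low : (n ^ n <= (64 * al ^ 2) ^ n * f ^ 2)%N.
  have [n0|n0] := posnP n; first by move: num_syt_gt0; move: (num_syt n nu) => F F0; rewrite n0 !expn0 mul1n expn_gt0 F0.
  have h1 : (n ^ n <= (8 * b) ^ n * f)%N.
    apply: leq_trans (expn_le_fact n) _.
    have -> : ((8 * b) ^ n = 4 ^ n * (2 * b) ^ n)%N by rewrite -expnMn; congr (_ ^ _)%N; lia.
    by rewrite -mulnA leq_mul2l num_syt_lower orbT.
  have h2 : (n ^ n * n ^ n <= ((64 * al ^ 2) ^ n * f ^ 2) * n ^ n)%N.
    apply: leq_trans (_ : ((8 * b) ^ n * f) ^ 2 <= _)%N.
      by rewrite -[X in (_ <= X)%N]mulnn leq_mul.
    rewrite expnMn -expnM [(n * 2)%N]mulnC expnM mulnAC -[X in (_ <= X * _)%N]expnMn leq_mul2r.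
    apply/orP; right; rewrite leq_exp2r // expnMn -mulnA.
    by rewrite leq_mul2l b_al orbT.
  by rewrite leq_pmul2r ?expn_gt0 ?n0 in h2.
have c2 := cyc_supp g.
have ch : `|X g| ^+ 4 * (n ^ #|supp g|)%N%:R <= (n ^ (2 * n))%N%:R.
  apply: le_trans (_ : (n ^ (2 * cyc g))%N%:R * (n ^ #|supp g|)%N%:R <= _).
    rewrite ler_wpM2r // -[4%N]/(2 * 2)%N exprM mulnC natrX exprM.
    by rewrite lerXn2r ?nnegrE ?exprn_ge0 // chi_sqr_le.
  rewrite -natrM ler_nat -expnD.
  move: c2; move: (2 * cyc g + #|supp g|)%N => N c2.
  have [n0|n0] := posnP n; last by rewrite leq_pexp2l.
  by move: c2; rewrite n0 muln0 leqn0 => /eqP->.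
rewrite /char_ratio expr_div_n mulrAC ler_pdivrMr ?exprn_gt0 ?num_syt_pos //.
apply: le_trans ch _; rewrite -natrX -natrM ler_nat.
rewrite mulnC !expnM -[4%N]/(2 * 2)%N expnM -expnMn leq_exp2r //.
Qed.
End CharacterFacts.

Lemma zeta_norm i : `|zeta i| = 1.
Proof.
case: i => [|i]; first by rewrite normr1.
rewrite /zeta; case: (C_prim_root_exists _) => z /= zP.
apply/eqP; rewrite -(@pexpr_eq1 _ _ i.+1) //; first by rewrite -normrX (prim_expr_order zP) normr1.
Qed.

Lemma norm_exprz (z : algC) (k : int) : `|z| = 1 -> `|exprz z k| = 1.
Proof. by move=> z1; case: k => m; rewrite /exprz ?normfV normrX z1 ?expr1n ?invr1. Qed.

(** * From multiplicities to character ratios *)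

Section Multiplicity.
Variables (n : nat) (nu : seq nat) (r : int).
Hypothesis nuP : is_partition n nu.
Implicit Types s g : {perm 'I_n}.

Lemma xi1 s : xi r s 1%g = 1.
Proof.
rewrite /xi big1 // => x /eqP bx; rewrite perm1 bx findex0 mulr0 //.
Qed.

Lemma xi_norm s g : `|xi r s g| = 1.
Proof.
rewrite /xi normr_prod big1 // => x _; apply: norm_exprz; exact: zeta_norm.
Qed.

Lemma mult_error s :
  `| mult r s nu * ((zlambda (cycle_type s))%:R / (num_syt n nu)%:R) - 1 | <=
     \sum_(g in 'C[s]%g | g != 1%g) char_ratio nu g.
Proof.
have f0 := num_syt_pos nuP.
have c0 : #|'C[s]%g|%:R != 0 :> algC by rewrite pnatr_eq0 -lt0n cardG_gt0.
have -> : mult r s nu = #|'C[s]%g|%:R^-1 * \sum_(g in 'C[s]%g) xi r s g * (chi nu g)^*.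
  exact: (frobenius_reciprocity 'C[s]%G (xi r s) (chiJ nuP)).
rewrite -card_centralizer (bigD1 1%g) ?group1 //= xi1 mul1r chi1 // conjC_nat.
have -> : #|'C[s]%g|%:R^-1 * ((num_syt n nu)%:R + \sum_(g in 'C[s]%g | g != 1%g) xi r s g * (chi nu g)^*)
   * (#|'C[s]%g|%:R / (num_syt n nu)%:R) - 1
   = (\sum_(g in 'C[s]%g | g != 1%g) xi r s g * (chi nu g)^*) / (num_syt n nu)%:R.
  by field; rewrite c0 gt_eqF.
rewrite normrM normfV normr_nat /char_ratio -mulr_suml ler_wpM2r ?invr_ge0 ?(ltW f0) //.
apply: le_trans (ler_norm_sum _ _ _) _; apply: ler_sum => g _.
by rewrite normrM xi_norm mul1r norm_conjC.
Qed.
End Multiplicity.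

(** * Rectangular cycle types *)

Lemma inv_pow2_lt (eps : algC) : 0 < eps -> exists E : nat, ((2 ^ E)%N%:R)^-1 < eps.
Proof.
move=> e0; exists (Num.bound eps^-1); have i0 : 0 <= eps^-1 by rewrite invr_ge0 ltW.
rewrite -[ltRHS]invrK ltf_pV2 ?posrE ?invr_gt0 ?ltr0n ?expn_gt0 //.
apply: lt_trans (archi_boundP i0) _; by rewrite ltr_nat ltn_expl.
Qed.

Lemma poly_le_pow2 a c : exists U, forall u, (U <= u)%N -> (c * u ^ a <= 2 ^ u)%N.
Proof.
pose d := a.+1; exists (maxn d (c * (2 * d) ^ d)) => u; rewrite geq_max => /andP[h1 h2].
have d0 : (0 < (2 * d) ^ d)%N by rewrite expn_gt0.
rewrite -(leq_pmul2r d0); apply: leq_trans (_ : u ^ d <= _)%N.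
  by rewrite [leqRHS]expnS mulnAC leq_mul2r h2 orbT.
have e : (u ^ d <= (2 * d * (u %/ d)) ^ d)%N.
  rewrite leq_exp2r //; have := divn_eq u d; have := @ltn_pmod u d isT.
  have : (1 <= u %/ d)%N by rewrite divn_gt0.
  by move: (u %/ d)%N (u %% d)%N => q1 r1; nia.
apply: leq_trans e _; rewrite expnMn [leqRHS]mulnC leq_mul2l; apply/orP; right.
apply: leq_trans (_ : (2 ^ (u %/ d)) ^ d <= _)%N; first by rewrite leq_exp2r // ltnW // ltn_expl.
by rewrite -expnM leq_pexp2l // leq_trunc_div.
Qed.

Lemma partition0 nu : is_partition 0 nu -> nu = [::].
Proof. by case/and3P=> _; case: nu => //= x nu /andP[]; case: x. Qed.

Lemma partition_size_gt0 n nu : (0 < n)%N -> is_partition n nu -> (0 < size nu)%N.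
Proof. by move=> n0 /and3P[_ _]; case: nu => //=; case: n n0. Qed.

Lemma balanced_nat a N nu : balanced a N nu -> exists2 al : nat, (0 < al)%N &
  forall n, ((maxn (head 0 (nu n)) (size (nu n))) ^ 2 <= al ^ 2 * N n)%N.
Proof.
move=> bal; have sq0 m : 0 <= sqrtC m%:R by rewrite sqrtC_ge0.
have [a0|na0] := boolP (0 <= a).
  exists (Num.bound a).+1 => // n; have [_ h1 h2] := bal n.
  have H c : c%:R <= a * sqrtC (N n)%:R -> (c ^ 2 <= (Num.bound a).+1 ^ 2 * N n)%N.
    move=> h; rewrite -(ler_nat algC) natrM natrX natrX -[(N n)%:R]sqrtCK -exprMn.
    apply: lerXn2r; rewrite ?nnegrE ?mulr_ge0 ?sq0 //; apply: le_trans h _.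
    rewrite ler_wpM2r ?sq0 //; apply: le_trans (ltW (archi_boundP a0)) _.
    by rewrite ler_nat.
  by rewrite /maxn; case: ifP => _; apply: H.
(* Without 0 <= a the first row bound can only hold for N n = 0, where the partition is empty. *)
exists 1%N => // n; have [part h1 _] := bal n.
have [N0|N0] := posnP (N n); first by move: part; rewrite N0 => /partition0 ->.
case/negP: na0; have s0 : 0 < sqrtC (N n)%:R :> algC by rewrite lt0r sqrtC_eq0 pnatr_eq0 -lt0n N0 sq0.
by rewrite -(pmulr_lge0 _ s0); apply: le_trans h1; rewrite ler0n.
Qed.

(** * Centralizers of permutations with equal cycles *)

Section EqualCycles.
Variables (n m : nat) (s : {perm 'I_n}).
Hypothesis orbit_size : forall x, #|porbit s x| = m.
Implicit Types (g : {perm 'I_n}) (x : 'I_n).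

Definition moved_bases g := [set b in bases s | g b != b].

Lemma porbit_bases_inj : {in bases s &, injective (porbit s)}.
Proof.
move=> b c hb hc e; have tr := transversalP (partition_porbits s).
have /and3P[_ triv _] := partition_porbits s.
apply: (pblock_inj tr) => //.
have pb x : pblock (porbits s) x = porbit s x.
  by apply: def_pblock => //; [apply: imset_f | apply: porbit_id].
by rewrite !pb.
Qed.

Lemma card_supp_cent g : g \in 'C[s]%g -> #|supp g| = (m * #|moved_bases g|)%N.
Proof.
move=> cg; pose P := porbit s @: moved_bases g.
have -> : supp g = cover P.
  apply/setP => x; apply/idP/bigcupP => [|[C /imsetP[b + ->] /porbitP[k ->]]].
    have [b bB bx] := bases_cover s x; rewrite inE => gx.
    exists (porbit s b) => //; apply: imset_f; rewrite in_set bB /=.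
    have /porbitP[k ex] := bx; move: gx; rewrite ex cent_pow //.
    by apply: contra => /eqP ->.
  rewrite in_set => /andP[_]; rewrite inE cent_pow //.
  by apply: contra => /eqP/perm_inj ->.
have triv : trivIset P.
  have /and3P[_ tr _] := partition_porbits s; apply: trivIsetS tr.
  by apply/subsetP => C /imsetP[b _ ->]; apply: imset_f.
rewrite -(eqP triv) (eq_bigr (fun _ => m)) => [|C /imsetP[b _ ->]]; last exact: orbit_size.
rewrite sum_nat_const mulnC card_in_imset // => b c.
by rewrite !in_set => /andP[hb _] /andP[hc _]; apply: porbit_bases_inj.
Qed.

Lemma moved_bases_gt0 g : g \in 'C[s]%g -> g != 1%g -> (0 < #|moved_bases g|)%N.
Proof.
move=> cg; apply: contraNT; rewrite -eqn0Ngt cards_eq0 => /eqP e.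
apply/eqP; apply: (cent_eq_bases cg); first exact: group1.
move=> b hb; rewrite perm1; apply/eqP; apply: contraT => h.
by have := in_set0 b; rewrite -e in_set hb h.
Qed.

Lemma moved_bases_le g : (#|moved_bases g| <= cyc s)%N.
Proof. by rewrite -card_bases subset_leq_card //; apply/subsetP => b; rewrite in_set => /andP[]. Qed.

(** In each factor of [centralizer_weight] the base point contributes 1 and all other points
    together at most 1. *)
Lemma sum_cent_moved : \sum_(g in 'C[s]%g) (n ^ (2 * #|moved_bases g|))%N%:R^-1 <= (2 ^ cyc s)%N%:R :> algC.
Proof.
pose wt (b z : 'I_n) : algC := if z == b then 1 else (n ^ 2)%N%:R^-1.
have wt0 b z : 0 <= wt b z by rewrite /wt; case: ifP => // _; rewrite invr_ge0.
apply: le_trans (_ : \sum_(g in 'C[s]%g) \prod_(b in bases s) wt b (g b) <= _).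
  apply: ler_sum => g _; rewrite le_eqVlt; apply/orP; left; apply/eqP.
  rewrite /wt.
  rewrite (bigID (fun b => g b == b)) /= big1 => [|b /andP[_ ->]] //; rewrite mul1r.
  rewrite (eq_bigr (fun _ => (n ^ 2)%N%:R^-1)) => [|b /andP[_ /negbTE ->]] //.
  rewrite (eq_bigl (mem (moved_bases g))) => [|b]; last by rewrite /= in_set.
  by rewrite prodr_const expnM natrX exprVn.
apply: le_trans (centralizer_weight s wt0) _; rewrite natrX -card_bases -prodr_const.
apply: ler_prod => b _; rewrite sumr_ge0 //= (bigD1 b) //= {1}/wt eqxx.
have n0 : (0 < n)%N by apply: leq_ltn_trans (ltn_ord b).
rewrite [2]/(1 + 1) lerD2l; apply: le_trans (_ : \sum_(z : 'I_n) n%:R^-1 <= _).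
  rewrite [leRHS](bigD1 b) //= -[leLHS]add0r lerD ?invr_ge0 //; apply: ler_sum => z /negbTE zb.
  by rewrite /wt zb lef_pV2 ?posrE ?ltr0n ?expn_gt0 ?n0 // ler_nat -[n in (n <= _)%N]expn1 leq_pexp2l.
by rewrite sumr_const card_ord -[leLHS]mulr_natl divff // pnatr_eq0 -lt0n.
Qed.
End EqualCycles.

(** With q = n / (2p) the support and the p sets fit into n points and n <= 4 p q; the lower bound
    on n then makes al^2 n / q^2 at most 1 / G, so x^2 <= G^(-p). *)
Lemma small_support_le1 (x : algC) al n t p G W : 0 <= x -> (0 < al)%N -> (0 < n)%N -> (0 < p)%N ->
  (forall q, (t + p * q <= n)%N -> x ^+ 2 * (q ^ (2 * p))%N%:R <= ((al ^ 2 * n) ^ p)%N%:R) ->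
  (2 * t <= n)%N -> (2 * p <= n)%N -> (16 * p ^ 2 * G * al ^ 2 <= n)%N -> (W ^ 2 <= G ^ p)%N ->
  x * W%:R <= 1.
Proof.
move=> x0 al0 n0 p0 xq tn pn Gn WG; pose q := (n %/ (2 * p))%N.
have q0 : (0 < q)%N by rewrite divn_gt0 ?muln_gt0.
have le : (n <= 4 * p * q)%N.
  have := divn_eq n (2 * p); have := @ltn_pmod n (2 * p); rewrite -/q muln_gt0 p0 => /(_ isT).
  by move: (n %% _)%N q q0 => r0 q' q0; nia.
have Gq : (G * (al ^ 2 * n) <= q ^ 2)%N.
  have le2 : (n * n <= 16 * p ^ 2 * q ^ 2)%N.
    have -> : (16 * p ^ 2 * q ^ 2 = (4 * p * q) * (4 * p * q))%N by rewrite -!mulnn; clear; lia.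
    exact: leq_mul.
  have c0 : (0 < 16 * p ^ 2)%N by rewrite muln_gt0 expn_gt0 p0.
  rewrite -(leq_pmul2l c0); apply: leq_trans le2.
  have -> : (16 * p ^ 2 * (G * (al ^ 2 * n)) = 16 * p ^ 2 * G * al ^ 2 * n)%N by clear; lia.
  by rewrite leq_mul2r Gn orbT.
have /xq xp : (t + p * q <= n)%N.
  have : (2 * (p * q) <= n)%N by rewrite mulnA mulnC leq_trunc_div.
  by move: (p * q)%N tn => c; clear; lia.
have y0 : 0 <= x * W%:R by rewrite mulr_ge0.
rewrite -(@expr_le1 _ 2 _ _ y0) // exprMn.
have A0 : 0 < ((al ^ 2 * n) ^ p)%N%:R :> algC by rewrite ltr0n expn_gt0 muln_gt0 expn_gt0 al0 n0.
rewrite -(ler_pM2r A0) mul1r; apply: le_trans xp; rewrite -mulrA ler_wpM2l ?exprn_ge0 //.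
rewrite -natrX -natrM ler_nat; apply: leq_trans (_ : G ^ p * (al ^ 2 * n) ^ p <= _)%N.
  by rewrite leq_mul2r WG orbT.
by rewrite -expnMn expnM leq_exp2r.
Qed.

(* Here x stands for a character ratio at an element moving j of the k cycles.  The constant D is
   chosen so that x 4^n <= 1 as soon as n^(2j) > D^k. *)
Section EqualCyclesEstimate.
Variables (al E L m k j : nat).
Let K := ((64 * al ^ 2) ^ 2)%N.
Let D := (2 ^ 16 * K ^ 2)%N.
Hypotheses (al0 : (0 < al)%N) (L_D : (2 * D <= 2 ^ L)%N) (D_m : (D < m)%N) (E_m : (E <= m)%N).
Hypotheses (k0 : (0 < k)%N) (j0 : (0 < j)%N) (j_k : (j <= k)%N) (k_m : (k <= m)%N).
Hypotheses (m_exp : (2 * m ^ 4 <= 2 ^ m)%N) (m_lin : (3 * (L + E) * k <= m)%N).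
Hypothesis m_sqr : (64 * al ^ 2 * (L + E) ^ 2 * k <= m)%N.
Let n := (m * k)%N.
Variable x : algC.
Hypothesis x0 : 0 <= x.
Hypothesis x_small : forall p q, (3 * p <= m * j + 2)%N -> (m * j + p * q <= n)%N ->
  x ^+ 2 * (q ^ (2 * p))%N%:R <= ((al ^ 2 * n) ^ p)%N%:R.
Hypothesis x_large : x ^+ 4 * (n ^ (m * j))%N%:R <= ((64 * al ^ 2) ^ (2 * n))%N%:R.

Let m0 : (0 < m)%N. Proof. by apply: leq_ltn_trans D_m. Qed.
Let n0 : (0 < n)%N. Proof. by rewrite muln_gt0 m0 k0. Qed.
Let D0 : (0 < D)%N. Proof. by rewrite !(muln_gt0, expn_gt0) al0. Qed.

(** The choice p = L k + E makes 2^p at least D^k 2^(k + E), since 2 D <= 2^L; with G = 4 the saving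
    is exactly 2^p. *)
Lemma few_moved : (n ^ (2 * j) <= D ^ k)%N -> x * (n ^ (2 * j) * 2 ^ (k + E))%N%:R <= 1.
Proof.
move=> h; pose p := (L * k + E)%N.
have L0 : (0 < L)%N by case: (posnP L) L_D => // ->; rewrite expn0; move: D0; lia.
have p0 : (0 < p)%N by rewrite /p addn_gt0 muln_gt0 L0 k0.
have ple : (p <= (L + E) * k)%N by rewrite /p; nia.
have p3 : (3 * p <= m)%N by apply: leq_trans m_lin; rewrite -mulnA leq_mul2l.
(* As D < m <= n, the assumption leaves at most half of the cycles moved, hence a support of at most
   n/2. *)
have j2 : (2 * j <= k)%N.
  rewrite leqNgt; apply/negP => kj.
  have : (n ^ k.+1 <= D ^ k)%N by apply: leq_trans h; rewrite leq_pexp2l.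
  rewrite leqNgt => /negP[]; apply: leq_ltn_trans (_ : D ^ k.+1 < _)%N; first by rewrite leq_pexp2l.
  by rewrite ltn_exp2r //; apply: leq_trans D_m _; rewrite /n leq_pmulr.
have x1 : x * (2 ^ p)%N%:R <= 1.
  apply: (@small_support_le1 _ al n (m * j) p 4) => //; last by rewrite -expnM mulnC expnM.
  - move=> q; apply: x_small; have : (m <= m * j)%N by rewrite leq_pmulr.
    by lia.
  - by rewrite mulnCA leq_mul2l j2 orbT.
  - by apply: leq_trans (_ : m <= _)%N; [lia | rewrite leq_pmulr].
  have -> : (16 * p ^ 2 * 4 * al ^ 2 = 64 * al ^ 2 * p ^ 2)%N by clear; lia.
  apply: leq_trans (_ : 64 * al ^ 2 * (L + E) ^ 2 * k * k <= _)%N.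
    rewrite -[leqRHS]mulnA [(k * k)%N]mulnn -[leqRHS]mulnA -expnMn leq_mul2l leq_exp2r //.
    by rewrite ple orbT.
  by rewrite leq_mul2r m_sqr orbT.
apply: le_trans x1; rewrite ler_wpM2l // ler_nat.
apply: leq_trans (_ : D ^ k * 2 ^ (k + E) <= _)%N; first by rewrite leq_mul2r h orbT.
rewrite expnD mulnA -expnMn [(D * 2)%N]mulnC /p expnD expnM leq_mul2r; apply/orP; right.
by rewrite leq_exp2r.
Qed.

Lemma many_moved : (D ^ k < n ^ (2 * j))%N -> x * (n ^ (2 * j) * 2 ^ (k + E))%N%:R <= 1.
Proof.
move=> h; have x1 : x * (4 ^ n)%N%:R <= 1.
  have y0 : 0 <= x * (4 ^ n)%N%:R by rewrite mulr_ge0.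
  rewrite -(@expr_le1 _ 8 _ _ y0) // exprMn.
  have K0 : 0 < (K ^ (2 * n))%N%:R :> algC by rewrite ltr0n !(muln_gt0, expn_gt0) al0.
  rewrite -(ler_pM2r K0) mul1r -mulrA -natrX -natrM.
  (* The eighth power is the square of the estimate [x_large]; the factor 2^16 of [D] is 4^8. *)
  have -> : ((4 ^ n) ^ 8 * K ^ (2 * n) = D ^ n)%N.
    rewrite [(K ^ _)%N]expnM [in RHS]expnMn; congr (_ * _)%N.
    by rewrite -[4%N]/(2 ^ 2)%N -!expnM; congr (_ ^ _)%N; lia.
  apply: le_trans (_ : x ^+ 8 * (n ^ (2 * j * m))%N%:R <= _).
    rewrite ler_wpM2l ?exprn_ge0 // ler_nat [in X in (D ^ X <= _)%N]/n [(m * k)%N]mulnC !expnM.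
    by rewrite leq_exp2r // ltnW // -expnM.
  have -> : x ^+ 8 * (n ^ (2 * j * m))%N%:R = (x ^+ 4 * (n ^ (m * j))%N%:R) ^+ 2.
    rewrite exprMn -exprM -natrX -expnM; congr (_ * (_ ^ _)%N%:R); lia.
  have -> : (K ^ (2 * n))%N%:R = ((64 * al ^ 2) ^ (2 * n))%N%:R ^+ 2 :> algC.
    by rewrite /K -natrX -!expnM; congr (_ ^ _)%N%:R; lia.
  by apply: lerXn2r; rewrite ?nnegrE ?mulr_ge0 ?exprn_ge0.
apply: le_trans x1; rewrite ler_wpM2l // ler_nat.
rewrite -[4%N]/(2 * 2)%N expnMn expnD mulnA leq_mul //; last first.
  by rewrite leq_pexp2l // (leq_trans E_m) // /n leq_pmulr.
apply: leq_trans (_ : (m ^ 4) ^ k * 2 ^ k <= _)%N.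
  rewrite leq_mul2r -expnM; apply/orP; right.
  apply: leq_trans (_ : n ^ (2 * k) <= _)%N; first by rewrite leq_pexp2l // leq_mul2l j_k orbT.
  have -> : (m ^ (4 * k) = (m * m) ^ (2 * k))%N by rewrite mulnn -expnM mulnA.
  by rewrite leq_exp2r ?muln_gt0 // /n leq_mul2l k_m orbT.
by rewrite -expnMn /n expnM leq_exp2r // mulnC.
Qed.

Lemma moved_estimate : x * (n ^ (2 * j) * 2 ^ (k + E))%N%:R <= 1.
Proof. by have [/few_moved|/many_moved] := leqP (n ^ (2 * j)) (D ^ k). Qed.
End EqualCyclesEstimate.

Lemma zlambda_nseq k m : (0 < m)%N -> zlambda (nseq k m) = (m ^ k * k`!)%N.
Proof.
move=> m0; rewrite /zlambda sumn_nseq; have [->|k0] := posnP k; first by rewrite muln0 big_geq.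
have mI : m \in index_iota 1 (m * k).+1 by rewrite mem_index_iota m0 ltnS leq_pmulr.
rewrite (bigD1_seq m) ?iota_uniq //= count_nseq /= eqxx mul1n big1 ?muln1 // => i /negbTE im.
by rewrite count_nseq /= eq_sym im.
Qed.

Lemma nseq_cycles n k m (s : {perm 'I_n}) : cycle_type s = nseq k m ->
  cyc s = k /\ forall x, #|porbit s x| = m.
Proof.
move=> e; split; first by rewrite -[RHS](size_nseq k m) -e size_sort size_map -cardE.
move=> x; have : #|porbit s x| \in cycle_type s.
  by rewrite mem_sort; apply: map_f; rewrite mem_enum imset_f.
by rewrite e mem_nseq => /andP[_ /eqP].
Qed.

Lemma rectangle_multiplicity r (k : nat -> nat) :
  (forall eps : algC, 0 < eps -> exists M, forall m, (M <= m)%N -> (k m)%:R <= eps * m%:R) ->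
  forall (a : algC) (nu : nat -> seq nat), balanced a (fun m => m * k m)%N nu ->
  forall s : forall m, {perm 'I_(m * k m)},
    (forall m, (0 < m)%N -> cycle_type (s m) = nseq (k m) m) ->
  forall eps : algC, 0 < eps -> exists M, forall m, (M <= m)%N ->
    `| mult r (s m) (nu m) * ((m ^ k m * (k m)`!)%N%:R / (@num_syt (m * k m) (nu m))%:R) - 1 | < eps.
Proof.
move=> k_o a nu bal s s_type eps eps0.
have [E E_eps] := inv_pow2_lt eps0; have [al al0 b_al] := balanced_nat bal.
have [L L_D] : exists L, (2 * (2 ^ 16 * ((64 * al ^ 2) ^ 2) ^ 2) <= 2 ^ L)%N.
  by move: (2 * _)%N => D; exists D; apply/ltnW/ltn_expl.
(* One inequality C k <= m covers [m_lin], [m_sqr] and k <= m. *)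
pose C := (64 * al ^ 2 * (L + E) ^ 2 + 3 * (L + E) + 1)%N.
have [M1 M1P] := k_o (C%:R^-1) ltac:(by rewrite invr_gt0 ltr0n /C addn1).
have [U UP] := poly_le_pow2 4 2.
have [D eD] : {D | D = (2 ^ 16 * ((64 * al ^ 2) ^ 2) ^ 2)%N} by exists (2 ^ 16 * ((64 * al ^ 2) ^ 2) ^ 2)%N.
exists (M1 + U + D.+1 + E)%N => m hm.
have m1 : (M1 <= m)%N by lia.
have mU : (U <= m)%N by lia.
have mD : (D < m)%N by lia.
have mE : (E <= m)%N by lia.
have m0 : (0 < m)%N by apply: leq_ltn_trans mD.
have Ck : (C * k m <= m)%N.
  have := M1P m m1; rewrite ler_pdivlMl; last by rewrite ltr0n /C addn1.
  by rewrite -natrM ler_nat.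
have [nuP _ _] := bal m.
rewrite -zlambda_nseq // -s_type //; apply: le_lt_trans (mult_error r nuP (s m)) _.
have [cs os] := nseq_cycles (s_type m m0).
have [k0|k0] := posnP (k m).
  rewrite big1 // => g /andP[_ /negP[]]; apply/eqP/permP => x.
  by have := ltn_ord x; rewrite [X in (_ < X)%N](_ : _ = 0%N) // k0 muln0.
apply: le_lt_trans _ E_eps.
pose n := (m * k m)%N.
have n0 : (0 < n)%N by rewrite muln_gt0 m0 k0.
pose b := maxn (head 0%N (nu m)) (size (nu m)).
have b0 : (0 < b)%N by rewrite leq_max (partition_size_gt0 n0 nuP) orbT.
have b1 : (head 0%N (nu m) <= b)%N by rewrite leq_max leqnn.
have b2 : (size (nu m) <= b)%N by rewrite leq_max leqnn orbT.
apply: le_trans (_ : \sum_(g in 'C[s m]%g)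
   (n ^ (2 * #|moved_bases (s m) g|))%N%:R^-1 * (2 ^ (k m + E))%N%:R^-1 <= _); last first.
  rewrite -mulr_suml; apply: le_trans (_ : (2 ^ k m)%N%:R * (2 ^ (k m + E))%N%:R^-1 <= _).
    by rewrite ler_wpM2r ?invr_ge0 // -[in leRHS]cs; apply: sum_cent_moved.
  by rewrite expnD natrM invfM mulrA divff ?mul1r // pnatr_eq0 -lt0n expn_gt0.
rewrite [leLHS]big_mkcondr; apply: ler_sum => g cg.
have c0 : 0 <= (n ^ (2 * #|moved_bases (s m) g|))%N%:R^-1 * (2 ^ (k m + E))%N%:R^-1 :> algC.
  by rewrite mulr_ge0 ?invr_ge0.
case: ifP => // g1; rewrite -invfM -natrM -[leRHS]mul1r ler_pdivlMr; last first.
  by rewrite ltr0n muln_gt0 !expn_gt0 n0.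
have sg := card_supp_cent os cg.
apply: (@moved_estimate al E L m (k m)) => //.
- by rewrite -eD.
- exact: moved_bases_gt0.
- by have := moved_bases_le (s m) g; rewrite cs.
- by apply: leq_trans Ck; rewrite leq_pmull // /C addn1.
- exact: UP.
- by apply: leq_trans Ck; rewrite leq_mul2r /C -addnA addnCA leq_addr orbT.
- by apply: leq_trans Ck; rewrite leq_mul2r /C -addnA leq_addr orbT.
- exact: ratio_ge0.
- by move=> p q; rewrite -sg; apply: (ratio_small_support nuP b0 b1 b2 (b_al m)).
by rewrite -sg; apply: (ratio_large_support nuP b0 b1 b2 (b_al m)).
Qed.

(** * Random cycle types *)

(* The hypotheses on n hold when n is of order u^12 with u large. *)
Section CommutingEstimate.
Variables (n : nat) (nu : seq nat) (al u : nat).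
Hypotheses (nuP : is_partition n nu) (al0 : (0 < al)%N) (u0 : (0 < u)%N) (n0 : (0 < n)%N).
Hypothesis b_al : ((maxn (head 0 nu) (size nu)) ^ 2 <= al ^ 2 * n)%N.
Hypothesis n_large12 : (16 * 729 * al ^ 2 * (24 * u) ^ 12 <= n)%N.
Hypothesis n_large8 : (32 * (1024 * al ^ 2 * u ^ 2) ^ 4 <= n)%N.
Hypotheses (n_large2 : (48 * u + 8 * u ^ 2 <= n)%N) (n_large0 : (2 * ((64 * al ^ 2) ^ 2) ^ 2 <= n)%N).
Hypothesis n_small : (2 * n <= 2 ^ u)%N.
Implicit Types (s g : {perm 'I_n}) (p q : nat).

Lemma ratio_small g p q : (3 * p <= #|supp g| + 2)%N -> (#|supp g| + p * q <= n)%N ->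
  char_ratio nu g ^+ 2 * (q ^ (2 * p))%N%:R <= ((al ^ 2 * n) ^ p)%N%:R.
Proof.
apply: (ratio_small_support nuP (b := maxn (head 0%N nu) (size nu))) => //.
- by rewrite leq_max (partition_size_gt0 n0 nuP) orbT.
- by rewrite leq_max leqnn.
- by rewrite leq_max leqnn orbT.
Qed.

Lemma ratio_large g : char_ratio nu g ^+ 4 * (n ^ #|supp g|)%N%:R <= ((64 * al ^ 2) ^ (2 * n))%N%:R.
Proof.
apply: (ratio_large_support nuP (b := maxn (head 0%N nu) (size nu))) => //.
- by rewrite leq_max (partition_size_gt0 n0 nuP) orbT.
- by rewrite leq_max leqnn.
- by rewrite leq_max leqnn orbT.
Qed.

(** In the square of the fourth power, n^n has to absorb (64 al^2)^(4n) and (2n)^(8u); the latter is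
    at most 2^(8 u^2) <= 2^n. *)
Lemma ratio_very_large g : (n < 2 * #|supp g|)%N -> char_ratio nu g * ((2 * n) ^ u)%N%:R <= 1.
Proof.
move=> h; have y0 : 0 <= char_ratio nu g * ((2 * n) ^ u)%N%:R by rewrite mulr_ge0 ?ratio_ge0.
rewrite -(@expr_le1 _ 4 _ _ y0) // exprMn.
have N0 : 0 < (n ^ #|supp g|)%N%:R :> algC by rewrite ltr0n expn_gt0 n0.
rewrite -(ler_pM2r N0) mul1r mulrAC.
apply: le_trans (_ : ((64 * al ^ 2) ^ (2 * n))%N%:R * ((2 * n) ^ u)%N%:R ^+ 4 <= _).
  by rewrite ler_wpM2r ?exprn_ge0 //; apply: ratio_large.
rewrite -natrX -natrM ler_nat expnM -(@leq_exp2r _ _ 2) // expnMn.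
apply: leq_trans (_ : n ^ n <= _)%N; last by rewrite -expnM leq_pexp2l // mulnC ltnW.
apply: leq_trans (_ : (2 * ((64 * al ^ 2) ^ 2) ^ 2) ^ n <= _)%N; last by rewrite leq_exp2r.
rewrite -[((_ ^ n) ^ 2)%N]expnM [(n * 2)%N]mulnC expnM [leqRHS]expnMn [leqRHS]mulnC leq_mul2l.
apply/orP; right; apply: leq_trans (_ : (2 ^ u) ^ (8 * u) <= _)%N.
  have -> : ((((2 * n) ^ u) ^ 4) ^ 2 = (2 * n) ^ (8 * u))%N by rewrite -!expnM; congr (_ ^ _)%N; lia.
  by rewrite leq_exp2r ?muln_gt0 ?u0.
rewrite -expnM leq_pexp2l //; apply: leq_trans n_large2.
by rewrite mulnCA mulnn leq_addl.
Qed.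

(** Here p = 8u whatever the support. [B] is 16 p^2 al^2, so G = n / B is the largest value that
    [small_support_le1] admits, and after removing the exponent u the requirement is (2n)^2 <=
    G^8. *)
Lemma ratio_moderate g : (24 * u < #|supp g|)%N -> (2 * #|supp g| <= n)%N ->
  char_ratio nu g * ((2 * n) ^ u)%N%:R <= 1.
Proof.
move=> h1 h2; have [B eB] : {B | B = (1024 * al ^ 2 * u ^ 2)%N} by eexists.
have B0 : (0 < B)%N by rewrite eB !(muln_gt0, expn_gt0) al0 u0.
have Bn : (B <= n)%N.
  apply: leq_trans n_large8; rewrite -eB; apply: leq_trans (_ : B ^ 4 <= _)%N.
    by rewrite -[leqLHS]expn1 leq_pexp2l.
  by rewrite leq_pmull.
apply: (@small_support_le1 _ al n #|supp g| (8 * u) (n %/ B)) => //.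
- exact: ratio_ge0.
- by rewrite muln_gt0.
- by move=> q; apply: ratio_small; lia.
- by apply: leq_trans n_large2; clear; lia.
- have -> : (16 * (8 * u) ^ 2 * (n %/ B) * al ^ 2 = n %/ B * B)%N.
    by move: (n %/ B)%N => G; rewrite eB; clear; lia.
  exact: leq_trunc_div.
rewrite -expnM [(u * 2)%N]mulnC [leqLHS]expnM [leqRHS]expnM leq_exp2r //.
have c0 : (0 < (2 * B) ^ 8)%N by rewrite expn_gt0 muln_gt0 B0.
have le : (n <= 2 * B * (n %/ B))%N.
  have := divn_eq n B; have := @ltn_pmod n B B0; have : (0 < n %/ B)%N by rewrite divn_gt0.
  by move: (n %/ B)%N (n %% B)%N => G r0; clear; nia.
rewrite -(leq_pmul2l c0); apply: leq_trans (_ : n ^ 8 <= _)%N; last by rewrite -expnMn leq_exp2r.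
have -> : ((2 * B) ^ 8 * (2 * n) ^ 2 = (32 * B ^ 4) ^ 2 * n ^ 2)%N by clear; lia.
apply: leq_trans (_ : n ^ 2 * n ^ 2 <= _)%N; first by rewrite leq_mul2r leq_exp2r // eB n_large8 orbT.
by rewrite -expnD leq_pexp2l.
Qed.

Lemma ratio_far g : (24 * u < #|supp g|)%N -> char_ratio nu g * ((2 * n) ^ u)%N%:R <= 1.
Proof.
by move=> h; have [/ratio_moderate|/ratio_very_large] := leqP (2 * #|supp g|) n; apply.
Qed.

Lemma sum_far s : (cyc s <= u)%N ->
  \sum_(g in 'C[s]%g | (24 * u < #|supp g|)%N) char_ratio nu g <= (2 ^ u)%N%:R^-1.
Proof.
move=> cu; apply: le_trans (_ : \sum_(g in 'C[s]%g) ((2 * n) ^ u)%N%:R^-1 <= _).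
  rewrite [leLHS]big_mkcondr; apply: ler_sum => g _; case: ifP => [h|_]; last by rewrite invr_ge0.
  by rewrite -[leRHS]mul1r ler_pdivlMr ?ratio_far // ltr0n expn_gt0 muln_gt0 n0.
rewrite sumr_const -[leLHS]mulr_natl ler_pdivrMr; last by rewrite ltr0n expn_gt0 muln_gt0 n0.
apply: le_trans (card_cent_le s) _; rewrite expnMn natrM mulKf ?pnatr_eq0 -?lt0n ?expn_gt0 //.
by rewrite -natrX ler_nat leq_pexp2l.
Qed.

(** The factorial cancels the number of commuting pairs with this support size; one factor 24u pays
    for summing over the sizes, the other leaves a small remainder. *)
Lemma ratio_near g t : #|supp g| = t.+1 -> (t < 24 * u)%N ->
  char_ratio nu g <= ((t.+1`! * (24 * u) ^ 2)%N%:R)^-1.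
Proof.
move=> gt tu; pose p := ((t.+1 + 2) %/ 3)%N; pose tau := (24 * u)%N.
have p0 : (0 < p)%N by rewrite divn_gt0 // addn2.
have pt : (t.+1 <= 3 * p)%N /\ (3 * p <= t.+1 + 2)%N by rewrite /p; clear; lia.
have ptau : (p <= tau)%N by move: tu; rewrite /p /tau; clear; lia.
have tau0 : (0 < tau)%N by rewrite muln_gt0.
have tn : (2 * tau <= n)%N by rewrite /tau; apply: leq_trans n_large2; clear; lia.
rewrite -[leRHS]mul1r ler_pdivlMr; last by rewrite ltr0n muln_gt0 fact_gt0 expn_gt0 tau0.
(* Since 729 = 3^6, G^p is (3p)^(6p) tau^(4p), which dominates the square of (t+1)! tau^2 because
   t+1 <= 3p. *)
apply: (@small_support_le1 _ al n t.+1 p (729 * p ^ 6 * tau ^ 4)) => //.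
- exact: ratio_ge0.
- by move=> q; rewrite -gt; apply: ratio_small; rewrite gt; case: pt.
- by apply: leq_trans tn; rewrite leq_mul2l.
- by apply: leq_trans tn; rewrite leq_mul2l.
- apply: leq_trans n_large12; rewrite -/tau.
  have -> : (16 * p ^ 2 * (729 * p ^ 6 * tau ^ 4) * al ^ 2 = 16 * 729 * al ^ 2 * (p ^ 8 * tau ^ 4))%N.
    by clear; lia.
  by rewrite leq_mul2l -[12%N]/(8 + 4)%N expnD leq_mul2r leq_exp2r // ptau !orbT.
rewrite expnMn -expnM [leqRHS]expnMn leq_mul //; last first.
  by rewrite -expnM leq_pexp2l // leq_pmulr.
apply: leq_trans (_ : ((3 * p) ^ (3 * p)) ^ 2 <= _)%N.
  rewrite leq_exp2r //; apply: leq_trans (_ : t.+1 ^ t.+1 <= _)%N.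
    rewrite -ffactnn; elim: {1 4 6}t.+1 (leqnn t.+1) => // k IH kt.
    by rewrite expnSr ffactnSr leq_mul ?leq_subr // IH // ltnW.
  apply: leq_trans (_ : (3 * p) ^ t.+1 <= _)%N; first by rewrite leq_exp2r //; case: pt.
  by rewrite leq_pexp2l ?muln_gt0 //; case: pt.
by rewrite -expnM [(3 * p * 2)%N]mulnC mulnA expnM leq_exp2r // expnMn.
Qed.

Lemma sum_near : \sum_(s : {perm 'I_n})
  \sum_(g in 'C[s]%g | (g != 1%g) && (#|supp g| <= 24 * u)%N) char_ratio nu g <= n`!%:R / (24 * u)%N%:R.
Proof.
pose tau := (24 * u)%N; have tau0 : (0 < tau)%N by rewrite muln_gt0.
pose c (t : nat) : algC := ((t.+1`! * tau ^ 2)%N%:R)^-1.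
have c0 t : 0 <= c t by rewrite invr_ge0.
apply: le_trans (_ : \sum_(s : {perm 'I_n}) \sum_(g in 'C[s]%g) \sum_(t < tau)
    (if #|supp g| == t.+1 then c t else 0) <= _).
  apply: ler_sum => s _; rewrite [leLHS]big_mkcondr; apply: ler_sum => g _.
  have S0 (P : pred 'I_tau) : 0 <= \sum_(t < tau | P t) (if #|supp g| == t.+1 then c t else 0).
    by apply: sumr_ge0 => t _; case: ifP.
  case: ifP => [/andP[g1 gt]|_]; last exact: S0.
  have sg0 : (0 < #|supp g|)%N.
    rewrite lt0n cards_eq0; apply: contra g1 => /eqP e; apply/eqP/permP => x; rewrite perm1.
    by apply/eqP; apply: contraT => gx; have := in_set0 x; rewrite -e inE gx.
  have lt : (#|supp g|.-1 < tau)%N by rewrite prednK.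
  rewrite (bigD1 (Ordinal lt)) //= prednK // eqxx -[leLHS]addr0 lerD ?S0 //.
  by apply: ratio_near => //; rewrite prednK.
pose N (t : nat) s := #|[set g in 'C[s]%g | #|supp g| == t.+1]|.
rewrite (eq_bigr (fun s => \sum_(t < tau) (N t s)%:R * c t)) => [|s _]; last first.
  rewrite exchange_big /=; apply: eq_bigr => t _; rewrite -big_mkcondr /= sumr_const mulr_natl.
  by congr (_ *+ _); apply: eq_card => g; rewrite [in RHS]in_set.
rewrite exchange_big /=; apply: le_trans (_ : \sum_(t < tau) n`!%:R / (tau ^ 2)%N%:R <= _).
  apply: ler_sum => t _; rewrite -mulr_suml -natr_sum.
  have tn : (t.+1 <= n)%N.
    apply: leq_trans (ltn_ord t) _; apply: leq_trans n_large2; rewrite /tau; clear; lia.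
  apply: le_trans (_ : (n`! * t.+1`!)%N%:R * c t <= _).
    by rewrite ler_wpM2r // ler_nat; apply: sum_commuting_supp.
  rewrite /c; have := fact_gt0 t.+1; move: (t.+1)`! n`! (tau ^ 2)%N => T M T2 T0.
  by rewrite !natrM invfM -mulrA mulVKf ?lexx // pnatr_eq0 -lt0n.
rewrite sumr_const card_ord -[leLHS]mulr_natl -mulnn natrM invfM mulrCA.
by rewrite mulVKf ?lexx // pnatr_eq0 -lt0n.
Qed.
End CommutingEstimate.

(** The exponent 12 comes from [ratio_near]: p^2 from the choice of q and p^6 tau^4 from G, where p
    <= tau = 24u. The other requirements have lower degree in u. *)
Lemma size_bounds al : exists2 c, (0 < c)%N & forall u, (0 < u)%N ->
  [/\ (16 * 729 * al ^ 2 * (24 * u) ^ 12 <= c * u ^ 12)%N,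
      (32 * (1024 * al ^ 2 * u ^ 2) ^ 4 <= c * u ^ 12)%N,
      (48 * u + 8 * u ^ 2 <= c * u ^ 12)%N &
      (2 * ((64 * al ^ 2) ^ 2) ^ 2 <= c * u ^ 12)%N].
Proof.
have [A eA] : {A | A = (16 * 729 * al ^ 2 * 24 ^ 12)%N} by eexists.
have [B eB] : {B | B = (32 * (1024 * al ^ 2) ^ 4)%N} by eexists.
have [D eD] : {D | D = (2 * ((64 * al ^ 2) ^ 2) ^ 2)%N} by eexists.
exists (A + B + D + 56)%N => [|u u0]; first by rewrite addn_gt0 orbT.
have mono c e : (e <= 12)%N -> (c <= A + B + D + 56)%N -> (c * u ^ e <= (A + B + D + 56) * u ^ 12)%N.
  by move=> le12 lec; rewrite leq_mul // leq_pexp2l.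
split.
- by rewrite expnMn mulnA -eA; apply: mono => //; lia.
- by rewrite expnMn mulnA -eB -expnM; apply: mono => //; lia.
- apply: leq_trans (_ : 56 * u ^ 2 <= _)%N; last by apply: mono => //; lia.
  by rewrite -mulnn; move: u0; clear; nia.
by rewrite -eD -[leqLHS]muln1 -(expn0 u); apply: mono => //; lia.
Qed.

Lemma card_many_cycles n u :
  (#|[set s : {perm 'I_n} | (u < cyc s)%N]| * 2 ^ u <= n.+1`!)%N.
Proof.
rewrite -sum_2cyc -sum_nat_const big_mkcond; apply: leq_sum => s _.
by rewrite inE; case: ifP => // us; rewrite leq_pexp2l // ltnW.
Qed.

Lemma random_multiplicity r (a : algC) (nu : nat -> seq nat) : balanced a (fun n => n) nu ->
  forall eps delta : algC, 0 < eps -> 0 < delta ->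
    exists N, forall n, (N <= n)%N ->
      #|[set s : {perm 'I_n} | eps < `| mult r s (nu n) *
            ((zlambda (cycle_type s))%:R / (@num_syt n (nu n))%:R) - 1 |]|%:R
        < delta * (n`!)%:R.
Proof.
move=> bal eps delta eps0 delta0; have [al al0 b_al] := balanced_nat bal.
have [E E_eps] : exists E : nat, ((2 ^ E)%N%:R)^-1 < eps / 2 by apply: inv_pow2_lt; rewrite divr_gt0.
have [F F_delta] : exists F : nat, ((2 ^ F)%N%:R)^-1 < delta / 2 by apply: inv_pow2_lt; rewrite divr_gt0.
have [c c0 cP] := size_bounds al.
have [U UP] := poly_le_pow2 12 (2 ^ F * 2 * c * 2 ^ 12).
(* [U] makes 2^u dominate a multiple of n, [E] handles the distant supports, and 2^(E + F) serves
   Markov's inequality for [S2]. *)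
pose u0 := (U + E + 2 ^ (E + F))%N.
have u0_gt0 : (0 < u0)%N by rewrite addn_gt0 expn_gt0 orbT.
exists (c * u0 ^ 12)%N => n hn.
have n0 : (0 < n)%N by apply: leq_trans hn; rewrite muln_gt0 c0 expn_gt0 u0_gt0.
have ubnd v : (c * v ^ 12 <= n)%N -> (v <= n)%N.
  move=> h; apply: leq_trans h; apply: leq_trans (_ : v ^ 12 <= _)%N; last by rewrite leq_pmull.
  by case: v => // v; rewrite -[leqLHS]expn1 leq_pexp2l.
(* Maximality gives n < c (u + 1)^12 <= c (2u)^12, the upper bound on n needed to compare it with
   2^u. *)
have [u un umax] : exists2 u, (c * u ^ 12 <= n)%N & forall v, (c * v ^ 12 <= n)%N -> (v <= u)%N.
  by have [u] := ex_maxnP (ex_intro _ u0 hn) ubnd; exists u.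
have uu0 := umax _ hn; have u_gt0 : (0 < u)%N by apply: leq_trans uu0.
have [uU uE uEF] : [/\ (U <= u)%N, (E <= u)%N & (2 ^ (E + F) <= u)%N].
  by split; apply: leq_trans uu0; rewrite /u0; move: (2 ^ _)%N => T; clear; lia.
have [l1 l2 l3 l4] := cP u u_gt0.
have nF : (2 ^ F * (2 * n) <= 2 ^ u)%N.
  apply: leq_trans (UP u uU); have -> : (2 ^ F * 2 * c * 2 ^ 12 * u ^ 12 = 2 ^ F * (2 * (c * (2 * u) ^ 12)))%N.
    by rewrite expnMn !mulnA.
  do 2!apply: leq_mul => //; apply: leq_trans (_ : c * u.+1 ^ 12 <= _)%N.
    by rewrite leqNgt; apply/negP => /ltnW/umax; rewrite ltnn.
  rewrite leq_mul2l leq_exp2r //; apply/orP; right.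
  by move: u_gt0; clear; lia.
have n2u : (2 * n <= 2 ^ u)%N by apply: leq_trans nF; rewrite leq_pmull ?expn_gt0.
have [nuP _ _] := bal n.
pose near (s : {perm 'I_n}) := \sum_(g in 'C[s]%g | (g != 1%g) && (#|supp g| <= 24 * u)%N) char_ratio (nu n) g.
have near0 s : 0 <= near s by apply: sumr_ge0 => g _; apply: ratio_ge0.
set Bad := [set s | _].
pose S1 := [set s : {perm 'I_n} | (u < cyc s)%N].
pose S2 := [set s : {perm 'I_n} | (2 ^ E)%N%:R^-1 < near s].
(* Outside [S1] and [S2] the near and the far part of the error are each at most eps / 2; both
   exceptional sets are then bounded by Markov's inequality. *)
have sub : (#|Bad| <= #|S1| + #|S2|)%N.
  apply: leq_trans (_ : #|S1 :|: S2| <= _)%N; last by rewrite -cardsUI leq_addr.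
  apply/subset_leq_card/subsetP => s; rewrite in_setU !in_set; apply: contraLR.
  rewrite negb_or -leqNgt => /andP[cs]; rewrite -real_leNgt ?ger0_real ?invr_ge0 // => ns.
  rewrite -real_leNgt ?ger0_real ?normr_ge0 ?(ltW eps0) //.
  apply: le_trans (mult_error r nuP s) _.
  rewrite (bigID (fun g => #|supp g| <= 24 * u)%N) /=.
  have -> : eps = eps / 2 + eps / 2 by field.
  apply: lerD.
    under eq_bigl do rewrite -andbA.
    exact: le_trans ns (ltW E_eps).
  apply: le_trans (_ : (2 ^ u)%N%:R^-1 <= _); last first.
    apply: le_trans (ltW E_eps); rewrite lef_pV2 ?posrE ?ltr0n ?expn_gt0 //.
    by rewrite ler_nat leq_pexp2l.
  have far := sum_far nuP al0 u_gt0 n0 (b_al n) (leq_trans l1 un) (leq_trans l2 un)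
    (leq_trans l3 un) (leq_trans l4 un) n2u cs.
  apply: le_trans far; rewrite [leLHS]big_mkcond [leRHS]big_mkcond; apply: ler_sum => g _ /=.
  rewrite -ltnNge; case: (g \in _) => //=; case: (g != _) => //=.
  by case: ifP => // _; apply: ratio_ge0.
have S1F : (#|S1| * 2 ^ F <= n`!)%N.
  rewrite -(@leq_pmul2r (2 * n)) ?muln_gt0 ?n0 // -mulnA.
  apply: leq_trans (_ : #|S1| * 2 ^ u <= _)%N; first by rewrite leq_mul2l nF orbT.
  apply: leq_trans (card_many_cycles n u) _; rewrite factS mulnC leq_mul2l; apply/orP; right.
  by move: n0; clear; lia.
have S2F : (#|S2| * 2 ^ F <= n`!)%N.
  have near_sum := sum_near nuP al0 u_gt0 n0 (b_al n) (leq_trans l1 un) (leq_trans l3 un).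
  have : #|S2|%:R * (2 ^ E)%N%:R^-1 <= n`!%:R / (24 * u)%N%:R :> algC.
    apply: le_trans near_sum; rewrite mulr_natl -sumr_const [leLHS]big_mkcond.
    apply: ler_sum => s _; rewrite in_set -/(near s); case: ifP => [/ltW//|_]; exact: near0.
  rewrite ler_pdivlMr ?ltr0n ?muln_gt0 // mulrAC ler_pdivrMr ?ltr0n ?expn_gt0 //.
  rewrite -!natrM ler_nat => h; rewrite -(@leq_pmul2r (2 ^ E)) ?expn_gt0 //.
  apply: leq_trans h; rewrite -mulnA -expnD addnC leq_mul2l; apply/orP; right.
  by apply: leq_trans uEF _; rewrite leq_pmull.
apply: le_lt_trans (_ : (2 ^ F)%N%:R^-1 * 2 * n`!%:R < _); last first.
  by rewrite ltr_pM2r ?ltr0n ?fact_gt0 // -ltr_pdivlMr.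
rewrite -mulrA ler_pdivlMl ?ltr0n ?expn_gt0 // -!natrM ler_nat.
apply: leq_trans (_ : 2 ^ F * (#|S1| + #|S2|) <= _)%N; first by rewrite leq_mul2l sub orbT.
by rewrite mulnC mulnDl mul2n -addnn leq_add.
Qed.

Theorem theorem8p3 (r : int) :
  (forall k : nat -> nat,
     (forall eps : algC, 0 < eps ->
        exists M, forall m, (M <= m)%N -> (k m)%:R <= eps * m%:R) ->
   forall (a : algC) (nu : nat -> seq nat),
     balanced a (fun m => m * k m)%N nu ->
   forall s : forall m, {perm 'I_(m * k m)},
     (forall m, (0 < m)%N -> cycle_type (s m) = nseq (k m) m) ->
   forall eps : algC, 0 < eps ->
     exists M, forall m, (M <= m)%N ->
       `| mult r (s m) (nu m) * ((m ^ k m * (k m)`!)%N%:R / (@num_syt (m * k m) (nu m))%:R)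
          - 1 | < eps)
  /\
  (forall (a : algC) (nu : nat -> seq nat),
     balanced a (fun n => n) nu ->
   forall eps delta : algC, 0 < eps -> 0 < delta ->
     exists N, forall n, (N <= n)%N ->
       #|[set s : {perm 'I_n} |
           eps < `| mult r s (nu n) *
                     ((zlambda (cycle_type s))%:R / (@num_syt n (nu n))%:R) - 1 |]|%:R
         < delta * (n`!)%:R).
Proof.
split; [exact: rectangle_multiplicity | exact: random_multiplicity].
Qed.
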